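(* Let $M$ be a $(2k+1)$-dimensional closed regular contact manifold, with contact form $\eta$, and with a pseudo-Hermitian structure $(\eta,J)$. Assume that the Reeb vector field $\xi$, defined by $\eta(\xi)=1$ and $d\eta(\xi,\cdot)=0$, generates a periodic one-parameter transformation group of pseudo-Hermitian transformations. Then $|\pi_1(\mathrm{Psh}(M))|=\infty$.
   Context: A contact form on $M^{2k+1}$ is a one-form $\eta$ with $\eta\wedge(d\eta)^k$ nowhere zero; $(M,\eta)$ is called regular if every orbit of its Reeb vector field $\xi$ is periodic. A pseudo-Hermitian structure (CR structure) $(\eta,J)$ on $M$ consists of the contact form $\eta$ and a complex structure $J$ on the contact bundle $\mathrm{Ker}\,\eta$ (so $J^2=-\mathrm{id}$ on $\mathrm{Ker}\,\eta$) such that the Levi form $d\eta\circ J$ is a positive definite Hermitian form on $\mathrm{Ker}\,\eta$. The group of pseudo-Hermitian transformations is $$\mathrm{Psh}(M)=\{h\in\mathrm{Diff}(M):h^*\eta=\eta,\ h_*\circ J=J\circ h_*\text{ on }\mathrm{Ker}\,\eta\},$$ with the topology induced from $\mathrm{Diff}(M)$; $\pi_1$ is based at the identity. The hypothesis on $\xi$ means that the flow $\psi_t$ of $\xi$ satisfies $\psi_t\in\mathrm{Psh}(M)$ for all $t$ and $\psi_T=\mathrm{id}$ for some $T>0$. *)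

(* Defs.v *)
From HB Require Import structures.
From mathcomp Require Import all_boot all_order all_algebra all_fingroup.
From mathcomp Require Import all_classical all_reals all_analysis.
Set Implicit Arguments.
Unset Strict Implicit.
Unset Printing Implicit Defensive.
Import Order.TTheory GRing.Theory Num.Theory.
Import numFieldNormedType.Exports.
Local Open Scope classical_set_scope.
Local Open Scope ring_scope.

(** * Smooth functions on open subsets of R^n *)

Section Smooth.
Context {R : realType} {n : nat} {V : normedModType R}.

Fixpoint partials (s : seq 'I_n) (f : 'rV[R]_n -> V) : 'rV[R]_n -> V :=
  if s is i :: s' then fun x => 'D_(delta_mx 0 i) (partials s' f) x else f.

(* [U] is meant to be open, so that only the values of [f] on [U] matter. *)
Definition smooth_on (U : set 'rV[R]_n) (f : 'rV[R]_n -> V) :=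
  forall s x, U x ->
    {for x, continuous (partials s f)} /\
    forall i, derivable (partials s f) x (delta_mx 0 i).

End Smooth.

(** * Exterior algebra *)

Section Exterior.
Context {R : realType} {V : Type}.

Definition mform (m : nat) := ('I_m -> V) -> R.

Definition wedge p q (a : mform p) (b : mform q) : mform (p + q) := fun v =>
  ((p`! * q`!)%:R)^-1 * \sum_(s : 'S_(p + q))
    (-1) ^+ s * a (fun i => v (s (lshift q i))) * b (fun j => v (s (rshift p j))).

Fixpoint wedge_pow (b : mform 2) (k : nat) : mform k.*2 :=
  if k is k'.+1 return mform k.*2 then wedge b (@wedge_pow b k') else fun=> 1.

End Exterior.

Arguments wedge_pow {R V} b k _.

(** * Smooth manifolds *)

(* The atlas is a family of charts: [chart i] is a homeomorphism, with inverse
   [chart_inv i], from the open set [dom i] to an open subset of R^n.  The values of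
   [chart i] and [chart_inv i] outside of these sets are irrelevant.  There is no
   boundary. *)
Record manifold (R : realType) (n : nat) := Manifold {
  mspace :> topologicalType;
  space_hausdorff : hausdorff_space mspace;
  space_second_countable : @second_countable mspace;
  chart_index : Type;
  dom : chart_index -> set mspace;
  chart : chart_index -> mspace -> 'rV[R]_n;
  chart_inv : chart_index -> 'rV[R]_n -> mspace;
  dom_open : forall i, open (dom i);
  dom_cover : forall p, exists i, dom i p;
  chart_open : forall i, open (chart i @` dom i);
  chartK : forall i p, dom i p -> chart_inv i (chart i p) = p;
  chart_continuous : forall i, {within dom i, continuous (chart i)};
  chart_inv_continuous : forall i, 
    {within chart i @` dom i, continuous (chart_inv i)};
  transition_smooth : forall i j,
    smooth_on (chart i @` (dom i `&` dom j)) (chart j \o chart_inv i)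
}.

Arguments dom {R n m} i _.
Arguments chart {R n m} i _.
Arguments chart_inv {R n m} i _.

Definition closed_manifold (R : realType) (n : nat) (M : manifold R n) :=
  compact [set: M].

Section Manifold.
Context {R : realType} {n : nat} {M : manifold R n}.
Implicit Types (f g : M -> M) (i j : chart_index M) (p : M).

Definition local_rep f i j : 'rV[R]_n -> 'rV[R]_n := chart j \o f \o chart_inv i.

Definition smooth_map f := continuous f /\
  forall i j, smooth_on (chart i @` (dom i `&` f @^-1` dom j)) (local_rep f i j).

Definition is_diffeo f :=
  smooth_map f /\ exists g, [/\ cancel f g, cancel g f & smooth_map g].

(* A tangent vector at [p] is given by its row of components in a chart [i]
   around [p]; [tangent_map f i j p] is the differential of [f] at [p], read in
   the charts [i] around [p] and [j] around [f p].  For [f := idfun] it is the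
   change of components of tangent vectors at [p] from [i] to [j]. *)
Definition tangent_map f i j p : 'rV[R]_n -> 'rV[R]_n :=
  'd (local_rep f i j) (chart i p).

(* Evaluation of a covector, given by a column, on a tangent vector. *)
Definition pair_cv (v : 'rV[R]_n) (c : 'cV[R]_n) : R := (v *m c) 0 0.

Definition pullback_eq f (w : chart_index M -> M -> 'cV[R]_n) :=
  forall i j p v, dom i p -> dom j (f p) ->
    pair_cv (tangent_map f i j p v) (w j (f p)) = pair_cv v (w i p).

End Manifold.

(* Tensor fields are given by their components in each chart, subject to the
   usual transformation law; the component of index [i] is only relevant at the
   points of [dom i]. *)
Record one_form (R : realType) (n : nat) (M : manifold R n) := OneForm {
  form_comp :> chart_index M -> M -> 'cV[R]_n;
  form_coherent : pullback_eq idfun form_comp;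
  form_smooth : forall i, smooth_on (chart i @` dom i) (form_comp i \o chart_inv i)
}.

Record vector_field (R : realType) (n : nat) (M : manifold R n) := VectorField {
  field_comp :> chart_index M -> M -> 'rV[R]_n;
  field_coherent : forall i j p, dom i p -> dom j p ->
    tangent_map idfun i j p (field_comp i p) = field_comp j p;
  field_smooth : forall i, smooth_on (chart i @` dom i) (field_comp i \o chart_inv i)
}.

Section Forms.
Context {R : realType} {n : nat} {M : manifold R n}.

(* d eta (v, w) = v (eta w) - w (eta v) for [v] and [w] extended with constant
   components in the chart [i]. *)
Definition ext_d (eta : one_form M) (i : chart_index M) (p : M)
    (v w : 'rV[R]_n) : R :=
  'D_v (fun x => pair_cv w (eta i (chart_inv i x))) (chart i p) -
  'D_w (fun x => pair_cv v (eta i (chart_inv i x))) (chart i p).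

Definition is_flow (xi : vector_field M) (psi : R -> M -> M) :=
  (forall p, psi 0 p = p) /\
  forall p, continuous (psi^~ p) /\
    forall i t, dom i (psi t p) ->
      is_derive t (1 : R) (fun s => chart i (psi s p)) (xi i (psi t p)).

Definition periodic_orbits (psi : R -> M -> M) :=
  forall p, exists2 T : R, 0 < T & psi T p = p.

End Forms.

(** * Contact and pseudo-Hermitian structures *)

Definition is_contact (R : realType) (k : nat) (M : manifold R k.*2.+1)
    (eta : one_form M) :=
  forall (i : chart_index M) (p : M), dom i p ->
    exists v : 'I_(1 + k.*2) -> 'rV[R]_(k.*2.+1),
      wedge (fun u : 'I_1 -> _ => pair_cv (u ord0) (eta i p))
        (wedge_pow (fun u : 'I_2 -> _ => ext_d eta i p (u ord0) (u ord_max)) k)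
        v != 0.

Section Contact.
Context {R : realType} {n : nat} {M : manifold R n}.
Implicit Types (eta : one_form M) (f : M -> M).

Definition is_reeb eta (xi : vector_field M) :=
  forall (i : chart_index M) (p : M), dom i p ->
    pair_cv (xi i p) (eta i p) = 1 /\
    forall v, ext_d eta i p (xi i p) v = 0.

(* The tangent vectors at [p] that belong to Ker eta, in the chart [i]. *)
Definition ker_form eta (i : chart_index M) (p : M) : set 'rV[R]_n :=
  [set v | pair_cv v (eta i p) = 0].

Definition commutes_on_ker eta f (J : chart_index M -> M -> 'M[R]_n) :=
  forall i j p v, dom i p -> dom j (f p) -> ker_form eta i p v ->
    tangent_map f i j p (v *m J i p) = tangent_map f i j p v *m J j (f p).

(* (d eta o J)(v, w) = d eta (J v, w). *)
Definition levi eta (J : chart_index M -> M -> 'M[R]_n) i p (v w : 'rV[R]_n) :=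
  ext_d eta i p (v *m J i p) w.

End Contact.

(* The endomorphism J of Ker eta is the restriction to Ker eta of the matrix
   [J i p], acting on rows of components on the right; the values of this matrix
   outside of Ker eta are not constrained by any transformation law. *)
Record pseudo_hermitian (R : realType) (n : nat) (M : manifold R n)
    (eta : one_form M) := PseudoHermitian {
  cr_comp :> chart_index M -> M -> 'M[R]_n;
  cr_smooth : forall i, smooth_on (chart i @` dom i) (cr_comp i \o chart_inv i);
  cr_coherent : commutes_on_ker eta idfun cr_comp;
  cr_ker : forall i p v, dom i p -> ker_form eta i p v ->
    ker_form eta i p (v *m cr_comp i p);
  cr_square : forall i p v, dom i p -> ker_form eta i p v ->
    v *m cr_comp i p *m cr_comp i p = - v;
  levi_sym : forall i p v w, dom i p ->
    ker_form eta i p v -> ker_form eta i p w ->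
    levi eta cr_comp i p v w = levi eta cr_comp i p w v;
  levi_hermitian : forall i p v w, dom i p ->
    ker_form eta i p v -> ker_form eta i p w ->
    levi eta cr_comp i p (v *m cr_comp i p) (w *m cr_comp i p) =
    levi eta cr_comp i p v w;
  levi_pos : forall i p v, dom i p -> ker_form eta i p v -> v != 0 ->
    0 < levi eta cr_comp i p v v
}.

(** * The group of diffeomorphisms with the C^oo topology *)

Record diffeo (R : realType) (n : nat) (M : manifold R n) := Diffeo {
  diffeo_fun :> M -> M;
  diffeoP : is_diffeo diffeo_fun
}.

HB.instance Definition _ (R : realType) (n : nat) (M : manifold R n) :=
  gen_eqMixin (diffeo M).
HB.instance Definition _ (R : realType) (n : nat) (M : manifold R n) :=
  gen_choiceMixin (diffeo M).

Section DiffeoTopology.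
Context {R : realType} {n : nat} (M : manifold R n).

Definition diffeo_ball (f : diffeo M) (i j : chart_index M) (K : set M)
    (s : seq 'I_n) (e : R) : set (diffeo M) :=
  [set g | forall p, K p -> dom j (g p) /\
    `|partials s (local_rep g i j) (chart i p) -
      partials s (local_rep f i j) (chart i p)| < e].

Definition diffeo_subbase : set (set (diffeo M)) :=
  [set N | exists (f : diffeo M) i j K s e,
    [/\ compact K, K `<=` dom i, f @` K `<=` dom j, 0 < e &
        N = diffeo_ball f i j K s e]].

End DiffeoTopology.

Arguments diffeo_subbase {R n} M _.

HB.instance Definition _ (R : realType) (n : nat) (M : manifold R n) :=
  isSubBaseTopological.Build (diffeo M) (diffeo_subbase M) id.

Lemma smooth_idfun (R : realType) (n : nat) (M : manifold R n) :
  smooth_map (idfun : M -> M).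
Proof. by split=> [p|i j]; [exact: cvg_id|exact: transition_smooth]. Qed.

Definition diffeo_id (R : realType) (n : nat) (M : manifold R n) : diffeo M :=
  Diffeo (conj (smooth_idfun M)
    (ex_intro _ idfun (And3 (frefl _) (frefl _) (smooth_idfun M)))).

(** * Pseudo-Hermitian transformations *)

Definition Psh (R : realType) (n : nat) (M : manifold R n) (eta : one_form M)
    (J : pseudo_hermitian eta) : set (diffeo M) :=
  [set h | pullback_eq h eta /\ commutes_on_ker eta h J].

Lemma Psh_diffeo_id (R : realType) (n : nat) (M : manifold R n)
    (eta : one_form M) (J : pseudo_hermitian eta) :
  diffeo_id M \in Psh J.
Proof.
by apply/mem_set; split; [exact: form_coherent|exact: cr_coherent].
Qed.

(* [Psh J], as a type, carries the topology induced from [diffeo M]. *)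
Definition Psh_id (R : realType) (n : nat) (M : manifold R n)
    (eta : one_form M) (J : pseudo_hermitian eta) : Psh J :=
  exist _ (diffeo_id M) (Psh_diffeo_id J).

(** * Fundamental group *)

Section FundamentalGroup.
Context (R : realType) {T : topologicalType}.
Implicit Types (x : T) (c d : R -> T).

Definition is_loop x c :=
  [/\ {within `[0, 1], continuous c}, c 0 = x & c 1 = x].

Definition loop_homotopic x c d := exists H : R * R -> T,
  [/\ {within `[0, 1] `*` `[0, 1], continuous H},
      {in `[0, 1], forall t, H (0, t) = c t},
      {in `[0, 1], forall t, H (1, t) = d t} &
      {in `[0, 1], forall s, H (s, 0) = x /\ H (s, 1) = x}].

(* The underlying set of pi_1 (T, x): the homotopy classes of loops at x. *)
Definition pi1 x : set (set (R -> T)) :=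
  [set C | exists2 c, is_loop x c &
                      C = [set d | is_loop x d /\ loop_homotopic x c d]].

End FundamentalGroup.

Arguments pi1 R {T} x _.

(* Main.v *)
Require Import Defs.
From HB Require Import structures.
From mathcomp Require Import all_boot all_order all_algebra fingroup perm.
From mathcomp Require Import all_classical all_reals all_analysis.
From mathcomp Require Import ring lra zify.
Set Implicit Arguments.
Unset Strict Implicit.
Unset Printing Implicit Defensive.
Import Order.TTheory GRing.Theory Num.Theory.
Import numFieldNormedType.Exports.
Local Open Scope classical_set_scope.
Local Open Scope ring_scope.

(** The loops [gam n : t |-> psi_(n T t)] are pairwise non-homotopic.  An element of
   [Psh J] preserves [eta], hence [d eta] and [xi], hence commutes with the circle
   action [act a = psi_(T a)].  So a homotopy from [gam n] to [gam n'] is a family of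
   maps [H s t : M -> M] commuting with the action, with [H 0 t = act (n t)],
   [H 1 t = act (n' t)] and [H s 0 = H s 1 = id].

   As [xi] does not vanish, finitely many functions [f_1, ..., f_q : M -> C] with
   [f_l (act a x) = exp (2 i pi w_l a) f_l x] and [w_l <> 0] have no common zero:
   take Fourier coefficients along the orbits of bump functions.  Put
   [F_l (s_1, t_1, ..., s_q, t_q) = f_l (H s_1 t_1 (... (H s_q t_q p)))].  Where
   [F_l <> 0], the form [d (arg F_l) / (2 pi) - w_l sum_j (n + (n' - n) s_j) dt_j] is
   compatible with the identifications that turn each square [(s_j, t_j)] into a
   sphere, and minus its differential is [w_l (n' - n) A] with [A = sum_j ds_j dt_j].
   The open sets [F_l <> 0] cover, so the product over [l] of these classes vanishes,
   whereas [A^q] is [q!] times the fundamental class of [(S^2)^q].  Cochains on fine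
   triangulated grids replace differential forms, as [F_l] is only continuous.

   That [gam n] is continuous for the C^oo topology requires the joint continuity of
   the derivatives of [psi_t]: it follows from Baire's theorem at some time, hence
   from the group law at all times. *)

(** * Cochains on triangulated grids *)

(** A Reeb orbit may be contractible in [M], as on odd spheres, so evaluating the loops [gam n] at a
    point of [M] need not separate them. A single function of nonzero weight without zeros would
    settle the matter by its winding number, but none exists on [S^3] with the Hopf action; hence
    several functions that only jointly have no zero.

    In terms of bundles, [F_l] is a section of a line bundle over (S^2)^q whose Chern class is
    [w_l (n' - n) A] up to sign. The [F_l] have no common zero, so the sum of these line bundles has
    a section without zeros and its Euler class vanishes; yet this class is a nonzero multiple of
    [A^q]. This is why [q] copies of the homotopy are composed, one for each function: on a product
    of fewer spheres [A^q] is already zero. Commutation with the action is what allows the rotation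
    of the [j]-th map on the sides [s_j = 0] and [s_j = 1] to be carried through the other maps.

    The vanishing of the product is a Stokes formula on the cube: the two cup products to be
    compared differ by a coboundary, and its boundary terms vanish because each face is collapsed to
    lower dimension. *)

Section Cochains.
Context {R : comNzRingType} {P : Type}.
Implicit Types (f g : (nat -> P) -> R) (x : nat -> P).

(** A simplex is an infinite sequence of vertices of which a [k]-cochain reads only the entries [0]
    to [k] ([has_degree]), so that degrees stay out of the types. As [bump j] skips [j],
    [x \o bump j] is the [j]-th face. *)
Definition coboundary (k : nat) f : (nat -> P) -> R := fun x =>
  \sum_(j < k.+2) (-1) ^+ j * f (x \o bump j).

Definition cup (k : nat) f g : (nat -> P) -> R := fun x =>
  f x * g (fun i => x (k + i)%N).

Definition has_degree (k : nat) f :=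
  forall x y, (forall i, (i <= k)%N -> x i = y i) -> f x = f y.

(** Omitting one of the vertices [0] to [k] leaves to [g] the vertices from [k.+1] on; omitting a
    later one leaves [f] unchanged. Each product on the right has one term more, from the last face
    for [f] and the first face for [g]; these two terms are opposite. *)
Lemma coboundary_cup k l f g x : has_degree k f -> has_degree l g ->
  coboundary (k + l) (cup k f g) x =
  cup k.+1 (coboundary k f) g x + (-1) ^+ k * cup k f (coboundary l g) x.
Proof.
move=> fk gl; set y := fun i => x (k + i)%N; set z := fun i => x (k.+1 + i)%N.
have -> : coboundary (k + l) (cup k f g) x =
    (\sum_(i < k.+1) (-1) ^+ i * f (x \o bump i)) * g z +
    (-1) ^+ k * (f x * \sum_(i < l.+1) (-1) ^+ (i.+1) * g (y \o bump i.+1)).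
  rewrite /coboundary /cup (_ : (k + l).+2 = (k.+1 + l.+1)%N); last by lia.
  rewrite big_split_ord/= mulr_suml !mulr_sumr; congr (_ + _).
    apply: eq_bigr => i _; rewrite -mulrA; congr (_ * (_ * _)).
    apply: gl => m _ /=; rewrite /bump; case: i => i /= ik.
    by rewrite (_ : (i <= k + m)%N) //; lia.
  apply: eq_bigr => i _.
  have -> : f (x \o bump (k.+1 + i)) = f x.
    by apply: fk => m mk /=; rewrite /bump (_ : (_ <= m)%N = false) //; lia.
  rewrite (_ : g _ = g (y \o bump i.+1)); last first.
    apply: gl => m _ /=; rewrite /bump /y; congr x.
    by rewrite addSnnS leq_add2l addnCA.
  by rewrite !addSn !exprS exprD; ring.
rewrite /cup -/y -/z.
have -> : coboundary k f x = \sum_(i < k.+1) (-1) ^+ i * f (x \o bump i) +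
    (-1) ^+ k.+1 * f x.
  rewrite /coboundary big_ord_recr/=; congr (_ + _ * _).
  by apply: fk => i ik /=; rewrite /bump ltnNge ik.
have -> : coboundary l g y = g z +
    \sum_(i < l.+1) (-1) ^+ (i.+1) * g (y \o bump i.+1).
  rewrite /coboundary big_ord_recl/= mul1r; congr (_ + _).
  by apply: gl => i _; rewrite /= /y /z /bump addnS.
by rewrite exprS; ring.
Qed.

Lemma has_degree_cup k l f g : has_degree k f -> has_degree l g ->
  has_degree (k + l) (cup k f g).
Proof.
move=> fk gl x y xy; rewrite /cup; congr (_ * _).
  by apply: fk => i ik; apply: xy; lia.
by apply: gl => i il; apply: xy; lia.
Qed.

Definition cochain1 (b : P -> P -> R) : (nat -> P) -> R :=
  fun x => b (x 0%N) (x 1%N).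

Definition cochain2 (a : P -> P -> P -> R) : (nat -> P) -> R :=
  fun x => a (x 0%N) (x 1%N) (x 2%N).

Definition coboundary1 (b : P -> P -> R) (x y z : P) := b y z - b x z + b x y.

Lemma coboundary_cochain1 b x :
  coboundary 1 (cochain1 b) x = cochain2 (coboundary1 b) x.
Proof.
rewrite /coboundary !big_ord_recr/= big_ord0 /cochain1 /cochain2 /coboundary1/=.
by rewrite /bump/= expr0 expr1 sqrrN expr1n; ring.
Qed.

Lemma coboundary_coboundary1 b x :
  coboundary 2 (cochain2 (coboundary1 b)) x = 0.
Proof.
rewrite /coboundary !big_ord_recr/= big_ord0 /cochain2 /coboundary1/=.
by rewrite /bump/= expr0 expr1 sqrrN expr1n !exprS expr0; ring.
Qed.

Lemma has_degree_cochain1 b : has_degree 1 (cochain1 b).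
Proof. by move=> x y xy; rewrite /cochain1 !xy. Qed.

Lemma has_degree_cochain2 a : has_degree 2 (cochain2 a).
Proof. by move=> x y xy; rewrite /cochain2 !xy. Qed.

Definition cups (s : seq (P -> P -> P -> R)) : (nat -> P) -> R :=
  foldr (fun a f => cup 2 (cochain2 a) f) (fun=> 1) s.

Lemma has_degree_cups s : has_degree (size s).*2 (cups s).
Proof.
elim: s => [//|a s IH] /=.
rewrite (_ : (size s).+1.*2 = (2 + (size s).*2)%N); last by lia.
by apply: has_degree_cup IH; exact: has_degree_cochain2.
Qed.

Lemma coboundary_cups s x :
  (forall a, List.In a s -> forall x, coboundary 2 (cochain2 a) x = 0) ->
  coboundary (size s).*2 (cups s) x = 0.
Proof.
elim: s x => [|a s IH] x s0 /=.
  by rewrite /coboundary !big_ord_recr big_ord0/= expr0 expr1; ring.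
rewrite (_ : (size s).+1.*2 = (2 + (size s).*2)%N); last by lia.
rewrite coboundary_cup; [|exact: has_degree_cochain2|exact: has_degree_cups].
rewrite /cup s0 /=; last by left.
by rewrite IH ?mul0r ?mulr0 ?addr0// => b bs; apply: s0; right.
Qed.

Definition perturb (p : (P -> P -> P -> R) * (P -> P -> R)) : P -> P -> P -> R :=
  fun u v w => p.1 u v w + coboundary1 p.2 u v w.

(* A cochain whose coboundary is the difference between the cup product of the
   cocycles [p.1 + delta p.2] and that of the cocycles [p.1]. *)
Fixpoint transgression (s : seq ((P -> P -> P -> R) * (P -> P -> R))) :
    (nat -> P) -> R :=
  if s is p :: s' then fun x =>
    cup 2 (cochain2 p.1) (transgression s') x +
    cup 1 (cochain1 p.2) (cups (map perturb s')) x
  else fun=> 0.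

Lemma coboundaryD k f g x :
  coboundary k (fun x => f x + g x) x = coboundary k f x + coboundary k g x.
Proof.
by rewrite /coboundary -big_split; apply: eq_bigr => i _; rewrite mulrDr.
Qed.

Lemma has_degree_transgression s :
  has_degree (size s).*2.-1 (transgression s).
Proof.
elim: s => [//|p s IH] x y xy /=; congr (_ + _).
  (* For an empty tail the degree [(size s).*2.-1] is truncated at [0], but the tail of the
     transgression is then zero. *)
  case: s IH xy => [|p' s] IH xy; first by rewrite /cup/= !mulr0.
  apply: (has_degree_cup (@has_degree_cochain2 p.1) IH) => i il.
  by apply: xy; move: il => /=; lia.
have := has_degree_cup (@has_degree_cochain1 p.2)
  (@has_degree_cups (map perturb s)).
by apply=> i; rewrite size_map => il; apply: xy; rewrite /=; lia.
Qed.

(** Telescoping: [a' b' - a b = a (b' - b) + (a' - a) b'], where [a' - a] is the coboundary of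
    [p.2]. The Leibniz rule turns the two summands of the transgression into these two terms, since
    [a] and the perturbed tail [b'] are closed and [a] has even degree. *)
Lemma coboundary_transgression s x :
  (forall p, List.In p s -> forall x, coboundary 2 (cochain2 p.1) x = 0) ->
  coboundary (size s).*2.-1 (transgression s) x =
  cups (map perturb s) x - cups (map fst s) x.
Proof.
elim: s x => [|p s IH] x s0 /=.
  by rewrite /coboundary big1 ?subrr// => i _; rewrite mulr0.
have {}IH y := IH y (fun p' p's => s0 p' (or_intror p's)).
have p0 y : coboundary 2 (cochain2 p.1) y = 0 by apply: s0; left.
have q0 y : coboundary (size s).*2 (cups (map perturb s)) y = 0.
  rewrite -(size_map perturb); apply: coboundary_cups => a.
  elim: (s) s0 => [//|p' s' IHs] s0 /= [<- z|].
    transitivity (coboundary 2 (cochain2 p'.1) z +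
        coboundary 2 (cochain2 (coboundary1 p'.2)) z).
      by rewrite -coboundaryD.
    by rewrite coboundary_coboundary1 addr0 s0 //; right; left.
  by apply: IHs => p'' [<-|H]; apply: s0; [left|right; right].
rewrite coboundaryD.
have -> : coboundary (size s).*2.+1
    (cup 2 (cochain2 p.1) (transgression s)) x =
    cochain2 p.1 x * (cups (map perturb s) (fun i => x (2 + i)%N) -
      cups (map fst s) (fun i => x (2 + i)%N)).
  rewrite -IH; case: (s) => [|p' s'] /=.
    by rewrite /coboundary !big1 ?mulr0// => i _; rewrite /cup !mulr0.
  rewrite (_ : (size s').+1.*2.+1 = (2 + (size s').+1.*2.-1)%N); last by lia.
  rewrite (coboundary_cup _ (@has_degree_cochain2 p.1)
    (@has_degree_transgression (p' :: s'))).
  by rewrite /cup p0 mul0r add0r sqrrN expr1n mul1r.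
rewrite -[X in coboundary X (cup 1 _ _)]add1n.
have dq := @has_degree_cups (map perturb s); rewrite size_map in dq.
rewrite (coboundary_cup _ (@has_degree_cochain1 p.2) dq).
rewrite /cup q0 mulr0 mulr0 addr0 coboundary_cochain1 {1 3}/cochain2 /perturb.
by rewrite /cochain2; ring.
Qed.

(* [F] is a face and [E x y] says that [x] and [y] have the same image when the
   face is collapsed. *)
Definition collapses (F : P -> Prop) (E : P -> P -> Prop) k f := forall x,
  (forall i, (i <= k)%N -> F (x i)) ->
  (exists2 i, (i < k)%N & E (x i) (x i.+1)) -> f x = 0.

(** The two factors share only the vertex [k], so the collapsed edge belongs to one of them, and
    that one vanishes. *)
Lemma collapses_cup F E k l f g : collapses F E k f -> collapses F E l g ->
  collapses F E (k + l) (cup k f g).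
Proof.
move=> fk gl x xF [i ikl Ei]; rewrite /cup.
have [ik|ki] := ltnP i k.
  by rewrite fk ?mul0r//; [move=> j jk; apply: xF; lia|exists i].
rewrite gl ?mulr0//; first by move=> j jl; apply: xF; lia.
by exists (i - k)%N; [lia|rewrite addnS subnKC].
Qed.

Lemma collapses_cups F E s :
  (forall a, List.In a s -> collapses F E 2 (cochain2 a)) ->
  collapses F E (size s).*2 (cups s).
Proof.
elim: s => [_ x _ []//|a s IH] sc /=.
rewrite (_ : (size s).+1.*2 = (2 + (size s).*2)%N); last by lia.
apply: collapses_cup; first by apply: sc; left.
by apply: IH => b bs; apply: sc; right.
Qed.

Lemma collapses_transgression F E s :
  (forall p, List.In p s -> [/\ collapses F E 2 (cochain2 p.1),
     collapses F E 1 (cochain1 p.2) & collapses F E 2 (cochain2 (coboundary1 p.2))]) ->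
  collapses F E (size s).*2.-1 (transgression s).
Proof.
elim: s => [//|p s IH] sc x /= xF xE.
have [p1 p2 _] := sc p (or_introl erefl).
have {}IH := IH (fun p' p's => sc p' (or_intror p's)).
rewrite [X in _ + X](_ : _ = 0) ?addr0; last first.
  have cs : collapses F E (size s).*2 (cups (map perturb s)).
    rewrite -(size_map perturb); apply: collapses_cups => a.
    elim: (s) sc => [//|p' s' IHs] sc /= [<-|].
      have [c1 _ c2] := sc p' (or_intror (or_introl erefl)).
      move=> y yF yE; move: (c1 y yF yE) (c2 y yF yE).
      by rewrite /cochain2 /perturb => -> ->; rewrite addr0.
    by apply: IHs => p'' [<-|H]; apply: sc; [left|right; right].
  by apply: (collapses_cup p2 cs) => //.
case: s {sc} IH xF xE => [|p' s] IH xF xE; first by rewrite /cup mulr0.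
by apply: (collapses_cup p1 IH).
Qed.

End Cochains.

(** * The Kuhn triangulation of a cube *)

Section Kuhn.
Context {R : realDomainType}.

(* The vertices of the simplex of the Kuhn triangulation of the cube with least
   vertex [x] whose edges are parallel to the axes [s 0], [s 1], ... *)
Definition kuhn_path n (x : {ffun 'I_n -> nat}) (s : 'S_n) (k : nat) :
  {ffun 'I_n -> nat} := [ffun i => (x i + (s^-1%g i < k))%N].

Definition grid_point n m (x : {ffun 'I_n -> 'I_m.+1}) : {ffun 'I_n -> nat} :=
  [ffun i => val (x i)].

(** The value of a cochain on the fundamental chain of the cube of side [m.+1]: the unit cube with
    least vertex [x] is cut into one simplex for each permutation, oriented by the sign. *)
Definition grid_sum n m (f : (nat -> {ffun 'I_n -> nat}) -> R) : R :=
  \sum_(x : {ffun 'I_n -> 'I_m.+1}) \sum_(s : 'S_n)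
    (-1) ^+ s * f (kuhn_path (grid_point x) s).

(** The shift is compared with a cyclic one: [ordS] differs from adding one only at the value [m],
    where one sum evaluates [g] at [m.+1] and the other at [0], with value zero in both cases. *)
Lemma grid_sum_shift n m (g : {ffun 'I_n -> nat} -> R) (i : 'I_n) :
  (forall x : {ffun 'I_n -> nat}, x i \in [:: 0; m.+1]%N -> g x = 0) ->
  \sum_(x : {ffun 'I_n -> 'I_m.+1}) g [ffun j => (grid_point x j + (j == i))%N] =
  \sum_(x : {ffun 'I_n -> 'I_m.+1}) g (grid_point x).
Proof.
move=> g0.
pose h (x : {ffun 'I_n -> 'I_m.+1}) :=
  [ffun j => if j == i then ordS (x j) else x j].
pose h' (x : {ffun 'I_n -> 'I_m.+1}) :=
  [ffun j => if j == i then ord_pred (x j) else x j].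
have hK : cancel h h'.
  by move=> x; apply/ffunP => j; rewrite !ffunE; case: eqP => // _; rewrite ordSK.
have h'K : cancel h' h.
  by move=> x; apply/ffunP => j; rewrite !ffunE; case: eqP => // _; rewrite ord_predK.
rewrite [RHS](reindex h) /=; last by exists h' => x _; [exact: hK|exact: h'K].
apply: eq_bigr => x _; have [xm|xm] := eqVneq (val (x i)) m.
  rewrite !g0// !ffunE eqxx ?xm ?addn1 ?inE ?eqxx ?orbT//.
  by rewrite /= xm modnn.
congr g; apply/ffunP => j; rewrite !ffunE; case: eqP => [->|_]; last by rewrite addn0.
rewrite /= addn1 modn_small//; move: xm (ltn_ord (x i)) => /=; lia.
Qed.

(* The inner terms of the coboundary cancel under transpositions, and the outer
   ones telescope. *)
Lemma grid_sum_coboundary n m (f : (nat -> {ffun 'I_n.+1 -> nat}) -> R) :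
  has_degree n f ->
  (forall (x : {ffun 'I_n.+1 -> nat}) (s : 'S_n.+1), x (s ord_max) \in [:: 0; m.+1]%N ->
     f (kuhn_path x s) = 0) ->
  grid_sum m (coboundary n f) = 0.
Proof.
move=> fn f0; pose T (j : nat) := \sum_(x : {ffun 'I_n.+1 -> 'I_m.+1})
  \sum_(s : 'S_n.+1) (-1) ^+ s * f (kuhn_path (grid_point x) s \o bump j).
have -> : grid_sum m (coboundary n f) = \sum_(j < n.+2) (-1) ^+ j * T j.
  rewrite /grid_sum /coboundary /T; under [RHS]eq_bigr => j _.
    rewrite mulr_sumr; under eq_bigr => x _ do rewrite mulr_sumr.
    over.
  rewrite [RHS]exchange_big/=; apply: eq_bigr => x _.
  rewrite [RHS]exchange_big/=; apply: eq_bigr => s _.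
  by rewrite mulr_sumr; apply: eq_bigr => j _; rewrite mulrCA.
have T_inner j : (j < n)%N -> T j.+1 = 0.
  (* The paths of [s] and of [t * s] differ only in the vertex [j.+1], which the face omits, and
     have opposite signs. *)
  move=> jn; pose t : 'S_n.+1 := tperm (inord j) (inord j.+1).
  suff : T j.+1 = - T j.+1 by move/eqP; rewrite -addr_eq0 -mulr2n mulrn_eq0 => /eqP.
  rewrite {1}/T -sumrN; apply: eq_bigr => x _.
  rewrite [LHS](reindex_inj (mulgI t)) -sumrN; apply: eq_bigr => s _.
  rewrite odd_permM odd_tperm -val_eqE /= !inordK ?(ltnW jn)//; last by lia.
  rewrite (_ : j != j.+1) /=; last by lia.
  rewrite signrN mulNr; congr (- (_ * _)); apply: fn => k _ /=.
  apply/ffunP => i; rewrite !ffunE invMg permM tpermV; congr (_ + nat_of_bool _)%N.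
  rewrite /t; case: tpermP => [->|->|//]; rewrite !inordK ?(ltnW jn)//;
    by rewrite /bump; case: leqP; lia.
rewrite big_ord_recl big_ord_recr/= big1 ?add0r; last first.
  by move=> i _; rewrite /= /bump/= add1n T_inner ?mulr0.
pose S := \sum_(x : {ffun 'I_n.+1 -> 'I_m.+1})
  \sum_(s : 'S_n.+1) (-1) ^+ s * f (kuhn_path (grid_point x) s).
have -> : T (bump 0 n) = S.
  apply: eq_bigr => x _; apply: eq_bigr => s _; congr (_ * _); apply: fn => k kn /=.
  by rewrite /bump/= add1n ltnNge kn.
suff -> : T 0%N = (-1) ^+ n * S by rewrite /bump/= add1n exprS; ring.
(* [r^-1 * s] traverses the axis [s ord_max] first and the others in the order of [s]. Without its
   first vertex, its path is the path of [s] from the neighbouring cube in the direction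
   [s ord_max], without its last vertex. The sign of [r] is that of a cycle of length [n.+1]. *)
pose r : 'S_n.+1 := lift_perm ord_max ord0 1.
rewrite /T /S exchange_big/= [in RHS]exchange_big/=.
rewrite [LHS](reindex_inj (mulgI r^-1%g)) /= mulr_sumr; apply: eq_bigr => s _.
rewrite -!mulr_sumr odd_permM odd_permV odd_lift_perm odd_perm1/= !addbF.
rewrite signr_addb signr_odd mulrA; congr (_ * _).
rewrite -(@grid_sum_shift _ _ (fun x => f (kuhn_path x s)) (s ord_max)); last first.
  by move=> x; exact: f0.
apply: eq_bigr => x _; apply: fn => k kn /=; apply/ffunP => i; rewrite !ffunE.
rewrite invMg invgK permM -addnA; congr (_ + _)%N.
rewrite -{2}[i](permKV s); set p := (s^-1)%g i; rewrite (inj_eq perm_inj).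
case: (unliftP ord_max p) => [q ->|->]; last first.
  by rewrite lift_perm_id eqxx /bump/= ltnNge kn.
have qn : (q < n)%N := ltn_ord q.
rewrite lift_perm_lift perm1 eq_sym (negbTE (neq_lift _ _)) /= /bump.
by rewrite (leqNgt n q) qn /= !add1n !add0n ltnS.
Qed.

(** * The area class on a product of squares *)

Section Area.
Variable q : nat.
Implicit Types x y z : {ffun 'I_(q + q) -> nat}.

(** [lshift q j] is the coordinate [s_j] and [rshift q j] the coordinate [t_j]: this is a discrete
    form of the sum of the [s_j dt_j]. *)
Definition area_form x y : R :=
  \sum_(j < q) (x (lshift q j))%:R * ((y (rshift q j))%:R - (x (rshift q j))%:R).

Definition area x y z : R :=
  \sum_(j < q) ((y (lshift q j))%:R - (x (lshift q j))%:R) *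
               ((z (rshift q j))%:R - (y (rshift q j))%:R).

Lemma coboundary_area_form : coboundary1 area_form = area.
Proof.
apply: boolp.funext => x; apply: boolp.funext => y; apply: boolp.funext => z.
rewrite /coboundary1 /area_form -sumrB -big_split/=.
by apply: eq_bigr => j _; ring.
Qed.

Lemma cups_prod (a : 'I_q -> {ffun 'I_(q + q) -> nat} ->
    {ffun 'I_(q + q) -> nat} -> {ffun 'I_(q + q) -> nat} -> R)
    (x : nat -> {ffun 'I_(q + q) -> nat}) :
  cups [seq a l | l <- enum 'I_q] x =
  \prod_(l < q) a l (x l.*2) (x l.*2.+1) (x l.*2.+2).
Proof.
have cupsE (s : seq ({ffun 'I_(q + q) -> nat} -> {ffun 'I_(q + q) -> nat} ->
    {ffun 'I_(q + q) -> nat} -> R)) (y : nat -> _) :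
  cups s y = \prod_(l < size s)
    nth (fun _ _ _ => 0) s l (y l.*2) (y l.*2.+1) (y l.*2.+2).
  elim: s y => [|t s IH] y /=; first by rewrite big_ord0.
  by rewrite /cup IH big_ord_recl /=; congr (_ * _); apply: eq_bigr.
rewrite cupsE size_map size_enum_ord; apply: eq_bigr => l _.
by rewrite (nth_map l) ?size_enum_ord// nth_ord_enum.
Qed.

(** A cup product of 2-cochains reads the edges of a path in consecutive pairs, whereas ['I_(q + q)]
    lists all [s_j] before all [t_j]. This is the passage to the order [s_1, t_1, s_2, t_2, ...]. *)
Definition interleave (p : 'I_(q + q)) : nat :=
  match fintype.split p with inl l => l.*2 | inr l => l.*2.+1 end.

Lemma interleave_lt p : (interleave p < q + q)%N.
Proof. by rewrite /interleave; case: splitP => l _; have := ltn_ord l; lia. Qed.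

Lemma interleave_inj : injective (fun p => Ordinal (interleave_lt p)).
Proof.
move=> p p' /(congr1 val) /=; rewrite /interleave.
case: splitP => l pl; case: splitP => l' pl' ll'; apply: ord_inj; rewrite ?pl ?pl'; lia.
Qed.

(** All unit cubes contribute equally. Expanding the product of the areas chooses a map [f] from
    factors to squares; the signed sum over paths is then the determinant of two diagonal copies of
    [P f], hence a square. It is [1] when [f] is a permutation and [0] otherwise, whence [q!];
    nonnegativity and the term of the identity are enough here. *)
Lemma grid_sum_area_neq0 m (d : 'I_q -> R) : (forall l, d l != 0) ->
  grid_sum m (cups [seq (fun x y z => d l * area x y z) | l <- enum 'I_q]) != 0.
Proof.
move=> d0.
pose P (f : {ffun 'I_q -> 'I_q}) : 'M[R]_q := \matrix_(l, j) (j == f l)%:R.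
pose c := \prod_l d l * \sum_(f : {ffun 'I_q -> 'I_q}) \det (P f) ^+ 2.
pose r : 'S_(q + q) := perm interleave_inj.
suff -> : grid_sum m (cups [seq (fun x y z => d l * area x y z) | l <- enum 'I_q])
    = \sum_(x : {ffun 'I_(q + q) -> 'I_m.+1}) (-1) ^+ r * c.
  rewrite sumr_const -mulr_natr !mulf_neq0 ?signr_eq0//.
  - by apply/prodf_neq0 => l _.
  - rewrite (bigD1 [ffun l => l]) //= paddr_eq0 ?sqr_ge0 ?sumr_ge0//; last first.
      by move=> *; exact: sqr_ge0.
    rewrite negb_and (_ : P _ = 1%:M) ?det1 ?expr1n ?oner_eq0//.
    by apply/matrixP => l j; rewrite !mxE ffunE eq_sym.
  - by rewrite pnatr_eq0 -lt0n card_ffun card_ord expn_gt0.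
apply: eq_bigr => x _.
rewrite (reindex_inj (mulgI r^-1%g)) /=.
under eq_bigr => s _.
  rewrite odd_permM odd_permV signr_addb -mulrA; over.
rewrite -mulr_sumr; congr (_ * _).
pose B f := block_mx (P f) 0 0 (P f).
have BE f p i : B f p i = (i == match fintype.split p with
    inl l => lshift q (f l) | inr l => rshift q (f l) end)%:R.
  have [[j ->]|[j ->]] : (exists j, i = lshift q j) \/ exists j, i = rshift q j.
  - case: (splitP i) => j ij; [left|right]; exists j; exact: val_inj.
  - rewrite /B; case: splitP => l pl.
      rewrite (_ : p = lshift q l) ?block_mxEul ?mxE ?eq_lshift//; exact: val_inj.
    by rewrite (_ : p = rshift q l) ?block_mxEdl ?mxE ?eq_lrshift//; exact: val_inj.
  - rewrite /B; case: splitP => l pl.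
      by rewrite (_ : p = lshift q l) ?block_mxEur ?mxE ?eq_rlshift//; exact: val_inj.
    by rewrite (_ : p = rshift q l) ?block_mxEdr ?mxE ?eq_rshift//; exact: val_inj.
have -> : c = \prod_l d l * \sum_f \det (B f).
  by congr (_ * _); apply: eq_bigr => f _; rewrite expr2 -(det_ublock _ 0).
rewrite /determinant.
rewrite exchange_big mulr_sumr /=; apply: eq_bigr => s _.
rewrite -mulr_sumr mulrCA; congr (_ * _).
rewrite cups_prod big_split /=; congr (_ * _).
(* The edge of index [interleave k] in the path of [r^-1 * s] is parallel to the axis [s k]. *)
have stepE i (k : 'I_(q + q)) (k' : nat) : k' = interleave k ->
    ((kuhn_path (grid_point x) (r^-1 * s) k'.+1 i)%:R -
     (kuhn_path (grid_point x) (r^-1 * s) k' i)%:R : R) = (s k == i)%:R.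
  move=> ->; rewrite !ffunE !natrD opprD addrACA subrr add0r.
  rewrite invMg invgK permM ltnS -(permKV s i) (inj_eq perm_inj) permK.
  set p := (s^-1)%g i; have -> : (k == p) = (interleave k == interleave p).
    by rewrite -(inj_eq interleave_inj).
  rewrite permE /=; case: ltngtP => _; by rewrite ?subrr ?subr0.
have splitl l : fintype.split (lshift q l) = inl l :> 'I_q + 'I_q by exact: (unsplitK (inl l)).
have splitr l : fintype.split (rshift q l) = inr l :> 'I_q + 'I_q by exact: (unsplitK (inr l)).
rewrite /area; under eq_bigr => l _.
  under eq_bigr => j _.
    rewrite (@stepE _ (lshift q l)); last by rewrite /interleave splitl.
    rewrite (@stepE _ (rshift q l)); last by rewrite /interleave splitr.
    over.
  over.
rewrite bigA_distr_bigA /=; apply: eq_bigr => f _.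
rewrite big_split_ord /= -big_split /=; apply: eq_bigr => l _.
by rewrite !BE splitl splitr.
Qed.

Definition partner (e : 'I_(q + q)) : 'I_(q + q) :=
  match fintype.split e with inl j => rshift q j | inr j => lshift q j end.

Lemma partner_lshift j : partner (lshift q j) = rshift q j.
Proof. by rewrite /partner (unsplitK (inl j)). Qed.

Lemma partner_rshift j : partner (rshift q j) = lshift q j.
Proof. by rewrite /partner (unsplitK (inr j)). Qed.

Lemma partnerK : involutive partner.
Proof.
move=> e; case: (fintype.splitP e) => j ej.
  have -> : e = lshift q j by exact: val_inj.
  by rewrite partner_lshift partner_rshift.
have -> : e = rshift q j by exact: val_inj.
by rewrite partner_rshift partner_lshift.
Qed.

Lemma partner_neq e : partner e != e.
Proof.
case: (fintype.splitP e) => j ej.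
  have -> : e = lshift q j by exact: val_inj.
  by rewrite partner_lshift eq_rlshift.
have -> : e = rshift q j by exact: val_inj.
by rewrite partner_rshift eq_lrshift.
Qed.

(** A side of the [j]-th square fixes one of [s_j], [t_j], and collapsing it forgets the other one.
    So on a face where [e] is extremal, points that agree off [partner e] are identified. *)
Definition agree_off (e : 'I_(q + q)) x y := forall i, i != e -> x i = y i.

(** If the increment of a term along the collapsed edge is not in the direction [partner e], it
    vanishes; if it is, the other increment of the term is along [e], which is constant on the
    face. *)
Lemma collapses_area e v :
  collapses (fun x => x e = v) (agree_off (partner e)) 2 (cochain2 area).
Proof.
move=> x xe [i i2 xE]; rewrite /cochain2 /area big1// => j _.
have l0 : lshift q j = partner e -> rshift q j = e.
  by rewrite -partner_lshift => ->; rewrite partnerK.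
have r0 : rshift q j = partner e -> lshift q j = e.
  by rewrite -[lshift q j]partner_rshift => ->; rewrite partnerK.
case: i i2 xE => [|[|//]] _ xE.
  have [/l0 ->|/xE ->] := eqVneq (lshift q j) (partner e).
    by rewrite !xe// subrr mulr0.
  by rewrite subrr mul0r.
have [/r0 ->|/xE ->] := eqVneq (rshift q j) (partner e).
  by rewrite !xe// subrr mul0r.
by rewrite subrr mulr0.
Qed.

End Area.

(* Discrete form of the fact that the [q]-th power of the class of area forms of
   (S^2)^q does not vanish, so that (S^2)^q is not covered by [q] open sets on each
   of which this class vanishes.  A factor S^2 is a square each of whose sides is
   collapsed to a point. *)
Lemma no_area_primitives q m (d : 'I_q -> R)
    (b : 'I_q -> {ffun 'I_(q + q) -> nat} -> {ffun 'I_(q + q) -> nat} -> R) :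
  (0 < q)%N -> (forall l, d l != 0) ->
  (forall l e (x y z : {ffun 'I_(q + q) -> nat}), x e \in [:: 0; m.+1]%N ->
    y e = x e -> z e = x e -> agree_off (partner e) x y ->
    [/\ b l x y = 0, b l x z = b l y z & b l z x = b l z y]) ->
  (forall (x : {ffun 'I_(q + q) -> 'I_m.+1}) (s : 'S_(q + q)),
    let p := kuhn_path (grid_point x) s in
    exists l, forall k, (k.+2 <= q + q)%N ->
      coboundary1 (b l) (p k) (p k.+1) (p k.+2) =
      - (d l * area (p k) (p k.+1) (p k.+2))) ->
  False.
Proof.
case: q d b => [//|q] d b _ d0 bface bcov.
pose P := {ffun 'I_(q.+1 + q.+1) -> nat}.
pose s := [seq ((fun x y z : P => d l * area x y z), b l) | l <- enum 'I_q.+1].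
have size_s : size s = q.+1 by rewrite size_map size_enum_ord.
have /eqP := grid_sum_area_neq0 m d0; apply.
have -> : [seq (fun x y z : P => d l * area x y z) | l <- enum 'I_q.+1] = map fst s.
  by rewrite /s -map_comp; apply: eq_map.
have closed p : List.In p s -> forall x, coboundary 2 (cochain2 p.1) x = 0.
  move=> ps x; suff [l ->] : exists l, p.1 = fun x y z : P => d l * area x y z.
    transitivity (d l * coboundary 2 (cochain2 (@area q.+1)) x).
      by rewrite /coboundary mulr_sumr; apply: eq_bigr => i _; rewrite mulrCA.
    by rewrite -coboundary_area_form coboundary_coboundary1 mulr0.
  move: ps; rewrite /s; elim: (enum _) => [//|l e IH] /= [<-|//].
  by exists l.
have : grid_sum m (coboundary (size s).*2.-1 (transgression s)) = 0.
  have ds := @has_degree_transgression _ _ s.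
  rewrite (_ : (size s).*2.-1 = (q + q.+1)%N) in ds *; last by rewrite size_s; lia.
  apply: (@grid_sum_coboundary (q + q.+1) m) => // x t xt.
  (* [e] is the axis traversed last, so the vertices read by the transgression lie in the face; the
     edge along [partner e] comes earlier and is collapsed. *)
  pose e : 'I_(q.+1 + q.+1) := t ord_max.
  have te : (t^-1)%g e = ord_max by rewrite permK.
  have E := @collapses_transgression R P (fun y => y e = x e) (@agree_off q.+1 (@partner q.+1 e)) s.
  apply: E.
  - move=> p ps; suff [l ->] : exists l, p = ((fun x y z : P => d l * area x y z), b l).
      have bl y y' z := bface l e y y' z.
      split=> /=.
      + move=> y ye yE; rewrite /cochain2.
        by have := collapses_area ye yE; rewrite /cochain2 => ->; rewrite mulr0.
      + move=> y ye [[|//] _ yE]; rewrite /cochain1.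
        by have [] := bl (y 0%N) (y 1%N) (y 0%N); rewrite ?ye.
      + move=> y ye [[|[|//]] _ yE]; rewrite /cochain2 /coboundary1.
          have [] := bl (y 0%N) (y 1%N) (y 2%N); rewrite ?ye// => -> -> _.
          by rewrite subrr addr0.
        have [] := bl (y 1%N) (y 2%N) (y 0%N); rewrite ?ye// => -> _ ->.
        by rewrite sub0r addNr.
    move: ps; rewrite /s; elim: (enum _) => [//|l e' IH] /= [<-|//].
    by exists l.
  - rewrite size_s => i iq; rewrite !ffunE te /=.
    rewrite -addnn in iq; rewrite [(_ < i)%N]ltnNge iq /=.
    by rewrite addn0.
  - pose i := (t^-1)%g (partner e).
    have iq : i != ord_max :> 'I_(q.+1 + q.+1).
      by rewrite -te (inj_eq perm_inj) partner_neq.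
    exists i.
      rewrite size_s -addnn; have := @leq_ord (q + q.+1) i.
      rewrite leq_eqVlt => /orP[/eqP iE|//].
      by move/eqP: iq; case; exact: val_inj.
    move=> j je; rewrite !ffunE ltnS; congr (_ + nat_of_bool _)%N.
    have : (t^-1)%g j != i by rewrite (inj_eq perm_inj).
    by rewrite -val_eqE /= => ji; rewrite [RHS]leq_eqVlt (negbTE ji).
have -> : grid_sum m (coboundary (size s).*2.-1 (transgression s)) =
    grid_sum m (cups (map perturb s)) - grid_sum m (cups (map fst s)).
  rewrite /grid_sum -sumrB; apply: eq_bigr => x _; rewrite -sumrB.
  by apply: eq_bigr => t _; rewrite coboundary_transgression// mulrBr.
(* On each simplex the factor given by [bcov] vanishes on every consecutive triple, hence at its own
   place in the product. *)
have -> : grid_sum m (cups (map perturb s)) = 0.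
  rewrite /grid_sum big1// => x _; rewrite big1// => t _.
  rewrite -map_comp cups_prod; have [l lE] := bcov x t.
  rewrite (bigD1 l)//= /perturb/= lE ?subrr ?mul0r ?mulr0//.
  by have := ltn_ord l; lia.
by rewrite sub0r => /eqP; rewrite oppr_eq0 => /eqP.
Qed.
End Kuhn.

(** * Homotopies commuting with a circle action *)

Section Angles.
Context {R : realType}.
Implicit Types x y a b : R.

(** Angles are counted in turns, so that their ambiguity is by integers. *)
Definition cs x : R := cos (2 * pi * x).
Definition sn x : R := sin (2 * pi * x).

Lemma csB x y : cs (x - y) = cs x * cs y + sn x * sn y.
Proof. by rewrite /cs mulrBr cosB. Qed.

Lemma snB x y : sn (x - y) = sn x * cs y - cs x * sn y.
Proof. by rewrite /sn mulrBr sinB. Qed.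

Lemma csD x y : cs (x + y) = cs x * cs y - sn x * sn y.
Proof. by rewrite /cs mulrDr cosD. Qed.

Lemma snD x y : sn (x + y) = sn x * cs y + cs x * sn y.
Proof. by rewrite /sn mulrDr sinD. Qed.

Lemma cs2Dsn2 x : cs x ^+ 2 + sn x ^+ 2 = 1.
Proof. exact: cos2Dsin2. Qed.

Lemma cs_sn_int (k : int) : cs k%:~R = 1 /\ sn k%:~R = 0.
Proof.
have cs1 : cs 1 = 1 by rewrite /cs mulr1 mulr_natl cos2pi.
have sn1 : sn 1 = 0 by rewrite /sn mulr1 mulr_natl sin2pi.
have csn (n : nat) : cs n%:R = 1 /\ sn n%:R = 0.
  elim: n => [|n [c s]]; first by rewrite /cs /sn mulr0 cos0 sin0.
  by rewrite -natr1 csD snD cs1 sn1 c s; split; ring.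
case: k => n; first exact: csn.
rewrite NegzE rmorphN /= /cs /sn mulrN cosN sinN.
by have [c s] := csn n.+1; split; [exact: c|rewrite -[sin _]/(sn _) s oppr0].
Qed.

Lemma cs_lt (e x : R) : 0 <= e <= `|x| -> `|x| <= 2^-1 -> cs x <= cs e.
Proof.
move=> /andP[e0 ex] x2; have p0 := pi_gt0 R.
rewrite /cs -(cos_norm (2 * pi * x)) normrM ger0_norm; last by nra.
rewrite leNgt ltr_cos ?in_itv/=; [|nra|nra].
by rewrite -leNgt ler_pM2l//; nra.
Qed.

Lemma cs_lt1 (e : R) : 0 < e <= 2^-1 -> cs e < 1.
Proof.
move=> e0; have p0 := pi_gt0 R; rewrite -[ltRHS]cos0 /cs.
by rewrite ltr_cos ?in_itv/=; nra.
Qed.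

(* The representative modulo 1 in [-1/2, 1/2[. *)
Definition cen x : R := x - (Num.floor (x + 2^-1))%:~R.

Lemma cen_norm x : `|cen x| <= 2^-1.
Proof.
have := floor_itv (x + 2^-1); rewrite intrD /cen => /andP[h1 h2].
by rewrite ler_norml; lra.
Qed.

Lemma cen_id x : `|x| < 2^-1 -> cen x = x.
Proof.
rewrite ltr_norml => /andP[h1 h2]; rewrite /cen (_ : Num.floor _ = 0) ?subr0//.
by apply/floor_def; rewrite add0r; lra.
Qed.

Lemma cenDint x (k : int) : cen (x + k%:~R) = cen x.
Proof.
rewrite /cen (addrAC x k%:~R 2^-1) floorDrz ?intr_int// intrKfloor intrD; ring.
Qed.

Lemma cenE x : exists k : int, cen x = x + k%:~R.
Proof. by exists (- Num.floor (x + 2^-1)); rewrite rmorphN. Qed.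

Lemma cs_cen x : cs (cen x) = cs x.
Proof.
have [k ->] := cenE x; have [c s] := cs_sn_int k.
by rewrite csD c s; ring.
Qed.

Lemma cen0 : cen (0 : R) = 0.
Proof. by rewrite cen_id// normr0. Qed.

Lemma int_norm_lt1 (k : int) : `|k%:~R : R| < 1 -> k = 0.
Proof. by rewrite -intr_norm -[1]/(1%:~R) ltr_int; lia. Qed.

Lemma cs_eq1 x : cs x = 1 -> exists k : int, x = k%:~R.
Proof.
rewrite -cs_cen => c1; have [k kE] := cenE x; exists (- k); rewrite rmorphN/=.
suff : cen x = 0 by rewrite kE; lra.
apply/eqP; rewrite -normr_le0 leNgt; apply/negP => c0.
have := @cs_lt `|cen x| (cen x); rewrite normr_ge0 lexx c1 => /(_ isT (cen_norm x)).
by rewrite leNgt cs_lt1// c0 cen_norm.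
Qed.

Lemma angle_exists a b : exists x,
  a = Num.sqrt (a ^+ 2 + b ^+ 2) * cs x /\ b = Num.sqrt (a ^+ 2 + b ^+ 2) * sn x.
Proof.
have ab0 : 0 <= a ^+ 2 + b ^+ 2 by rewrite addr_ge0// sqr_ge0.
set N := Num.sqrt _; have N2 : N ^+ 2 = a ^+ 2 + b ^+ 2 by rewrite sqr_sqrtr.
have N0 : 0 <= N by exact: sqrtr_ge0.
have [NE|NE] := eqVneq N 0.
  exists 0; rewrite NE !mul0r; rewrite NE in N2.
  by split; nra.
have Np : 0 < N by rewrite lt_def NE.
have p0 := pi_gt0 R.
have aN : -1 <= a / N <= 1.
  rewrite -ler_norml normrM normfV (ger0_norm N0) ler_pdivrMr// mul1r.
  rewrite -(ler_pXn2r (n := 2))// ?nnegrE// real_normK ?num_real// N2.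
  by rewrite lerDl sqr_ge0.
have sE : Num.sqrt (1 - (a / N) ^+ 2) = `|b| / N.
  have -> : 1 - (a / N) ^+ 2 = (b / N) ^+ 2.
    by rewrite !exprMn exprVn N2; field; rewrite -N2 expf_eq0.
  by rewrite sqrtr_sqr normrM normfV (ger0_norm N0).
have E y : 2 * pi * (y / (2 * pi)) = y by rewrite mulrC divfK//; lra.
have [b0|b0] := leP 0 b.
  exists (acos (a / N) / (2 * pi)); rewrite /cs /sn E acosK ?in_itv//= sin_acos//.
  by rewrite sE ger0_norm//; split; field.
exists (- acos (a / N) / (2 * pi)); rewrite /cs /sn E cosN sinN acosK ?in_itv//= sin_acos//.
by rewrite sE ltr0_norm//; split; field.
Qed.

End Angles.

(** Stated for all small [d] so that finitely many functions can share one value; the second point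
    may lie outside the cube. *)
Lemma cube_uniform_continuity (R : realType) n (G : 'rV[R]_n -> R) (e : R) :
  continuous G -> 0 < e -> \forall d \near 0^'+, forall x y : 'rV[R]_n,
    (forall i, 0 <= x 0 i <= 1) -> `|x - y| < d -> `|G x - G y| < e.
Proof.
move=> Gc e0.
have Kc : compact [set x : 'rV[R]_n | forall i, x ord0 i \in `[(0 : R), 1]].
  by apply: (@rV_compact _ _ (fun=> `[(0 : R), 1]%classic)) => i; exact: segment_compact.
have H := (compact_near_coveringP _).1 Kc R (0^'+)
  (fun d x => forall y : 'rV[R]_n, `|x - y| < d -> `|G x - G y| < e) (at_right_proper_filter 0).
apply: filterS (H _) => [d + x y xK xy|].
  by move=> /(_ x); apply => // i; rewrite in_itv/=; exact: xK.
move=> x _; have /cvgrPdist_lt /(_ (e / 2)) := Gc x.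
rewrite divr_gt0// => /(_ isT) /nbhs_ballP [r /= r0 xr].
exists (ball x (r / 2), [set d | d < r / 2]) => /=.
  split; first by apply: nbhsx_ballx; rewrite divr_gt0.
  by apply: nbhs_right_lt; rewrite divr_gt0.
move=> [x' d] /= [x'r dr] y xy.
have r2 : r / 2 < r by rewrite gtr_pMr//; lra.
have h1 : `|G x - G x'| < e / 2 by apply: xr; apply: le_ball x'r; exact: ltW.
have h2 : `|G x - G y| < e / 2.
  apply: xr; rewrite -ball_normE /= in x'r *.
  have -> : x - y = (x - x') + (x' - y) by rewrite addrA subrK.
  apply: le_lt_trans (ler_normD _ _) _.
  by rewrite [ltRHS]splitr ltrD// (lt_trans xy).
have -> : G x' - G y = (G x - G y) - (G x - G x') by ring.
by rewrite (le_lt_trans (ler_normB _ _))// [ltRHS]splitr ltrD.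
Qed.

Lemma continuous_pairing (S T U : topologicalType) (f : S -> T) (g : S -> U) x :
  {for x, continuous f} -> {for x, continuous g} ->
  {for x, continuous (fun y => (f y, g y))}.
Proof. by move=> fx gx; exact: cvg_pair. Qed.

Lemma rV_norm_le (R : realType) n (x : 'rV[R]_n) (r : R) :
  0 <= r -> (forall i, `|x ord0 i| <= r) -> `|x| <= r.
Proof.
move=> r0 xr; rewrite /Num.norm /= mx_normrE; apply/bigmax_leP; split => //.
by move=> [i j] _ /=; rewrite (ord1 i).
Qed.

(** * Equivariant homotopies evaluated on a grid *)

Section Weighted.
Context {R : realType} {M : topologicalType} (q : nat).
Variables (act : R -> M -> M) (u v : 'I_q -> M -> R) (w : 'I_q -> R).
Variables (H : R -> R -> M -> M) (n n' : R).
Hypothesis compactM : compact [set: M].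
Hypothesis u_cont : forall l, continuous (u l).
Hypothesis v_cont : forall l, continuous (v l).
Hypothesis uv_neq0 : forall p, exists l, 0 < u l p ^+ 2 + v l p ^+ 2.
Hypothesis w_neq0 : forall l, w l != 0.
Hypothesis u_act : forall l a p,
  u l (act a p) = cs (w l * a) * u l p - sn (w l * a) * v l p.
Hypothesis v_act : forall l a p,
  v l (act a p) = sn (w l * a) * u l p + cs (w l * a) * v l p.
Hypothesis H_cont : continuous (fun z : R * R * M => H z.1.1 z.1.2 z.2).
Hypothesis H_act : forall s t a p, H s t (act a p) = act a (H s t p).
Hypothesis H_t0 : forall (s : R) p, 0 <= s <= 1 -> H s 0 p = p.
Hypothesis H_t1 : forall (s : R) p, 0 <= s <= 1 -> H s 1 p = p.
Hypothesis H_s0 : forall (t : R) p, 0 <= t <= 1 -> H 0 t p = act (n * t) p.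
Hypothesis H_s1 : forall (t : R) p, 0 <= t <= 1 -> H 1 t p = act (n' * t) p.

Let sq l p := u l p ^+ 2 + v l p ^+ 2.

(** An arbitrary choice, in general discontinuous. It matters only modulo [1], and only where [sq l]
    is positive. *)
Let angle l p : R := projT1 (cid (angle_exists (u l p) (v l p))).

Let u_angle l p : u l p = Num.sqrt (sq l p) * cs (angle l p).
Proof. by rewrite /angle; case: cid => x []. Qed.

Let v_angle l p : v l p = Num.sqrt (sq l p) * sn (angle l p).
Proof. by rewrite /angle; case: cid => x []. Qed.

Let sq_act l a p : sq l (act a p) = sq l p.
Proof.
rewrite /sq u_act v_act; have := cs2Dsn2 (w l * a).
move: (cs _) (sn _) (u l p) (v l p) => c s x y cs1.
transitivity ((c ^+ 2 + s ^+ 2) * (x ^+ 2 + y ^+ 2)); first by ring.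
by rewrite cs1 mul1r.
Qed.

Let angle_act l a p : 0 < sq l p ->
  exists k : int, angle l (act a p) = angle l p + w l * a + k%:~R.
Proof.
move=> p0; suff /cs_eq1[k kE] : cs (angle l (act a p) - (angle l p + w l * a)) = 1.
  by exists k; rewrite -kE; ring.
have N0 : 0 < Num.sqrt (sq l p) by rewrite sqrtr_gt0.
have := v_act l a p; have := u_act l a p.
rewrite (u_angle l p) (v_angle l p) (u_angle l (act a p)) (v_angle l (act a p)).
rewrite sq_act => uE vE; rewrite csB csD snD.
have E1 := cs2Dsn2 (angle l p); have E2 := cs2Dsn2 (w l * a).
move: (cs (w l * a)) (sn (w l * a)) (angle l (act a p)) (angle l p) uE vE E1 E2.
move=> cw sw th' th uE vE E1 E2.
have -> : cs th' = cw * cs th - sw * sn th.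
  by apply: (mulfI (lt0r_neq0 N0)); rewrite uE; ring.
have -> : sn th' = sw * cs th + cw * sn th.
  by apply: (mulfI (lt0r_neq0 N0)); rewrite vE; ring.
transitivity ((cw ^+ 2 + sw ^+ 2) * (cs th ^+ 2 + sn th ^+ 2)); first by ring.
by rewrite E1 E2 mulr1.
Qed.

(** Law of cosines: two vectors of squared length at least [c] that make an angle of at least [e]
    turns are at squared distance at least [2 * c * (1 - cs e)]. *)
Let angle_close l p p' (c e : R) : 0 < c -> 0 < e <= 2^-1 -> c <= sq l p -> c <= sq l p' ->
  (u l p - u l p') ^+ 2 + (v l p - v l p') ^+ 2 < 2 * c * (1 - cs e) ->
  `|cen (angle l p' - angle l p)| < e.
Proof.
move=> c0 e0 cp cp'; rewrite ltNge => /negP close; rewrite ltNge; apply/negP => ea.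
apply: close.
have le_e : cs (angle l p' - angle l p) <= cs e.
  by rewrite -cs_cen; apply: cs_lt; rewrite ?cen_norm// ea andbT; case/andP: e0 => /ltW.
have N2 : Num.sqrt (sq l p) ^+ 2 = sq l p by rewrite sqr_sqrtr//; lra.
have N2' : Num.sqrt (sq l p') ^+ 2 = sq l p' by rewrite sqr_sqrtr//; lra.
have N0 : 0 <= Num.sqrt (sq l p) by exact: sqrtr_ge0.
have N0' : 0 <= Num.sqrt (sq l p') by exact: sqrtr_ge0.
rewrite (u_angle l p) (v_angle l p) (u_angle l p') (v_angle l p').
rewrite csB in le_e.
set N := Num.sqrt (sq l p) in N0 N2 *; set N' := Num.sqrt (sq l p') in N0' N2' *.
have NN : c <= N * N'.
  rewrite -(ler_pXn2r (n := 2))// ?nnegrE ?mulr_ge0//; last exact: ltW.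
  by rewrite exprMn N2 N2' expr2 ler_pM// ltW.
have := cs2Dsn2 (angle l p); have := cs2Dsn2 (angle l p').
move: (cs (angle l p)) (sn (angle l p)) (cs (angle l p')) (sn (angle l p')) le_e.
move=> x y x' y' le_e xy' xy.
have -> : (N * x - N' * x') ^+ 2 + (N * y - N' * y') ^+ 2 =
  N ^+ 2 * (x ^+ 2 + y ^+ 2) + N' ^+ 2 * (x' ^+ 2 + y' ^+ 2) -
  2 * (N * N') * (x' * x + y' * y) by ring.
rewrite xy xy' !mulr1.
have e1 : cs e < 1 by exact: cs_lt1.
have := sqr_ge0 (N - N'); rewrite sqrrB => NB.
have h1 : 0 <= (N * N' - c) * (1 - cs e) by apply: mulr_ge0; lra.
have h2 : 0 <= N * N' * (cs e - (x' * x + y' * y)).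
  by apply: mulr_ge0; [exact: mulr_ge0|lra].
nra.
Qed.

Let chain (e : seq 'I_q) (x : 'rV[R]_(q + q)) (p : M) : M :=
  foldr (fun j => H (x ord0 (lshift q j)) (x ord0 (rshift q j))) p e.

Let chain_cont e p : continuous (fun x => chain e x p).
Proof.
elim: e => [|j e IH] x /=; first exact: cst_continuous.
have := @H_cont (x ord0 (lshift q j), x ord0 (rshift q j), chain e x p).
move=> Hc; apply: (@continuous_comp _ _ _ (fun x : 'rV[R]_(q + q) =>
  (x ord0 (lshift q j), x ord0 (rshift q j), chain e x p))
  (fun z : R * R * M => H z.1.1 z.1.2 z.2)) => //.
apply: continuous_pairing; last exact: IH.
by apply: continuous_pairing; exact: coord_continuous.
Qed.

Let chain_eq e (x y : 'rV[R]_(q + q)) p : (forall j, j \in e ->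
    H (x ord0 (lshift q j)) (x ord0 (rshift q j)) =1
    H (y ord0 (lshift q j)) (y ord0 (rshift q j))) ->
  chain e x p = chain e y p.
Proof.
elim: e => [//|j e IH] xy /=; rewrite xy ?mem_head//; congr (H _ _ _).
by apply: IH => i ie; apply: xy; rewrite inE ie orbT.
Qed.

(** The outer maps commute with the action, so a rotation in the [j]-th map can be carried to the
    front of the composition. *)
Let chain_act e j (x y : 'rV[R]_(q + q)) a p : uniq e -> j \in e ->
  (forall i, i != j -> x ord0 (lshift q i) = y ord0 (lshift q i) /\
                       x ord0 (rshift q i) = y ord0 (rshift q i)) ->
  (forall p', H (x ord0 (lshift q j)) (x ord0 (rshift q j)) p' =
    act a (H (y ord0 (lshift q j)) (y ord0 (rshift q j)) p')) ->
  chain e x p = act a (chain e y p).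
Proof.
move=> + + xy xyj; elim: e => [//|i e IH] /= /andP[ie ue].
rewrite inE => /orP[/eqP ji|je].
  rewrite -{i}ji in ie *; rewrite xyj; congr (act a (H _ _ _)).
  apply: chain_eq => i i_e p'.
  by have [-> ->] := xy i (memPn ie i i_e).
have ij : i != j by apply: contraNneq ie => ->.
by rewrite IH// H_act; have [-> ->] := xy i ij.
Qed.

Section Grid.
Variables (p0 : M) (m : nat).
Implicit Types (g h k : {ffun 'I_(q + q) -> nat}) (e : 'I_(q + q)).
Let Z (x : 'rV[R]_(q + q)) := chain (enum 'I_q) x p0.

(** [minn] keeps the image in the unit cube for every vertex, since the face condition of
    [no_area_primitives] ranges over vertices outside the grid too. *)
Definition grid_pt (g : {ffun 'I_(q + q) -> nat}) : 'rV[R]_(q + q) :=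
  \row_i ((minn (g i) m.+1)%:R / m.+1%:R).

Lemma grid_pt_itv g i : 0 <= grid_pt g ord0 i <= 1.
Proof.
rewrite mxE divr_ge0//= ler_pdivrMr// mul1r ler_nat; exact: geq_minr.
Qed.

(** Left-endpoint rule, along an edge, for the integral of [w_l sum_j (n + (n' - n) s_j) dt_j]. The
    coefficient is [n] at [s_j = 0] and [n'] at [s_j = 1], the speeds at which [H] rotates there. *)
Definition twist l (g h : {ffun 'I_(q + q) -> nat}) : R :=
  w l * \sum_(j < q) (n + (n' - n) * grid_pt g ord0 (lshift q j)) *
    (grid_pt h ord0 (rshift q j) - grid_pt g ord0 (rshift q j)).

Let zangle l g := angle l (Z (grid_pt g)).
Let zsq l g := sq l (Z (grid_pt g)).

(** Only the square of [e] distinguishes [g] from [h]. If [e] is [s_j], the coefficients agree and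
    the cochain is additive in [t_j]; if [e] is [t_j], all increments of [t_j] vanish. *)
Lemma twist_face l e g h k : h e = g e -> k e = g e ->
  agree_off (partner e) g h ->
  twist l k h - twist l k g = twist l g h /\
  twist l h k - twist l g k = - twist l g h.
Proof.
move=> he ke gh.
have ghE i : i != partner e -> grid_pt h ord0 i = grid_pt g ord0 i.
  by move=> /gh gi; rewrite !mxE gi.
have heE : grid_pt h ord0 e = grid_pt g ord0 e by rewrite !mxE he.
have keE : grid_pt k ord0 e = grid_pt g ord0 e by rewrite !mxE ke.
have l0 j : lshift q j = partner e -> rshift q j = e.
  by rewrite -partner_lshift => ->; rewrite partnerK.
have r0 j : rshift q j = partner e -> lshift q j = e.
  by rewrite -[lshift q j]partner_rshift => ->; rewrite partnerK.
rewrite /twist -!mulrBr -mulrN; split; congr (_ * _).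
  rewrite -sumrB; apply: eq_bigr => j _.
  have [/r0 ->|/ghE ->] := eqVneq (rshift q j) (partner e); last by ring.
  by rewrite keE; ring.
rewrite -sumrB -sumrN; apply: eq_bigr => j _.
have [/l0 ->|/ghE ->] := eqVneq (lshift q j) (partner e); last by ring.
by rewrite keE heE; ring.
Qed.

(** If [e] is some [s_j], the [j]-th map is the rotation by [N * t_j], and a change of [t_j] rotates
    the whole composition. If [e] is some [t_j], the [j]-th map is the identity whatever [s_j] is,
    and nothing changes. *)
Lemma zangle_face l e g h : g e \in [:: 0; m.+1]%N -> h e = g e ->
  agree_off (partner e) g h ->
  zsq l h = zsq l g /\ (0 < zsq l g ->
    exists k : int, zangle l h = zangle l g + twist l g h + k%:~R).
Proof.
move=> ge he gh.
have ghE i : i != partner e -> grid_pt h ord0 i = grid_pt g ord0 i.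
  by move=> /gh gi; rewrite !mxE gi.
have heE : grid_pt h ord0 e = grid_pt g ord0 e by rewrite !mxE he.
have ge01 : grid_pt g ord0 e = 0 \/ grid_pt g ord0 e = 1.
  move: ge; rewrite !inE mxE => /orP[] /eqP ->; first by left; rewrite min0n mul0r.
  by right; rewrite minnn divff.
have [j [ej|ej]] : exists j, e = lshift q j \/ e = rshift q j.
  by case: (fintype.splitP e) => j ej; exists j; [left|right]; exact: val_inj.
(* [y] is the point of [g] with [t_j] replaced by [0], where [H] is the identity. *)
- pose y : 'rV[R]_(q + q) := \row_i if i == rshift q j then 0 else grid_pt g ord0 i.
  rewrite ej partner_lshift in ghE ge01 heE.
  pose N := n + (n' - n) * grid_pt g ord0 (lshift q j).
  have ZE f : (forall i, i != rshift q j -> grid_pt f ord0 i = grid_pt g ord0 i) ->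
      Z (grid_pt f) = act (N * grid_pt f ord0 (rshift q j)) (Z y).
    move=> fE; apply: (@chain_act _ j); rewrite ?enum_uniq ?mem_enum//.
      move=> i ij; rewrite !mxE eq_lrshift eq_rshift (negbTE ij).
      by have := fE (lshift q i); have := fE (rshift q i);
        rewrite !mxE eq_lrshift eq_rshift ij => -> // ->.
    move=> p'; rewrite [y _ (lshift _ _)]mxE [y _ (rshift _ _)]mxE eqxx eq_lrshift /=.
    rewrite H_t0; last exact: grid_pt_itv.
    rewrite fE ?eq_lrshift// /N; case: ge01 => ->.
      by rewrite H_s0 ?grid_pt_itv// mulr0 addr0.
    by rewrite H_s1 ?grid_pt_itv// mulr1 addrC subrK.
  have Zg := ZE g (fun _ _ => erefl); have Zh := ZE h ghE.
  have tE : twist l g h = w l * (N * (grid_pt h ord0 (rshift q j) - grid_pt g ord0 (rshift q j))).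
    rewrite /twist (bigD1 j)//= big1 ?addr0// => i ij.
    by rewrite ghE ?eq_rshift// subrr mulr0.
  rewrite /zsq /zangle Zg Zh !sq_act tE; split => // y0.
  have [k1 ->] := angle_act (N * grid_pt h ord0 (rshift q j)) y0.
  have [k2 ->] := angle_act (N * grid_pt g ord0 (rshift q j)) y0.
  by exists (k1 - k2); rewrite rmorphB /=; ring.
- rewrite ej partner_rshift in ghE ge01 heE.
  have -> : twist l g h = 0.
    rewrite /twist big1 ?mulr0// => i _; have [->|ij] := eqVneq i j.
      by rewrite heE subrr mulr0.
    by rewrite ghE ?eq_rlshift// subrr mulr0.
  have ZE : Z (grid_pt h) = Z (grid_pt g).
    apply: chain_eq => i _ p'; have [->|ij] := eqVneq i j.
      by rewrite heE; case: ge01 => ->; rewrite ?H_t0 ?H_t1 ?grid_pt_itv.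
    by rewrite !ghE ?eq_rlshift ?eq_lshift.
  by rewrite /zsq /zangle ZE; split=> // _; exists 0; rewrite !addr0.
Qed.

(** Where [F_l] is not small, this is the increment of its argument minus the twist, made
    independent of the choice of angles by [cen]. The test only involves [zsq], which collapsing
    preserves, so the default value [0] is compatible with the faces as well. *)
Definition prim c l (g h : {ffun 'I_(q + q) -> nat}) : R :=
  if (c <= zsq l g) && (c <= zsq l h) then
    cen (zangle l h - zangle l g - twist l g h) else 0.

Lemma prim_face c l e g h k : 0 < c -> g e \in [:: 0; m.+1]%N -> h e = g e ->
  k e = g e -> agree_off (partner e) g h ->
  [/\ prim c l g h = 0, prim c l g k = prim c l h k & prim c l k g = prim c l k h].
Proof.
move=> c0 ge he ke gh; have [sE aE] := zangle_face l ge he gh.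
have [t1 t2] := twist_face l he ke gh.
rewrite /prim sE; case: leP => //= cg; last by rewrite andbF.
have [i iE] := aE (lt_le_trans c0 cg); rewrite andbT; split.
- by rewrite iE (_ : _ - _ - _ = 0 + i%:~R) ?cenDint ?cen0//; ring.
- case: ifP => // _; rewrite iE.
  have -> : zangle l k - zangle l g - twist l g k =
    zangle l k - (zangle l g + twist l g h + i%:~R) - twist l h k + i%:~R.
    by move: t2; lra.
  by rewrite cenDint.
- case: ifP => // _; rewrite iE.
  have -> : zangle l g + twist l g h + i%:~R - zangle l k - twist l k h =
    zangle l g - zangle l k - twist l k g + i%:~R by move: t1; lra.
  by rewrite cenDint.
Qed.

Section Path.
Variables (x : {ffun 'I_(q + q) -> 'I_m.+1}) (s : 'S_(q + q)).
Let p := kuhn_path (grid_point x) s.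

Lemma grid_pt_path (k : nat) i :
  grid_pt (p k) ord0 i = (p k i)%:R / m.+1%:R.
Proof.
rewrite mxE (minn_idPl _)// !ffunE; have := ltn_ord (x i).
by case: (_ < k)%N => /=; lia.
Qed.

Lemma grid_pt_path_close (k k' : nat) i :
  `|grid_pt (p k) ord0 i - grid_pt (p k') ord0 i| <= m.+1%:R^-1.
Proof.
rewrite !grid_pt_path -mulrBl normrM normfV [X in _ / X]ger0_norm//.
rewrite ler_piMl ?invr_ge0// !ffunE !natrD opprD addrACA subrr add0r.
by case: (_ < k)%N; case: (_ < k')%N; rewrite /= ?subrr ?subr0 ?sub0r ?normrN ?normr0 ?normr1.
Qed.

Lemma coboundary_twist l (k : nat) :
  coboundary1 (twist l) (p k) (p k.+1) (p k.+2) =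
  w l * (n' - n) / m.+1%:R ^+ 2 * area (p k) (p k.+1) (p k.+2).
Proof.
rewrite /coboundary1 /twist -mulrBr -mulrDr -sumrB -big_split/=.
rewrite -!mulrA; congr (_ * _); rewrite /area !mulr_sumr; apply: eq_bigr => j _.
by rewrite !grid_pt_path; field.
Qed.

Lemma twist_path_le l (k k' : nat) : 0 <= n -> 0 <= n' ->
  `|twist l (p k) (p k')| <= `|w l| * (q%:R * (n + n')) / m.+1%:R.
Proof.
move=> n0 n0'; rewrite /twist normrM -mulrA ler_wpM2l//.
apply: le_trans (ler_norm_sum _ _ _) _.
rewrite -[X in X%:R * _]card_ord -mulrA mulr_natl -sumr_const; apply: ler_sum => j _.
rewrite normrM ler_pM ?grid_pt_path_close//.
have /andP[s0 s1] := grid_pt_itv (p k) (lshift q j).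
by rewrite ler_norml; apply/andP; split; nra.
Qed.

End Path.
End Grid.

Lemma homotopy_contradiction (p0 : M) : 0 <= n -> 0 <= n' -> n != n' -> False.
Proof.
move=> n0 n0' nn'.
have [l0 _] := uv_neq0 p0.
have q0 : (0 < q)%N by case: l0 => k; lia.
have [c c0 cE] : exists2 c, 0 < c & forall p, exists l, c <= sq l p.
  have Sc : continuous (fun p => \sum_l sq l p).
    apply: continuous_big => [|l _ p]; first exact: add_continuous.
    by apply: cvgD; rewrite expr2; apply: cvgM; [exact: u_cont|exact: u_cont|exact: v_cont|exact: v_cont].
  have [pm _ pmin] := @compact_EVT_min M R (fun p => \sum_l sq l p) setT
    (ex_intro _ p0 I) compactM (continuous_subspaceT Sc).
  have m0 : 0 < \sum_l sq l pm.
    have [l ll] := uv_neq0 pm; rewrite (bigD1 l)//= ltr_pwDl//.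
    by apply: sumr_ge0 => i _; rewrite addr_ge0// sqr_ge0.
  exists ((\sum_l sq l pm) / q%:R) => [|p]; first by rewrite divr_gt0// ltr0n.
  apply: contrapT => /forallNP hp.
  have := pmin p (in_setT _); apply/negP; rewrite -ltNge.
  have -> : \sum_l sq l pm = \sum_(l < q) ((\sum_l sq l pm) / q%:R).
    rewrite sumr_const card_ord -[RHS]mulr_natr divfK// pnatr_eq0; lia.
  apply: ltr_sum; last by move=> l _; rewrite ltNge; apply/negP/hp.
  by apply/hasP; exists l0; rewrite ?mem_index_enum.
pose Z (x : 'rV[R]_(q + q)) := chain (enum 'I_q) x p0.
(* A vector of length at least [sqrt c], moved by less than half of [sqrt c], keeps a squared length
   of at least [c / 4]: the index [l] found at one vertex serves the whole simplex. *)
pose c' := c / 4; have c'0 : 0 < c' by rewrite divr_gt0.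
(* An increment of angle minus a twist is then below [1 / 2], where [cen] is the identity, and three
   increments of angle add up to less than [1]. *)
pose ep : R := 16^-1; have ep0 : 0 < ep by rewrite invr_gt0.
have k0 : 0 < 1 - cs ep by rewrite subr_gt0 cs_lt1// ep0 /= lef_pV2 ?posrE//; lra.
(* The first bound goes with the choice of [c'], the second is the threshold of [angle_close]. *)
pose eta := Num.min c' (2 * c' * (1 - cs ep)).
have eta0 : 0 < eta by rewrite lt_min c'0 /= !mulr_gt0.
pose e := Num.min 1 (eta / 2).
have e0 : 0 < e by rewrite lt_min ltr01 divr_gt0.
have [dl dl0 dlE] : exists2 dl : R, 0 < dl & forall (x y : 'rV[R]_(q + q)) l, (forall i, 0 <= x ord0 i <= 1) ->
    `|x - y| < dl -> (u l (Z x) - u l (Z y)) ^+ 2 + (v l (Z x) - v l (Z y)) ^+ 2 < eta.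
  have uc l : continuous (fun x => u l (Z x)).
    by move=> x; apply: continuous_comp; [exact: chain_cont|exact: u_cont].
  have vc l : continuous (fun x => v l (Z x)).
    by move=> x; apply: continuous_comp; [exact: chain_cont|exact: v_cont].
  have un l := cube_uniform_continuity (uc l) e0.
  have vn l := cube_uniform_continuity (vc l) e0.
  have dn : \forall d \near (0 : R)^'+, [/\ 0 < d,
      forall l (x y : 'rV[R]_(q + q)), (forall i, 0 <= x ord0 i <= 1) ->
        `|x - y| < d -> `|u l (Z x) - u l (Z y)| < e &
      forall l (x y : 'rV[R]_(q + q)), (forall i, 0 <= x ord0 i <= 1) ->
        `|x - y| < d -> `|v l (Z x) - v l (Z y)| < e].
    near=> d; split; first by near: d; exact: nbhs_right_gt.
      by near: d; apply: filter_forall => l; exact: un.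
    by near: d; apply: filter_forall => l; exact: vn.
  have [dl [dl0 H1 H2]] := filter_ex dn; exists dl => // x y l x01 xy.
  have small (t : R) : `|t| < e -> t ^+ 2 < eta / 2.
    move=> te; rewrite -real_normK ?num_real// expr2.
    have t1 : `|t| < 1 by rewrite (lt_le_trans te)// ge_min lexx.
    have t2 : `|t| < eta / 2 by rewrite (lt_le_trans te)// ge_min lexx orbT.
    by rewrite (le_lt_trans _ t2)// ler_piMr// ltW.
  rewrite [ltRHS]splitr ltrD//; apply: small; [exact: H1|exact: H2].
pose B := \sum_l `|w l| * (q%:R * (n + n')).
have B0 : 0 <= B.
  by apply: sumr_ge0 => l _; rewrite mulr_ge0// mulr_ge0// addr_ge0.
(* The mesh is below [dl] and the twist along an edge is at most [1 / 16]. *)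
pose m := Num.bound (dl^-1 + 16 * B).
have mE : dl^-1 + 16 * B < m.+1%:R.
  rewrite (@lt_trans _ _ m%:R) ?ltr_nat//; apply: archi_boundP.
  by rewrite addr_ge0 ?invr_ge0 ?(ltW dl0)// mulr_ge0.
have m0 : 0 < m.+1%:R :> R by rewrite ltr0n.
have mdl : m.+1%:R^-1 < dl.
  rewrite invf_plt ?posrE//; apply: le_lt_trans mE.
  by rewrite lerDl mulr_ge0.
have mB : B / m.+1%:R <= ep.
  have : 0 < dl^-1 by rewrite invr_gt0.
  by move=> ?; rewrite ler_pdivrMr// /ep; lra.
apply: (@no_area_primitives R q m
  (fun l => w l * (n' - n) / m.+1%:R ^+ 2) (prim p0 m c')) => //.
- move=> l; apply: mulf_neq0; last by rewrite invr_eq0 expf_neq0// lt0r_neq0.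
  by apply: mulf_neq0 => //; rewrite subr_eq0 eq_sym.
- move=> l f g h k ge he ke gh; exact: (prim_face p0 l c'0 ge he ke gh).
move=> x s p.
have [l lE] := cE (Z (grid_pt m (p 0%N))).
have close k k' : (u l (Z (grid_pt m (p k))) - u l (Z (grid_pt m (p k')))) ^+ 2 +
    (v l (Z (grid_pt m (p k))) - v l (Z (grid_pt m (p k')))) ^+ 2 < eta.
  apply: dlE; first by move=> i; exact: grid_pt_itv.
  apply: le_lt_trans mdl.
  apply: rV_norm_le => [|i]; first by rewrite invr_ge0.
  by rewrite !mxE; have := grid_pt_path_close x s k k' i; rewrite !mxE.
have large k : c' <= sq l (Z (grid_pt m (p k))).
  have := close 0%N k; rewrite lt_min => /andP[+ _]; move: lE; rewrite /sq /c'.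
  move: (u l (Z _)) (v l (Z _)) (u l (Z _)) (v l (Z _)) => a b a' b'.
  move=> h1 h2; have := sqr_ge0 (2 * a - a'); have := sqr_ge0 (2 * b - b'); nra.
exists l => k _.
pose r k k' := cen (angle l (Z (grid_pt m (p k'))) - angle l (Z (grid_pt m (p k)))).
have rE k1 k2 : `|r k1 k2| < ep.
  apply: (@angle_close l _ _ c'); rewrite ?large// ?ep0 /=.
    by rewrite lef_pV2 ?posrE//; lra.
  by have := close k1 k2; rewrite lt_min => /andP[].
have tE k1 k2 : `|twist m l (p k1) (p k2)| <= ep.
  apply: le_trans (twist_path_le x s l k1 k2 n0 n0') _; apply: le_trans mB.
  rewrite ler_pM2r ?invr_gt0// /B (bigD1 l)//= lerDl sumr_ge0// => i _.
  by rewrite mulr_ge0// mulr_ge0// addr_ge0.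
have primE k1 k2 : prim p0 m c' l (p k1) (p k2) = r k1 k2 - twist m l (p k1) (p k2).
  rewrite /prim !large /=.
  have [i iE] := cenE (angle l (Z (grid_pt m (p k2))) - angle l (Z (grid_pt m (p k1)))).
  rewrite -[LHS](cenDint _ i) -addrAC -iE cen_id//.
  apply: le_lt_trans (ler_normB _ _) _; have := rE k1 k2; have := tE k1 k2.
  by rewrite /r /ep; lra.
rewrite -(coboundary_twist x s l k) /coboundary1 !primE.
have [i1 r1] := cenE (angle l (Z (grid_pt m (p k.+1))) - angle l (Z (grid_pt m (p k)))).
have [i2 r2] := cenE (angle l (Z (grid_pt m (p k.+2))) - angle l (Z (grid_pt m (p k.+1)))).
have [i3 r3] := cenE (angle l (Z (grid_pt m (p k.+2))) - angle l (Z (grid_pt m (p k)))).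
(* The increments of angle around a triangle add up to an integer, which is small, hence zero; only
   the twist contributes to the coboundary. *)
suff : r k.+1 k.+2 - r k k.+2 + r k k.+1 = 0 by move=> /eqP; lra.
have sumE : r k.+1 k.+2 - r k k.+2 + r k k.+1 = (i2 - i3 + i1)%:~R.
  by rewrite /r r1 r2 r3 rmorphD rmorphB /=; ring.
rewrite sumE (_ : i2 - i3 + i1 = 0)//; apply: (@int_norm_lt1 R); rewrite -sumE.
have := rE k.+1 k.+2; have := rE k k.+2; have := rE k k.+1.
rewrite /ep !ltr_norml; lra.
Unshelve. all: by end_near.
Qed.

End Weighted.

(** * Differential calculus *)

Section Lines.
Context {R : realType}.

Lemma is_derive_line (V W : normedModType R) (f : V -> W) z v (t : R) df :
  is_derive (z + t *: v) v f df -> is_derive t 1 (fun s : R => f (z + s *: v)) df.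
Proof.
have E : (fun h : R => h^-1 *: (((fun s : R => f (z + s *: v)) \o shift t) (h *: 1) -
      f (z + t *: v))) =
    (fun h => h^-1 *: ((f \o shift (z + t *: v)) (h *: v) - f (z + t *: v))).
  apply/funext => h /=; congr (_ *: (f _ - _)).
  by rewrite scaler1 scalerDl addrCA addrA.
move=> [dv vE]; apply: DeriveDef; first by rewrite /derivable E.
by rewrite -vE /derive E.
Qed.

Lemma MVT_line (V : normedModType R) (f : V -> R) z v (r : R) :
  (forall t, 0 <= t <= 1 -> derivable f (z + (t * r) *: v) v) ->
  exists2 t, 0 <= t <= 1 & f (z + r *: v) - f z = r * 'D_v f (z + (t * r) *: v).
Proof.
move=> fd; pose g (t : R) := f (z + (t * r) *: v).
have gd (t : R) : 0 <= t <= 1 -> is_derive t 1 g (r * 'D_v f (z + (t * r) *: v)).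
  move=> t01; have h1 : is_derive (t * r) 1 (fun s : R => f (z + s *: v))
      ('D_v f (z + (t * r) *: v)).
    by apply: is_derive_line; apply: derivableP; exact: fd.
  have h2 : is_derive t 1 (fun t : R => t * r) r.
    apply: is_derive_eq; rewrite scaler0 add0r; exact: mulr1.
  have := @is_derive1_comp R (fun s => f (z + s *: v)) (fun t => t * r) t _ _ h1 h2.
  by rewrite mulrC.
have gc : {within `[0, 1], continuous g}.
  apply: derivable_within_continuous => t; rewrite in_itv /= => t01.
  by have [] := gd t t01.
have gd' (t : R) : t \in `]0, 1[ -> is_derive t 1 g (r * 'D_v f (z + (t * r) *: v)).
  by rewrite in_itv/= => /andP[/ltW t0 /ltW t1]; apply: gd; rewrite t0.
have [t] := MVT ltr01 gd' gc.
rewrite in_itv/= => /andP[/ltW t0 /ltW t1] E; exists t; first by rewrite t0.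
by move: E; rewrite /g mul1r mul0r scale0r addr0 subr0 mulr1.
Qed.

End Lines.

Lemma mx_norm_le (R : realType) m n (x : 'M[R]_(m, n)) (r : R) :
  0 <= r -> (forall i j, `|x i j| <= r) -> `|x| <= r.
Proof.
move=> r0 xr; rewrite /Num.norm /= mx_normrE; apply/bigmax_leP; split => //.
Qed.

Lemma mx_norm_ge (R : realType) m n (x : 'M[R]_(m, n)) i j : `|x i j| <= `|x|.
Proof.
by rewrite [leRHS]/Num.norm /= mx_normrE; apply: (le_bigmax _ _ (i, j)).
Qed.

Lemma ge_minl (R : realDomainType) (x y : R) : Num.min x y <= x.
Proof. by rewrite ge_min lexx. Qed.

Lemma ge_minr (R : realDomainType) (x y : R) : Num.min x y <= y.
Proof. by rewrite ge_min lexx orbT. Qed.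

Section Partials.
Context {R : realType} {n : nat}.
Local Notation e_ i := (delta_mx 0 i : 'rV[R]_n).

(* The path from [y] to [y + h] parallel to the successive axes stays in any box
   containing its ends. *)
Lemma partials_estimate (f : 'rV[R]_n -> R) (x y h : 'rV[R]_n) (r : R)
    (c : 'I_n -> R) (e : R) :
  (forall z, `|z - x| < r -> forall i, derivable f z (e_ i) /\
     `|'D_(e_ i) f z - c i| <= e) ->
  `|y - x| < r -> `|y + h - x| < r ->
  `|f (y + h) - f y - \sum_i h 0 i * c i| <= n%:R * e * `|h|.
Proof.
move=> fd yx yhx.
have r0 : 0 < r by apply: le_lt_trans yx.
pose z (k : nat) : 'rV[R]_n := \row_i (y 0 i + (i < k)%:R * h 0 i).
have zx (k : 'I_n) t : 0 <= t <= 1 -> `|z k + (t * h 0 k) *: e_ k - x| < r.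
  move=> /andP[t0 t1]; apply: (@le_lt_trans _ _ (Num.max `|y - x| `|y + h - x|)).
    apply: mx_norm_le => [|i0 i]; first by rewrite le_max normr_ge0.
    rewrite (ord1 i0) !mxE eqxx /=.
    have h1 : `|y 0 i - x 0 i| <= Num.max `|y - x| `|y + h - x|.
      by rewrite le_max; have := mx_norm_ge (y - x) 0 i; rewrite !mxE => ->.
    have h2 : `|y 0 i + h 0 i - x 0 i| <= Num.max `|y - x| `|y + h - x|.
      by rewrite le_max; have := mx_norm_ge (y + h - x) 0 i; rewrite !mxE => ->; rewrite orbT.
    case: ltngtP => ik; rewrite ?mul1r ?mul0r ?addr0 -?val_eqE ?(ltn_eqF ik) ?(gtn_eqF ik)/=.
    - by rewrite mulr0 addr0.
    - by rewrite mulr0 addr0.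
    - have <- : i = k by exact: val_inj.
      rewrite eqxx mulr1; move: h1 h2; rewrite !ler_norml; move: (Num.max _ _) => M; nra.
  by rewrite gt_max yx.
have step (k : 'I_n) : `|f (z k.+1) - f (z k) - h 0 k * c k| <= e * `|h|.
  have -> : z k.+1 = z k + h 0 k *: e_ k.
    apply/rowP => i; rewrite !mxE eqxx /= -addrA; congr (_ + _).
    rewrite ltnS leq_eqVlt -val_eqE /=; case: eqP => [ik|_] /=; last by rewrite mulr0 addr0.
    by rewrite ik ltnn mul0r add0r mulr1 mul1r; congr (h 0 _); exact: val_inj.
  have [t t01 ->] := @MVT_line _ _ f (z k) (e_ k) (h 0 k)
    (fun t t01 => (fd _ (zx k t t01) k).1).
  rewrite -mulrBr normrM mulrC ler_pM//; last exact: mx_norm_ge.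
  exact: (fd _ (zx k t t01) k).2.
have -> : f (y + h) - f y = \sum_(k < n) (f (z k.+1) - f (z k)).
  rewrite -(big_mkord xpredT (fun k => f (z k.+1) - f (z k))) telescope_sumr//.
  congr (f _ - f _); apply/rowP => i; rewrite !mxE ?mul0r ?addr0//.
  by rewrite ltn_ord mul1r.
rewrite -sumrB (le_trans (ler_norm_sum _ _ _))//.
rewrite -mulrA mulr_natl -[X in _ *+ X]card_ord -sumr_const.
by apply: ler_sum => k _; exact: step.
Qed.


Section Combination.
Variables (a b : nat) (c : 'I_n -> 'M[R]_(a, b)).
Definition row_comb (h : 'rV[R]_n) : 'M[R]_(a, b) := \sum_i h 0 i *: c i.

Lemma row_comb_linear : linear row_comb.
Proof.
move=> k x y; rewrite /row_comb scaler_sumr -big_split; apply: eq_bigr => i _.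
by rewrite !mxE scalerDl scalerA.
Qed.

HB.instance Definition _ := GRing.isLinear.Build R 'rV[R]_n 'M[R]_(a, b) _
  row_comb row_comb_linear.

Lemma row_comb_continuous : continuous row_comb.
Proof.
apply: continuous_big => [|i _ x]; first exact: add_continuous.
by apply: (@cvgZr_tmp _ _ _ (nbhs x)); exact: coord_continuous.
Qed.
End Combination.

Lemma differentiable_estimate (V W : normedModType R) (f : V -> W) x
    (df : {linear V -> W}) : continuous df ->
  (forall e, 0 < e -> \forall h \near 0, `|f (h + x) - f x - df h| <= e * `|h|) ->
  differentiable f x.
Proof.
move=> dfc fE; have E : f \o shift x = cst (f x) + df +o_ 0 id.
  by apply/eqaddoP => e e0; near do rewrite opprD addrA; exact: fE.
by apply/diff_locallyP; rewrite (diff_unique dfc E).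
Unshelve. all: by end_near. Qed.

Lemma C1_differentiable a b (f : 'rV[R]_n -> 'M[R]_(a, b)) x :
  (\forall y \near x, forall i, derivable f y (e_ i)) ->
  (forall i, {for x, continuous ('D_(e_ i) f)}) ->
  differentiable f x.
Proof.
move=> fd fc; pose c i := 'D_(e_ i) f x.
apply: (@differentiable_estimate _ _ f x (row_comb c)).
  exact: row_comb_continuous.
(* [n.+1] absorbs the factor [n] of [partials_estimate], also when [n] is [0]. *)
move=> e e0; have e'0 : 0 < e / n.+1%:R by rewrite divr_gt0.
have : \forall y \near x, forall i, derivable f y (e_ i) /\
    `|'D_(e_ i) f y - c i| <= e / n.+1%:R.
  near=> y => i; split; first by move: i; near: y.
  move: i; near: y; apply: filter_forall => i.
  have /cvgrPdist_le /(_ _ e'0) := fc i.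
  apply: filterS => y H; rewrite distrC; exact: H.
move=> /nbhs_ballP[r /= r0 xr]; apply/nbhs_ballP; exists r => //= h.
rewrite -ball_normE /= sub0r normrN => hr.
apply: mx_norm_le => [|i j]; first by rewrite mulr_ge0// ltW.
have := @partials_estimate (fun y => f y i j) x x h r (fun k => c k i j)
  (e / n.+1%:R) _ _ _.
rewrite subrr normr0 => /(_ _ r0).
rewrite addrAC subrr add0r => /(_ _ hr) H.
have -> : (f (h + x) - f x - row_comb c h) i j =
    f (x + h) i j - f x i j - \sum_k h 0 k * c k i j.
  rewrite !mxE summxE [x + h]addrC; congr (_ - _).
  by apply: eq_bigr => k _; rewrite mxE.
apply: le_trans (H _) _.
  move=> z zr k; rewrite -ball_normE /= in xr.
  rewrite distrC in zr; have [d1 d2] := xr z zr k; split.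
    by move/derivable_mxP : d1; exact.
  apply: le_trans d2; have := mx_norm_ge ('D_(e_ k) f z - c k) i j.
  by rewrite {1}(derive_mx d1) !mxE.
rewrite ler_wpM2r// mulrCA ler_piMr ?(ltW e0)//.
by rewrite ler_pdivrMr// mul1r ler_nat.
Unshelve. all: by end_near. Qed.

Lemma is_derive_translate (V W : normedModType R) (f : V -> W) z c v df :
  is_derive (z + c) v f df -> is_derive z v (fun y => f (y + c)) df.
Proof.
have E : (fun h : R => h^-1 *: (((fun y => f (y + c)) \o shift z) (h *: v) -
      f (z + c))) =
    (fun h => h^-1 *: ((f \o shift (z + c)) (h *: v) - f (z + c))).
  by apply/funext => h /=; rewrite addrA.
move=> [dv vE]; apply: DeriveDef; first by rewrite /derivable E.
by rewrite -vE /derive E.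
Qed.

(** The mean value theorem along [a] for [y |-> f (y + s *: b) - f y], then along [b] for
    ['D_a f]. *)
Lemma second_difference (V : normedModType R) (f : V -> R) x a b (s : R) :
  (forall t t', 0 <= t <= 1 -> 0 <= t' <= 1 ->
    derivable f (x + (t * s) *: a + (t' * s) *: b) a /\
    derivable ('D_a f) (x + (t * s) *: a + (t' * s) *: b) b) ->
  exists t t', [/\ 0 <= t <= 1, 0 <= t' <= 1 &
    f (x + s *: a + s *: b) - f (x + s *: a) - (f (x + s *: b) - f x) =
    s * (s * 'D_b ('D_a f) (x + (t * s) *: a + (t' * s) *: b))].
Proof.
move=> fd; have l0 : 0 <= (0 : R) <= 1 by rewrite lexx ler01.
have l1 : 0 <= (1 : R) <= 1 by rewrite lexx ler01.
pose G y := f (y + s *: b) - f y.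
have Gd t : 0 <= t <= 1 -> is_derive (x + (t * s) *: a) a G
    ('D_a f (x + (t * s) *: a + s *: b) - 'D_a f (x + (t * s) *: a)).
  move=> t01; apply: is_deriveB.
    apply: is_derive_translate; apply: derivableP.
    by have [+ _] := fd t 1 t01 l1; rewrite (mul1r s).
  by apply: derivableP; have [+ _] := fd t 0 t01 l0; rewrite (mul0r s) scale0r addr0.
have [t t01 tE] := MVT_line (fun t t01 => @ex_derive _ _ _ _ _ _ _ (Gd t t01)).
have [t' t'01 t'E] := @MVT_line _ _ ('D_a f) (x + (t * s) *: a) b s
  (fun t' t'01 => (fd t t' t01 t'01).2).
exists t, t'; split=> //; rewrite -t'E -(@derive_val _ _ _ _ _ _ _ (Gd t t01)) -tE.
by rewrite /G.
Qed.

Lemma continuous_limits_eq (V : normedModType R) (f g : V -> R) x :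
  {for x, continuous f} -> {for x, continuous g} ->
  (forall d : R, 0 < d -> exists2 y, `|x - y| < d & exists2 y', `|x - y'| < d &
    f y = g y') -> f x = g x.
Proof.
move=> fc gc key; apply/eqP; rewrite -subr_eq0 -normr_le0.
apply/ler_addgt0Pr => e e0; rewrite add0r.
have e20 : 0 < e / 2 by rewrite divr_gt0.
have near_cst (h : V -> R) : {for x, continuous h} ->
    exists2 r, 0 < r & forall y, `|x - y| < r -> `|h x - h y| < e / 2.
  move=> /cvgrPdist_lt /(_ _ e20) /nbhs_ballP[r /= r0 hr].
  by exists r => // y yr; apply: hr; rewrite -ball_normE.
have [r1 r10 h1] := near_cst _ fc; have [r2 r20 h2] := near_cst _ gc.
have [|y yd [y' y'd yy']] := key (Num.min r1 r2); first by rewrite lt_min r10.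
have k1 := h1 y (lt_le_trans yd (ge_minl _ _)).
have k2 := h2 y' (lt_le_trans y'd (ge_minr _ _)).
rewrite yy' distrC in k1; rewrite ltW// [ltRHS]splitr distrC.
by rewrite -(subrKA (g y')) (le_lt_trans (ler_normD _ _))// ltrD.
Qed.

(* Both mixed derivatives are limits of the same second difference. *)
Lemma derive_comm (f : 'rV[R]_n -> R) x a b :
  (\forall y \near x, [/\ derivable f y a, derivable f y b,
     derivable ('D_a f) y b & derivable ('D_b f) y a]) ->
  {for x, continuous ('D_b ('D_a f))} -> {for x, continuous ('D_a ('D_b f))} ->
  'D_b ('D_a f) x = 'D_a ('D_b f) x.
Proof.
move=> fd cba cab.
suff : forall d : R, 0 < d -> exists2 y, `|x - y| < d & exists2 y', `|x - y'| < d &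
    'D_b ('D_a f) y = 'D_a ('D_b f) y'.
  by move=> key; exact: (continuous_limits_eq cba cab key).
move=> d d0; move: fd => /nbhs_ballP[r /= r0]; rewrite -ball_normE /= => fd.
pose M := `|a| + `|b| + 1; have M0 : 0 < M by rewrite ltr_wpDl// addr_ge0.
have mdr : 0 < Num.min d r by rewrite lt_min d0.
have [s s0 sM] : exists2 s, 0 < s & s * M < Num.min d r.
  exists (Num.min d r / 2 / M); first by rewrite !divr_gt0.
  by rewrite divfK ?lt0r_neq0// ltr_pdivrMr// ltr_pMr// ltr1n.
have near_x t t' : 0 <= t <= 1 -> 0 <= t' <= 1 ->
    `|x - (x + (t * s) *: a + (t' * s) *: b)| < Num.min d r.
  move=> /andP[t0 t1] /andP[t'0 t'1].
  have -> : x - (x + (t * s) *: a + (t' * s) *: b) = - ((t * s) *: a + (t' * s) *: b).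
    by rewrite -addrA opprD addrA subrr add0r.
  rewrite normrN (le_lt_trans (ler_normD _ _))// !normrZ.
  rewrite (ger0_norm t0) (ger0_norm t'0) (gtr0_norm s0).
  apply: le_lt_trans sM; have := normr_ge0 a; have := normr_ge0 b.
  rewrite /M => b0 a0.
  have h1 : t * s * `|a| <= s * `|a| by rewrite ler_wpM2r// ler_piMl// (ltW s0).
  have h2 : t' * s * `|b| <= s * `|b| by rewrite ler_wpM2r// ler_piMl// (ltW s0).
  nra.
have near_d t t' t01 t'01 := lt_le_trans (@near_x t t' t01 t'01) (ge_minl _ _).
have near_r t t' (t01 : 0 <= t <= 1) (t'01 : 0 <= t' <= 1) := fd _ (lt_le_trans (@near_x t t' t01 t'01) (ge_minr _ _)).
have [t [t' [t01 t'01 E1]]] : exists t t', [/\ 0 <= t <= 1, 0 <= t' <= 1 &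
    f (x + s *: a + s *: b) - f (x + s *: a) - (f (x + s *: b) - f x) =
    s * (s * 'D_b ('D_a f) (x + (t * s) *: a + (t' * s) *: b))].
  apply: second_difference => t t' t01 t'01.
  by have [da _ dab _] := near_r _ _ t01 t'01; exact: (conj da dab).
have [u' [u [u'01 u01 E2]]] : exists u' u, [/\ 0 <= u' <= 1, 0 <= u <= 1 &
    f (x + s *: b + s *: a) - f (x + s *: b) - (f (x + s *: a) - f x) =
    s * (s * 'D_a ('D_b f) (x + (u' * s) *: b + (u * s) *: a))].
  apply: second_difference => u' u u'01 u01; rewrite addrAC.
  by have [_ db _ dba] := near_r _ _ u01 u'01; exact: (conj db dba).
exists (x + (t * s) *: a + (t' * s) *: b); first exact: near_d.
exists (x + (u' * s) *: b + (u * s) *: a); first by rewrite addrAC; exact: near_d.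
apply: (mulfI (lt0r_neq0 s0)); apply: (mulfI (lt0r_neq0 s0)).
refine (etrans (esym E1) (etrans _ E2)).
by rewrite [x + s *: b + _]addrAC; ring.
Qed.

End Partials.

Lemma near_eq_continuous (T U : topologicalType) (f g : T -> U) x :
  (\near x, f x = g x) -> {for x, continuous f} -> {for x, continuous g}.
Proof.
move=> fg; rewrite /prop_for /continuous_at -(nbhs_singleton fg).
by apply: cvg_trans; apply: near_eq_cvg; apply: filterS fg => y ->.
Qed.

Lemma const_mx_continuous (R : realType) (T : topologicalType) (g : T -> R) x :
  {for x, continuous g} -> {for x, continuous (fun y => const_mx (g y) : 'M[R]_1)}.
Proof.
move=> gc; have /cvgrPdist_le H := gc; apply/cvgrPdist_le => e e0.
apply: filterS (H _ e0) => y ye; apply: mx_norm_le => [|i0 j0]; first exact: ltW.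
by rewrite !mxE.
Qed.

Section SmoothMaps.
Context {R : realType} {n : nat}.
Local Notation e_ i := (delta_mx 0 i : 'rV[R]_n).
Implicit Types (U : set 'rV[R]_n).

Lemma partials_cat (V : normedModType R) s s' (f : 'rV[R]_n -> V) :
  partials (s ++ s') f = partials s (partials s' f).
Proof. by elim: s => [//|i s IH] /=; rewrite IH. Qed.

Lemma smooth_on_partials (V : normedModType R) U s (f : 'rV[R]_n -> V) :
  smooth_on U f -> smooth_on U (partials s f).
Proof. by move=> fs s' x Ux; rewrite -partials_cat; exact: fs. Qed.

Lemma smooth_on_sub (V : normedModType R) U U' (f : 'rV[R]_n -> V) :
  U' `<=` U -> smooth_on U f -> smooth_on U' f.
Proof. by move=> sub fs s x /sub; exact: fs. Qed.

Lemma partials_entry a b U s (f : 'rV[R]_n -> 'M[R]_(a, b)) i j x :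
  open U -> smooth_on U f -> U x ->
  partials s (fun y => f y i j) x = partials s f x i j.
Proof.
move=> Uo fs; elim: s x => [//|k s IH] x Ux /=.
rewrite (near_eq_derive (g := fun y => partials s f y i j)); last first.
  by have : nbhs x U by [apply: open_nbhs_nbhs]; apply: filterS => y; exact: IH.
by rewrite (derive_mx ((fs s x Ux).2 k)) mxE.
Qed.

Lemma smooth_on_entry a b U (f : 'rV[R]_n -> 'M[R]_(a, b)) i j :
  open U -> smooth_on U f -> smooth_on U (fun y => f y i j).
Proof.
move=> Uo fs s x Ux.
have E : {near x, partials s (fun y => f y i j) =1 fun y => partials s f y i j}.
  have : nbhs x U by apply: open_nbhs_nbhs.
  by apply: filterS => y Uy; exact: (partials_entry s i j Uo fs Uy).
split.
  apply: (@near_eq_continuous _ _ (fun y => partials s f y i j)).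
    by move: E; apply: filterS => y ->.
  have := (fs s x Ux).1 => c1.
  exact: (cvg_comp _ _ c1 (@coord_continuous R a b i j (partials s f x))).
move=> k; apply: (near_eq_derivable (f := fun y => partials s f y i j)).
  by move: E; apply: filterS => y ->.
by have /derivable_mxP := (fs s x Ux).2 k; exact.
Qed.

Lemma smooth_on_differentiable a b U (f : 'rV[R]_n -> 'M[R]_(a, b)) x :
  open U -> smooth_on U f -> U x -> differentiable f x.
Proof.
move=> Uo fs Ux; apply: C1_differentiable => [|i].
  have : nbhs x U by apply: open_nbhs_nbhs.
  by apply: filterS => y Uy i; exact: (fs [::] y Uy).2.
exact: (fs [:: i] x Ux).1.
Qed.

Lemma C1_differentiable_real (f : 'rV[R]_n -> R) x :
  (\forall y \near x, forall i, derivable f y (e_ i)) ->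
  (forall i, {for x, continuous ('D_(e_ i) f)}) ->
  differentiable f x.
Proof.
move=> fd fc; pose F y : 'M[R]_1 := const_mx (f y).
have FE y : f y = F y 0 0 by rewrite mxE.
have Fd y i : derivable f y (e_ i) -> derivable F y (e_ i).
  move=> fy; apply/derivable_mxP => i0 j0.
  by rewrite (_ : (fun x => _) = f)//; apply/funext => z; rewrite mxE.
have -> : f = (fun M : 'M[R]_1 => M 0 0) \o F by apply/funext => y /=; rewrite mxE.
apply: differentiable_comp; last exact: differentiable_coord.
apply: C1_differentiable => [|i]; first by move: fd; apply: filterS => y fy i; exact: Fd.
have : {near x, (fun y => const_mx ('D_(e_ i) f y) : 'M[R]_1) =1 'D_(e_ i) F}.
  move: fd; apply: filterS => y fy; apply/matrixP => i0 j0.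
  have E := congr1 (fun M : 'M[R]_1 => M i0 j0) (derive_mx (Fd y i (fy i))).
  refine (etrans (mxE _ _ _ _) (esym (etrans E (etrans (mxE _ _ _ _) _)))).
  by congr (derive _ y _); apply/funext => z; rewrite mxE.
move=> E; exact: (near_eq_continuous E (const_mx_continuous (fc i))).
Qed.

Lemma derive_comp_curve (m : nat) (V : normedModType R) (h : 'rV[R]_m -> V)
    (c : R -> 'rV[R]_m) (t : R) dc :
  is_derive t 1 c dc -> differentiable h (c t) ->
  is_derive t 1 (h \o c) ('d h (c t) dc).
Proof.
move=> [cd cE] hd; have cd' : differentiable c t by apply/derivable1_diffP.
have hcd : differentiable (h \o c) t by exact: differentiable_comp.
apply: DeriveDef; first exact: diff_derivable.
refine (etrans (deriveE _ hcd) _).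
refine (etrans (congr1 (fun f => f 1) (diff_comp cd' hd)) _).
by rewrite /= -cE; congr ('d h (c t) _); rewrite deriveE.
Qed.

Lemma derive_comp (m : nat) (V : normedModType R) (h : 'rV[R]_m -> V)
    (g : 'rV[R]_n -> 'rV[R]_m) x v :
  differentiable h (g x) -> derivable g x v ->
  is_derive x v (h \o g) ('d h (g x) ('D_v g x)).
Proof.
move=> hd gd; pose c (s : R) := g (x + s *: v).
have c0 : c 0 = g x by rewrite /c scale0r addr0.
have ld : is_derive (0 : R) 1 c ('D_v g x).
  by apply: is_derive_line; rewrite scale0r addr0; exact: derivableP.
rewrite -c0 in hd *; have [e1 e2] := derive_comp_curve ld hd.
have E : (fun s : R => s^-1 *: (((h \o g) \o shift x) (s *: v) - (h \o g) x)) =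
   (fun s => s^-1 *: (((h \o c) \o shift 0) (s *: 1) - (h \o c) 0)).
  by apply/funext => s /=; rewrite /c addr0 scaler1 scale0r addr0 [s *: v + x]addrC.
by apply: DeriveDef; rewrite ?/derivable ?/derive E.
Qed.

End SmoothMaps.

(** * Families with jointly continuous derivatives *)

Section Jets.
Context {R : realType} {P : topologicalType} {n : nat}.
Local Notation e_ i := (delta_mx 0 i : 'rV[R]_n).
Implicit Types (W : set (P * 'rV[R]_n)) (h : P -> 'rV[R]_n -> R).

(** The derivatives in the space variable up to order [r] exist and are continuous in parameter and
    space together. Nothing is differentiated in the parameter, as the C^oo topology only sees
    derivatives of the individual maps. *)
Fixpoint jet (r : nat) W h : Prop :=
  (forall z, W z -> {for z, continuous (fun z => h z.1 z.2)}) /\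
  if r is r'.+1 then forall i, (forall z, W z -> derivable (h z.1) z.2 (e_ i)) /\
    jet r' W (fun p => 'D_(e_ i) (h p)) else True.

Lemma jet_continuous r W h : jet r W h ->
  forall z, W z -> {for z, continuous (fun z => h z.1 z.2)}.
Proof. by case: r => [|r] []. Qed.

Lemma jet_sub r W W' h : W' `<=` W -> jet r W h -> jet r W' h.
Proof.
move=> sub; elim: r h => [|r IH] h [hc hd]; split; try by move=> z /sub; exact: hc.
  by [].
by move=> i; have [hdi hj] := hd i; split; [move=> z /sub; exact: hdi|exact: IH].
Qed.

Lemma jet_le r r' W h : (r' <= r)%N -> jet r W h -> jet r' W h.
Proof.
elim: r r' h => [|r IH] [|r'] h //= rr' [hc hd]; split=> // i.
by have [hdi hj] := hd i; split=> //; exact: IH.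
Qed.

Lemma near_slice W z : open W -> W z -> \forall y \near z.2, W (z.1, y).
Proof.
case: z => p x Wo Wz; have : nbhs (p, x) W by exact: open_nbhs_nbhs.
have c : {for x, continuous (fun y => (p, y))}.
  by apply: continuous_pairing; [exact: cst_continuous|exact: cvg_id].
by move=> /c.
Qed.

Lemma jet_eq r W h h' : open W -> (forall z, W z -> h z.1 z.2 = h' z.1 z.2) ->
  jet r W h -> jet r W h'.
Proof.
move=> Wo; elim: r h h' => [|r IH] h h' hh' [hc hd].
  split=> // z Wz; apply: near_eq_continuous (hc z Wz).
  by have : nbhs z W by [exact: open_nbhs_nbhs]; apply: filterS.
split=> [z Wz|i].
  apply: near_eq_continuous (hc z Wz).
  by have : nbhs z W by [exact: open_nbhs_nbhs]; apply: filterS.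
have [hdi hj] := hd i.
have E z : W z -> \forall y \near z.2, h z.1 y = h' z.1 y.
  by move=> Wz; apply: filterS (near_slice Wo Wz) => y; exact: hh'.
split=> [z Wz|]; first exact: near_eq_derivable (E z Wz) (hdi z Wz).
by apply: (IH _ _ _ hj) => z Wz; exact: near_eq_derive (E z Wz).
Qed.

Lemma jet_cst r W (c : R) : jet r W (fun=> cst c).
Proof.
elim: r c => [|r IH] c; split=> //=; try by move=> z _; exact: cst_continuous.
move=> i; split=> [z _|]; first exact: derivable_cst.
rewrite (_ : (fun p => _) = (fun=> cst 0)); first exact: IH.
by apply/funext => p; apply/funext => x; rewrite derive_cst.
Qed.

Lemma jet_add r W h h' : open W -> jet r W h -> jet r W h' ->
  jet r W (fun p => h p \+ h' p).
Proof.
move=> Wo; elim: r h h' => [|r IH] h h' [hc hd] [hc' hd'].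
  by split=> // z Wz; exact: (continuousD (hc z Wz) (hc' z Wz)).
split=> [z Wz|i]; first exact: (continuousD (hc z Wz) (hc' z Wz)).
have [hdi hj] := hd i; have [hdi' hj'] := hd' i.
split=> [z Wz|]; first exact: (derivableD (hdi z Wz) (hdi' z Wz)).
apply: (jet_eq Wo _ (IH _ _ hj hj')) => z Wz.
by rewrite (deriveD (hdi z Wz) (hdi' z Wz)).
Qed.

Lemma jet_mul r W h h' : open W -> jet r W h -> jet r W h' ->
  jet r W (fun p => h p \* h' p).
Proof.
move=> Wo; elim: r h h' => [|r IH] h h' jh jh'.
  by split=> // z Wz; exact: (continuousM (jet_continuous jh Wz) (jet_continuous jh' Wz)).
split=> [z Wz|i].
  exact: (continuousM (jet_continuous jh Wz) (jet_continuous jh' Wz)).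
have [hc hd] := jh; have [hc' hd'] := jh'.
have [hdi hj] := hd i; have [hdi' hj'] := hd' i.
split=> [z Wz|]; first exact: (derivableM (hdi z Wz) (hdi' z Wz)).
have j := jet_le (leqnSn r) jh; have j' := jet_le (leqnSn r) jh'.
apply: (jet_eq Wo _ (jet_add Wo (IH _ _ j hj') (IH _ _ j' hj))) => z Wz.
by rewrite (deriveM (hdi z Wz) (hdi' z Wz)).
Qed.

Lemma jet_sum (I : Type) (s : seq I) r W (h : I -> P -> 'rV[R]_n -> R) :
  open W -> (forall i, jet r W (h i)) -> jet r W (fun p x => \sum_(i <- s) h i p x).
Proof.
move=> Wo hj; elim: s => [|i s IH].
  rewrite (_ : (fun p => _) = (fun=> cst 0)); first exact: jet_cst.
  by apply/funext => p; apply/funext => x; rewrite big_nil.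
apply: (jet_eq Wo _ (jet_add Wo (hj i) IH)) => z _ /=.
by rewrite big_cons.
Qed.

Lemma jet_differentiable r W h z : open W -> jet r.+1 W h -> W z ->
  differentiable (h z.1) z.2.
Proof.
move=> Wo [hc hd] Wz; apply: C1_differentiable_real.
  apply: filterS (near_slice Wo Wz) => y Wy i.
  by have [hdi _] := hd i; exact: (hdi _ Wy).
move=> i; have [_ hj] := hd i.
have c : {for z.2, continuous (fun y => (z.1, y))}.
  by apply: continuous_pairing; [exact: cst_continuous|exact: cvg_id].
have hjc := jet_continuous hj Wz; case: z Wz c hjc => p x /= Wz c hjc.
exact: (continuous_comp (f := fun y => (p, y)) c hjc).
Qed.

Lemma jet_partials r W h s : jet r W h -> (size s <= r)%N ->
  forall z, W z -> {for z, continuous (fun z => partials s (h z.1) z.2)}.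
Proof.
elim/last_ind: s r h => [|s i IH] r h jh; first by move=> _; exact: jet_continuous jh.
rewrite size_rcons; case: r jh => [//|r] [_ hd] sr z Wz.
have [_ hj] := hd i; apply: near_eq_continuous (IH r _ hj sr z Wz).
by apply: filterE => y; rewrite -cats1 partials_cat.
Qed.

Lemma jet_all_partials W h r :
  (forall s, (size s <= r)%N -> forall z, W z ->
    {for z, continuous (fun z => partials s (h z.1) z.2)} /\
    forall i, derivable (partials s (h z.1)) z.2 (e_ i)) -> jet r W h.
Proof.
elim: r h => [|r IH] h hs; split=> //; try by move=> z Wz; exact: (hs [::] _ z Wz).1.
move=> i; split=> [z Wz|]; first exact: (hs [::] _ z Wz).2.
apply: IH => s sr z Wz; have := hs (rcons s i) _ z Wz; rewrite size_rcons => /(_ sr).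
have E p : partials (rcons s i) (h p) = partials s ('D_(e_ i) (h p)).
  by rewrite -cats1 partials_cat.
move=> [hc hdi]; split=> [|k]; last by rewrite -E; exact: hdi.
by apply: near_eq_continuous hc; apply: filterE => y; rewrite E.
Qed.

End Jets.

Lemma smooth_on_jet (R : realType) (P : topologicalType) n (U : set 'rV[R]_n) f r :
  smooth_on U f -> jet r [set z : P * 'rV[R]_n | U z.2] (fun=> f).
Proof.
move=> fs; apply: jet_all_partials => s _ z Uz; split; last exact: (fs s z.2 Uz).2.
have c : {for z, continuous (fun z : P * 'rV[R]_n => z.2)} by exact: cvg_snd.
exact: (continuous_comp (g := partials s f) c (fs s z.2 Uz).1).
Qed.

Lemma mx_continuous (R : realType) (T : topologicalType) a b (f : T -> 'M[R]_(a, b)) x :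
  (forall i j, {for x, continuous (fun y => f y i j)}) -> {for x, continuous f}.
Proof.
move=> fc; apply/cvgrPdist_le => e e0.
have : \forall y \near x, forall i j, `|f x i j - f y i j| <= e.
  apply: filter_forall => i; apply: filter_forall => j.
  by have /cvgrPdist_le := fc i j; apply.
apply: filterS => y ye; apply: mx_norm_le => [|i j]; first exact: ltW.
by rewrite !mxE; exact: ye.
Qed.

Lemma diff_row (R : realType) n (f : 'rV[R]_n -> R) x v :
  differentiable f x -> 'd f x v = \sum_i v 0 i * 'D_(delta_mx 0 i) f x.
Proof.
move=> fx; rewrite [in LHS](row_sum_delta v) linear_sum.
by apply: eq_bigr => i _; rewrite linearZ /= deriveE.
Qed.

(** By the chain rule, a derivative of the composite is a sum of products of a derivative of [g] and
    a composite of the same kind with a derivative of [h]; hence the induction on [r]. The change of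
    parameter [tau] serves the translation of time in [flow_jet]. *)
Lemma jet_comp (R : realType) (P Q : topologicalType) n m r
    (W : set (P * 'rV[R]_m)) (W' : set (Q * 'rV[R]_n)) h (tau : Q -> P) g :
  open W -> open W' -> (forall z, W' z -> {for z.1, continuous tau}) ->
  (forall z, W' z -> W (tau z.1, g z.1 z.2)) ->
  jet r W h -> (forall k, jet r W' (fun q x => g q x 0 k)) ->
  jet r W' (fun q x => h (tau q) (g q x)).
Proof.
move=> Wo W'o tauc sub.
have cont r' h' : jet r' W h' -> (forall k, jet r' W' (fun q x => g q x 0 k)) ->
    forall z, W' z -> {for z, continuous (fun z => h' (tau z.1) (g z.1 z.2))}.
  move=> jh jg z Wz.
  have c : {for z, continuous (fun z : Q * 'rV[R]_n => (tau z.1, g z.1 z.2))}.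
    apply: continuous_pairing.
      apply: (continuous_comp (f := fst) (g := tau)); first exact: cvg_fst.
      exact: tauc.
    by apply: mx_continuous => i j; rewrite (ord1 i); exact: jet_continuous (jg j) z Wz.
  exact: (continuous_comp (g := fun z : P * 'rV[R]_m => h' z.1 z.2) c
    (jet_continuous jh (sub z Wz))).
elim: r h => [|r IH] h jh jg; first by split=> //; exact: (cont _ _ jh jg).
split=> [|i]; first exact: (cont _ _ jh jg).
have D z : W' z -> is_derive z.2 (delta_mx 0 i) (h (tau z.1) \o g z.1)
    (\sum_k 'D_(delta_mx 0 i) (fun x => g z.1 x 0 k) z.2 *
       'D_(delta_mx 0 k) (h (tau z.1)) (g z.1 z.2)).
  move=> Wz; have hdiff := jet_differentiable Wo jh (sub z Wz).
  have gd : derivable (g z.1) z.2 (delta_mx 0 i).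
    apply/derivable_mxP => i0 k; rewrite (ord1 i0).
    by have [_ /(_ i)[gdi _]] := jg k; exact: (gdi z Wz).
  have := derive_comp hdiff gd; rewrite (diff_row _ hdiff).
  rewrite (_ : \sum_i0 _ = \sum_k 'D_(delta_mx 0 i) (fun x => g z.1 x 0 k) z.2 *
       'D_(delta_mx 0 k) (h (tau z.1)) (g z.1 z.2))//.
  by apply: eq_bigr => k _; congr (_ * _); rewrite (derive_mx gd) mxE.
split=> [z Wz|]; first exact: (@ex_derive _ _ _ _ _ _ _ (D z Wz)).
have jg' k : jet r W' (fun q x => g q x 0 k) by exact: jet_le (leqnSn r) (jg k).
apply: (@jet_eq _ _ _ r W' (fun q x => \sum_k 'D_(delta_mx 0 i) (fun x => g q x 0 k) x *
   'D_(delta_mx 0 k) (h (tau q)) (g q x))) => //.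
  by move=> z Wz; exact: esym (@derive_val _ _ _ _ _ _ _ (D z Wz)).
apply: (@jet_sum _ _ _ _ _ r W' (fun k q x => 'D_(delta_mx 0 i) (fun x => g q x 0 k) x *
   'D_(delta_mx 0 k) (h (tau q)) (g q x)) W'o) => k.
have j1 : jet r W' (fun q => 'D_(delta_mx 0 i) (fun x => g q x 0 k)).
  by have [_ /(_ i)[_]] := jg k.
have j2 : jet r W' (fun q x => 'D_(delta_mx 0 k) (h (tau q)) (g q x)).
  by have [_ /(_ k)[_ hk]] := jh; exact: (IH _ hk jg').
exact: jet_mul W'o j1 j2.
Qed.

(** * Flows on manifolds *)

Lemma locally_lipschitz (R : realType) n a b (U : set 'rV[R]_n)
    (f : 'rV[R]_n -> 'M[R]_(a, b)) x :
  open U -> smooth_on U f -> U x ->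
  exists r L : R, [/\ 0 < r, 0 <= L, forall y, `|y - x| < r -> U y &
    forall y y', `|y - x| < r -> `|y' - x| < r -> `|f y' - f y| <= L * `|y' - y| ].
Proof.
move=> Uo fs Ux.
pose L := 1 + \sum_i `|'D_(delta_mx 0 i) f x|.
have L0 : 0 <= L by rewrite addr_ge0// sumr_ge0.
have near_L : \forall y \near x, forall i, `|'D_(delta_mx 0 i) f y| <= L.
  apply: (@filter_forall _ 'I_n (fun i y => is_true (`|'D_(delta_mx 0 i) f y| <= L)) (nbhs x)) => i.
  have /cvgrPdist_le /(_ 1 ltr01) := (fs [:: i] x Ux).1.
  apply: filterS => y yE; rewrite distrC in yE.
  have Li : `|'D_(delta_mx 0 i) f x| <= \sum_i `|'D_(delta_mx 0 i) f x|.
    by rewrite [leRHS](bigD1 i)//= lerDl sumr_ge0.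
  apply: le_trans (lerD yE Li).
  by apply: le_trans (ler_normD _ _); rewrite subrK.
have nU : nbhs x U by exact: open_nbhs_nbhs.
have : nbhs x (U `&` [set y | forall i, `|'D_(delta_mx 0 i) f y| <= L]) by exact: filterI.
move=> /nbhs_ballP[r /= r0]; rewrite -ball_normE /= => xr.
have {}xr y : `|y - x| < r -> U y /\ forall i, `|'D_(delta_mx 0 i) f y| <= L.
  by rewrite distrC => /xr.
exists r, (n%:R * L); split => //; first by rewrite mulr_ge0.
  by move=> y /xr[].
move=> y y' yx y'x; apply: mx_norm_le => [|i j]; first by rewrite !mulr_ge0.
have := @partials_estimate R n (fun y => f y i j) x y (y' - y) r (fun=> 0) L.
rewrite big1; last by move=> k _; rewrite mulr0.
have yE : y + (y' - y) = y' by rewrite addrC subrK.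
rewrite subr0 yE !mxE; apply => // z zx k.
have [Uz Lz] := xr z zx; have [_ /(_ k) d] := fs [::] z Uz; split.
  by have /derivable_mxP := d; exact.
have E := congr1 (fun M : 'M[R]_(a, b) => M i j) (derive_mx d).
have {}E := etrans E (mxE _ _ _ _).
rewrite subr0; apply: le_trans (Lz k); apply: le_trans (mx_norm_ge _ i j).
exact: (eq_ind _ (fun t : R => is_true (`|t| <= _)) (lexx _) _ E).
Qed.

(** * Charts and uniqueness of integral curves *)

Section Charts.
Context {R : realType} {n : nat} {M : manifold R n}.
Implicit Types (i j : chart_index M) (p : M) (x : 'rV[R]_n).

Definition chart_img i : set 'rV[R]_n := chart i @` dom i.

Lemma chart_imgP i x : chart_img i x ->
  dom i (chart_inv i x) /\ chart i (chart_inv i x) = x.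
Proof. by move=> [p ip <-]; rewrite chartK. Qed.

Lemma chart_img_chart i p : dom i p -> chart_img i (chart i p).
Proof. by move=> ip; exists p. Qed.

Lemma chart_continuous_at i p : dom i p -> {for p, continuous (chart i)}.
Proof.
move=> ip; have := @chart_continuous _ _ M i.
rewrite continuous_open_subspace; last exact: dom_open.
by apply; rewrite inE.
Qed.

Lemma chart_inv_continuous_at i x : chart_img i x ->
  {for x, continuous (chart_inv i : 'rV[R]_n -> M)}.
Proof.
move=> ix; have := @chart_inv_continuous _ _ M i.
rewrite continuous_open_subspace; last exact: chart_open.
by apply; rewrite inE.
Qed.

Lemma near_dom i p : dom i p -> nbhs p (dom i).
Proof. by move=> ip; apply: open_nbhs_nbhs; split=> //; exact: dom_open. Qed.

Lemma near_chart_img i x : chart_img i x -> nbhs x (chart_img i).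
Proof. by move=> ix; apply: open_nbhs_nbhs; split=> //; exact: chart_open. Qed.

Lemma near_chart i p (r : R) : dom i p -> 0 < r ->
  \forall q \near p, dom i q /\ `|chart i q - chart i p| < r.
Proof.
move=> ip r0; apply: filterI; first exact: near_dom.
have /cvgrPdist_lt /(_ r r0) := chart_continuous_at ip.
by apply: filterS => q; rewrite distrC.
Qed.

Lemma chart_ball i p (V : set M) : dom i p -> nbhs p V ->
  exists2 r : R, 0 < r & forall x, `|x - chart i p| < r ->
    chart_img i x /\ V (chart_inv i x).
Proof.
move=> ip pV; have ix := chart_img_chart ip.
have : \forall x \near chart i p, chart_img i x /\ V (chart_inv i x).
  apply: filterI; first exact: near_chart_img.
  by have := chart_inv_continuous_at ix; apply; rewrite chartK.
move=> /nbhs_ballP[r /= r0 h]; exists r => // x xr; apply: h.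
by rewrite -ball_normE /= distrC.
Qed.

Definition integral_curve (xi : vector_field M) (c : R -> M) := continuous c /\
  forall i t, dom i (c t) -> is_derive t (1 : R) (chart i \o c) (xi i (c t)).

Lemma integral_curve_shift xi c (s : R) :
  integral_curve xi c -> integral_curve xi (fun t => c (t + s)).
Proof.
move=> [cc cd]; split.
  move=> t; apply: (continuous_comp (f := fun t => t + s) (g := c)); last exact: cc.
  by apply: (@continuousD _ _ _ id (cst s)); [exact: cvg_id|exact: cst_continuous].
by move=> i t it; apply: (@is_derive_translate R R 'rV[R]_n (chart i \o c)); exact: cd.
Qed.

(** In a chart the difference [D] of the curves vanishes at [t0] and its derivative is bounded by
    [L * |D|]. On an interval of radius [d] with [d * L <= 1 / 2], the mean value theorem bounds the
    maximum of [|D|] by half of itself. *)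
Lemma integral_curve_local_uniqueness xi c1 c2 (t0 : R) :
  integral_curve xi c1 -> integral_curve xi c2 -> c1 t0 = c2 t0 ->
  \forall t \near t0, c1 t = c2 t.
Proof.
move=> [c1c c1d] [c2c c2d] c12.
have [i ip] := dom_cover (c1 t0); have ix := chart_img_chart ip.
have [r [L [r0 L0 rU lip]]] := locally_lipschitz (@chart_open _ _ _ i)
  (@field_smooth _ _ _ xi i) ix.
have near_curve c : continuous c -> c t0 = c1 t0 ->
    \forall t \near t0, dom i (c t) /\ `|chart i (c t) - chart i (c1 t0)| < r.
  move=> cc ct0.
  have H : nbhs (c t0) [set q | dom i q /\ `|chart i q - chart i (c1 t0)| < r].
    by rewrite ct0; exact: near_chart.
  exact: (cc t0 _ H).
have : nbhs t0 ([set t | dom i (c1 t) /\ `|chart i (c1 t) - chart i (c1 t0)| < r] `&`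
    [set t | dom i (c2 t) /\ `|chart i (c2 t) - chart i (c1 t0)| < r]).
  exact: filterI (near_curve c1 c1c erefl) (near_curve c2 c2c (esym c12)).
move=> /nbhs_ballP[d0 /= d00]; rewrite -ball_normE /= => H.
pose d := Num.min (d0 / 2) (2 * (L + 1))^-1.
have L1 : 0 < 2 * (L + 1) by rewrite mulr_gt0// ltr_wpDl.
have d1 : 0 < d by rewrite lt_min divr_gt0//= invr_gt0.
have {}H t : `|t - t0| <= d -> [/\ dom i (c1 t), dom i (c2 t),
    `|chart i (c1 t) - chart i (c1 t0)| < r & `|chart i (c2 t) - chart i (c1 t0)| < r].
  move=> td; have [|[]] := H t; last by move=> h1 h2 [h3 h4].
  rewrite /= distrC (le_lt_trans td)// (le_lt_trans (ge_minl _ _))//.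
  by rewrite ltr_pdivrMr// ltr_pMr// ltr1n.
pose D t := chart i (c1 t) - chart i (c2 t).
pose X t := xi i (c1 t) - xi i (c2 t).
have Dd t : `|t - t0| <= d -> is_derive t (1 : R) D (X t).
  by move=> /H[h1 h2 _ _]; apply: is_deriveB; [exact: c1d|exact: c2d].
have XD t : `|t - t0| <= d -> `|X t| <= L * `|D t|.
  by move=> /H[h1 h2 h3 h4]; have := lip _ _ h4 h3; rewrite /= !chartK.
have Dt0 : D t0 = 0 by rewrite /D c12 subrr.
have seg t : (t \in `[t0 - d, t0 + d]) = (`|t - t0| <= d).
  by rewrite in_itv /= ler_distl.
have Dc : {within `[t0 - d, t0 + d], continuous (fun t => `|D t|)}.
  apply: continuous_in_subspaceT => t; rewrite inE /= seg => td.
  apply: (continuous_comp (f := D)); last exact: norm_continuous.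
  by apply/differentiable_continuous/derivable1_diffP; exact: (@ex_derive _ _ _ _ _ _ _ (Dd t td)).
have t0in : `[t0 - d, t0 + d]%classic t0 by rewrite /= seg subrr normr0 ltW.
have [tm] := @compact_EVT_max _ R (fun t => `|D t|) `[t0 - d, t0 + d]%classic
  (ex_intro _ t0 t0in) (@segment_compact _ _ _) Dc.
rewrite inE /= seg => tmd tmax.
have Dtm : `|D tm| <= 2^-1 * `|D tm|.
  apply: mx_norm_le => [|i0 k]; first by rewrite mulr_ge0.
  rewrite (ord1 i0).
  have Dk t : `|t - t0| <= d -> is_derive t (1 : R) (fun t => D t 0 k) (X t 0 k).
    move=> td; have [dd dE] := Dd t td; split; first by have /derivable_mxP := dd; exact.
    by rewrite -dE; have E := congr1 (fun M : 'rV[R]_n => M 0 k) (derive_mx dd);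
      exact: esym (etrans E (mxE _ _ _ _)).
  have td s : 0 <= s <= 1 -> `|t0 + (s * (tm - t0)) *: 1 - t0| <= d.
    move=> /andP[s0 s1]; rewrite scaler1 addrAC subrr add0r normrM (ger0_norm s0).
    by apply: le_trans tmd; rewrite ler_piMl.
  have [s s01] := @MVT_line R R (fun t => D t 0 k) t0 1 (tm - t0)
    (fun s s01 => @ex_derive _ _ _ _ _ _ _ (Dk _ (td s s01))).
  rewrite (@derive_val _ _ _ _ _ _ _ (Dk _ (td s s01))).
  have tmE : t0 + (tm - t0) *: 1 = tm by rewrite scaler1 addrC subrK.
  have Dt0k : D t0 0 k = 0 by rewrite Dt0 mxE.
  rewrite tmE Dt0k subr0 => ->.
  rewrite normrM; set t := t0 + _ in td *.
  have Xt : `|X t 0 k| <= L * `|D tm|.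
    apply: le_trans (mx_norm_ge _ 0 k) _; apply: le_trans (XD t (td s s01)) _.
    by rewrite ler_wpM2l// tmax// inE /= seg; exact: td.
  apply: le_trans (ler_pM _ _ tmd Xt) _ => //.
  have dL : d <= (2 * (L + 1))^-1 by exact: ge_minr.
  rewrite mulrA ler_wpM2r//; apply: le_trans (ler_wpM2r L0 dL) _.
  by rewrite mulrC ler_pdivrMr// mulrA mulVf// mul1r lerDl.
have Dtm0 : `|D tm| = 0.
  by apply/eqP; rewrite eq_le normr_ge0 andbT; move: Dtm; lra.
apply/nbhs_ballP; exists d => //= t; rewrite -ball_normE /= distrC => /ltW td.
have [h1 h2 _ _] := H t td.
have /eqP : D t = 0.
  by apply/eqP; rewrite -normr_le0 -Dtm0; apply: tmax; rewrite inE /= seg.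
by rewrite subr_eq0 => /eqP E; rewrite -(chartK h1) E chartK.
Qed.

(** The set of times of agreement is open by local uniqueness, and closed because [M] is
    Hausdorff. *)
Lemma integral_curve_uniqueness xi c1 c2 (t0 : R) :
  integral_curve xi c1 -> integral_curve xi c2 -> c1 t0 = c2 t0 -> c1 = c2.
Proof.
move=> ic1 ic2 c12; pose E := [set t | c1 t = c2 t].
suff ET : E = setT by apply/funext => t; have : E t by rewrite ET.
have /connected_intervalP RC : is_interval [set: R] by [].
apply: RC; first by exists t0.
  exists E; last by rewrite setTI.
  rewrite openE => t Et; exact: integral_curve_local_uniqueness ic1 ic2 Et.
exists E; last by rewrite setTI.
rewrite -openC openE => t Et.
have := @space_hausdorff _ _ M; rewrite open_hausdorff => /(_ (c1 t) (c2 t)).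
have ne : c1 t != c2 t by apply/eqP.
move=> /(_ ne) [[A B] /=]; rewrite !inE => -[At Bt] [Ao Bo AB].
have [c1c _] := ic1; have [c2c _] := ic2.
have nA : nbhs t (c1 @^-1` A) by exact: (c1c t _ (open_nbhs_nbhs (conj Ao At))).
have nB : nbhs t (c2 @^-1` B) by exact: (c2c t _ (open_nbhs_nbhs (conj Bo Bt))).
apply: filterS (filterI nA nB) => s [/= As Bs] /= cs.
suff : set0 (c1 s) by [].
by rewrite -AB; split=> //; rewrite (cs : c1 s = c2 s).
Qed.

End Charts.

Lemma jet_derive (R : realType) (P : topologicalType) n r (W : set (P * 'rV[R]_n)) h v :
  open W -> jet r.+1 W h -> jet r W (fun p => 'D_v (h p)).
Proof.
move=> Wo jh; apply: (@jet_eq _ _ _ r W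
  (fun p x => \sum_i v 0 i * 'D_(delta_mx 0 i) (h p) x)) => //.
  by move=> z Wz; have hd := jet_differentiable Wo jh Wz; rewrite deriveE// diff_row.
apply: (@jet_sum _ _ _ _ _ r W (fun i p x => v 0 i * 'D_(delta_mx 0 i) (h p) x) Wo) => i.
have [_ /(_ i)[_ hj]] := jh.
exact: jet_mul Wo (jet_cst r W (v 0 i)) hj.
Qed.

Section MixedDerivatives.
Context {R : realType} {n : nat} (U : set 'rV[R]_n).
Hypothesis Uo : open U.

(** The first component is a dummy parameter: a single function is treated as a constant family. *)
Let W : set (R * 'rV[R]_n) := [set z | U z.2].

Let Wo : open W.
Proof.
rewrite openE => z Wz; have nU : nbhs z.2 U by exact: open_nbhs_nbhs.
have c : {for z, continuous (fun z : R * 'rV[R]_n => z.2)} by exact: cvg_snd.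
exact: (c _ nU).
Qed.

Lemma smooth_derive_continuous (f : 'rV[R]_n -> R) x a b :
  smooth_on U f -> U x -> {for x, continuous ('D_b ('D_a f))}.
Proof.
move=> fs Ux; have j2 := @smooth_on_jet R R n U f 2 fs.
have j0 := jet_derive b Wo (jet_derive a Wo j2).
have c : {for x, continuous (fun y : 'rV[R]_n => (0 : R, y))}.
  by apply: continuous_pairing; [exact: cst_continuous|exact: cvg_id].
exact: (continuous_comp (f := fun y => (0 : R, y)) c (jet_continuous j0 (z := (0, x)) Ux)).
Qed.

Lemma smooth_derivable (f : 'rV[R]_n -> R) x a :
  smooth_on U f -> U x -> differentiable f x /\ differentiable ('D_a f) x.
Proof.
move=> fs Ux; have j2 := @smooth_on_jet R R n U f 2 fs.
split; first exact: (jet_differentiable Wo j2 (z := (0, x)) Ux).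
exact: (jet_differentiable Wo (jet_derive a Wo j2) (z := (0, x)) Ux).
Qed.

Lemma smooth_derive_comm (f : 'rV[R]_n -> R) x a b :
  smooth_on U f -> U x -> 'D_b ('D_a f) x = 'D_a ('D_b f) x.
Proof.
move=> fs Ux; apply: derive_comm.
- have nU : nbhs x U by exact: open_nbhs_nbhs.
  apply: filterS nU => y Uy; have [f0 fa] := smooth_derivable a fs Uy.
  have [_ fb] := smooth_derivable b fs Uy.
  split; [exact: (diff_derivable f0)|exact: (diff_derivable f0)|
    exact: (diff_derivable fa)|exact: (diff_derivable fb)].
- exact: smooth_derive_continuous fs Ux.
- exact: smooth_derive_continuous fs Ux.
Qed.

End MixedDerivatives.

Section Pairing.
Context {R : realType} {n : nat}.
Implicit Types (w : 'rV[R]_n) (c : 'cV[R]_n).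

Lemma pair_cvE (v : 'rV[R]_n) c : pair_cv v c = \sum_k v 0 k * c k 0.
Proof. by rewrite /pair_cv mxE. Qed.

Lemma pair_cvBl (v w : 'rV[R]_n) c : pair_cv (v - w) c = pair_cv v c - pair_cv w c.
Proof. by rewrite /pair_cv mulmxBl !mxE. Qed.

Lemma pair_cvBr (v : 'rV[R]_n) c c' : pair_cv v (c - c') = pair_cv v c - pair_cv v c'.
Proof. by rewrite /pair_cv mulmxBr !mxE. Qed.

Lemma derive_pair_cv (V : normedModType R) (N : V -> 'cV[R]_n) w (x v : V) :
  differentiable N x ->
  'D_v (fun y => pair_cv w (N y)) x = pair_cv w ('d N x v).
Proof.
move=> Nd; have Ndv := diff_derivable (v := v) Nd.
have E : (fun y => pair_cv w (N y)) = \sum_k (w 0 k \*: (fun y => N y k 0)).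
  apply/funext => y; rewrite pair_cvE fct_sumE; by apply: eq_bigr.
have Dk k : is_derive x v (w 0 k \*: (fun y => N y k 0)) (w 0 k *: 'd N x v k 0).
  have dk : derivable (fun y => N y k 0) x v by have /derivable_mxP := Ndv; exact.
  rewrite -deriveE//; have := derive_mx Ndv => ->; rewrite mxE.
  by apply: is_deriveZ; exact: derivableP.
have D := is_derive_sum Dk.
by rewrite E (derive_val (is_derive := D)) pair_cvE.
Qed.

End Pairing.

Section LocalRep.
Context {R : realType} {n : nat} {M : manifold R n}.
Implicit Types (i j : chart_index M) (p : M) (x : 'rV[R]_n) (g : M -> M).

Definition rep_dom g i j : set 'rV[R]_n := chart i @` (dom i `&` g @^-1` dom j).

Lemma rep_domP g i j x : rep_dom g i j x ->
  [/\ chart_img i x, dom i (chart_inv i x), chart i (chart_inv i x) = x &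
      dom j (g (chart_inv i x))].
Proof.
by move=> [p [ip jp] <-]; rewrite chartK//; split => //; exact: chart_img_chart.
Qed.

Lemma rep_dom_chart g i j p : dom i p -> dom j (g p) -> rep_dom g i j (chart i p).
Proof. by move=> ip jp; exists p. Qed.

Lemma rep_dom_open g i j : continuous g -> open (rep_dom g i j).
Proof.
move=> gc; rewrite openE => x xU; have [ix ip cx jp] := rep_domP xU.
have h1 : nbhs (g (chart_inv i x)) (dom j) by exact: near_dom.
have h2 : nbhs x (chart_inv i @^-1` (g @^-1` dom j)).
  have h3 : nbhs (chart_inv i x) (g @^-1` dom j) by exact: (gc _ _ h1).
  exact: (chart_inv_continuous_at ix h3).
apply: filterS (filterI (near_chart_img ix) h2) => y [/chart_imgP[iy cy] jy].
by exists (chart_inv i y); rewrite ?cy.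
Qed.

Lemma smooth_map_rep g i j : smooth_map g -> smooth_on (rep_dom g i j) (local_rep g i j).
Proof. by move=> [_]; apply. Qed.

Lemma local_rep_chart g i j p : dom i p -> local_rep g i j (chart i p) = chart j (g p).
Proof. by move=> ip; rewrite /local_rep /= chartK. Qed.

End LocalRep.

(** * Maps preserving the contact form *)

Section Transformations.
Context {R : realType} {n : nat} {M : manifold R n} (eta : one_form M).
Implicit Types (i j : chart_index M) (p : M) (g : M -> M).

Let N i (x : 'rV[R]_n) : 'cV[R]_n := eta i (chart_inv i x).

Let N_differentiable i x : chart_img i x -> differentiable (N i) x.
Proof.
move=> ix; apply: (@smooth_on_differentiable R n n 1 (chart_img i) (N i) x) => //.
  exact: chart_open.
exact: (@form_smooth _ _ _ eta i).
Qed.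

Lemma ext_dE i p v w : dom i p -> ext_d eta i p v w =
  pair_cv w ('d (N i) (chart i p) v) - pair_cv v ('d (N i) (chart i p) w).
Proof.
move=> ip; have d := N_differentiable (chart_img_chart ip).
by rewrite /ext_d (derive_pair_cv w v d) (derive_pair_cv v w d).
Qed.

Lemma ext_dBl i p u v w : dom i p ->
  ext_d eta i p (u - v) w = ext_d eta i p u w - ext_d eta i p v w.
Proof.
by move=> ip; rewrite !ext_dE// linearB /= pair_cvBr pair_cvBl; ring.
Qed.

Lemma ext_d0l i p w : dom i p -> ext_d eta i p 0 w = 0.
Proof. by move=> ip; rewrite -(subrr (0 : 'rV_n)) ext_dBl// subrr. Qed.

(** Positivity of the Levi form makes [d eta] nondegenerate on Ker eta: [u = - J v] satisfies
    [J u = v], so [d eta (J u, u) = 0] and [u = 0]. *)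
Lemma ker_ext_d_eq0 (J : pseudo_hermitian eta) i p v : dom i p ->
  pair_cv v (eta i p) = 0 -> (forall w, ext_d eta i p v w = 0) -> v = 0.
Proof.
move=> ip kv dv; apply/eqP/negPn/negP => v0.
pose u := - v *m J i p.
have kNv : ker_form eta i p (- v).
  by rewrite /ker_form /= -sub0r pair_cvBl kv subr0 /pair_cv mul0mx mxE.
have ku : ker_form eta i p u by exact: cr_ker.
have uJ : u *m J i p = v by rewrite /u (@cr_square _ _ _ _ J i p _ ip kNv) opprK.
have u0 : u != 0 by apply: contra_neq v0 => u0; rewrite -uJ u0 mul0mx.
have := @levi_pos _ _ _ _ J i p u ip ku u0.
by rewrite /levi uJ dv ltxx.
Qed.

(** The product rule for the derivative along [w] of [eta (d phi v) = eta v], read in charts. The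
    sum of second derivatives is symmetric in [v] and [w], so it disappears by antisymmetry in
    [ext_d_pullback]. *)
Lemma derive_pullback g i j p v w : smooth_map g -> pullback_eq g eta ->
  dom i p -> dom j (g p) ->
  let phi := local_rep g i j in let x := chart i p in
  \sum_k 'D_w ('D_v (fun y => phi y 0 k)) x * N j (phi x) k 0 +
    pair_cv ('d phi x v) ('d (N j) (phi x) ('d phi x w)) =
  pair_cv v ('d (N i) x w).
Proof.
move=> gs ge ip jp phi x; have xU : rep_dom g i j x by exact: rep_dom_chart.
have Uo : open (rep_dom g i j) by apply: rep_dom_open; case: gs.
have ps := @smooth_map_rep R n M g i j gs; rewrite -/phi in ps.
have phiD y : rep_dom g i j y -> differentiable phi y.
  by move=> yU; exact: smooth_on_differentiable Uo ps yU.
have phik k : smooth_on (rep_dom g i j) (fun y => phi y 0 k).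
  exact: smooth_on_entry Uo ps.
have Dv k y : rep_dom g i j y -> 'D_v (fun y => phi y 0 k) y = 'd phi y v 0 k.
  move=> yU; have d := diff_derivable (v := v) (phiD y yU).
  have E := congr1 (fun m : 'rV[R]_n => m 0 k) (derive_mx d).
  exact: etrans (esym (etrans E (mxE _ _ _ _))) (congr1 (fun m : 'rV[R]_n => m 0 k) (deriveE v (phiD y yU))).
have phix : chart_img j (phi x).
  by rewrite /x /phi local_rep_chart//; exact: chart_img_chart.
have NphiD : differentiable (N j \o phi) x.
  by apply: differentiable_comp; [exact: phiD|exact: N_differentiable].
have E y : rep_dom g i j y ->
    \sum_k ('D_v (fun y => phi y 0 k) y * (N j \o phi) y k 0) = pair_cv v (N i y).
  move=> yU; have [iy ip' cy jp'] := rep_domP yU.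
  have := ge i j (chart_inv i y) v ip' jp'; rewrite /tangent_map cy -/phi.
  have -> : eta j (g (chart_inv i y)) = (N j \o phi) y.
    by rewrite /N /= /phi /local_rep /= chartK.
  rewrite pair_cvE /N => <-.
  by apply: eq_bigr => k _; congr (_ * _); exact: Dv.
have Dk k : is_derive x w (fun y => 'D_v (fun y => phi y 0 k) y * (N j \o phi) y k 0)
    ('D_v (fun y => phi y 0 k) x * 'd (N j \o phi) x w k 0 +
     (N j \o phi) x k 0 * 'D_w ('D_v (fun y => phi y 0 k)) x).
  have [_ d1] := smooth_derivable Uo v (phik k) xU.
  have d2 : is_derive x w (fun y => (N j \o phi) y k 0) ('d (N j \o phi) x w k 0).
    have d := diff_derivable (v := w) NphiD.
    split; first by have /derivable_mxP := d; exact.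
    have E2 := congr1 (fun m : 'cV[R]_n => m k 0) (derive_mx d).
    exact: etrans (esym (etrans E2 (mxE _ _ _ _))) (congr1 (fun m : 'cV[R]_n => m k 0) (deriveE w NphiD)).
  exact: (is_deriveM (derivableP (diff_derivable (v := w) d1)) d2).
have D1 := is_derive_sum Dk.
have D2 : is_derive x w (\sum_k (fun y => 'D_v (fun y => phi y 0 k) y * (N j \o phi) y k 0))
    (pair_cv v ('d (N i) x w)).
  have d : differentiable (N i) x by apply: N_differentiable; exact: chart_img_chart.
  apply: (near_eq_is_derive (f := fun y => pair_cv v (N i y))).
    have nU : nbhs x (rep_dom g i j) by exact: open_nbhs_nbhs.
    by apply: filterS nU => y yU; rewrite fct_sumE -E.
  split; last exact: derive_pair_cv.
  have Nd := diff_derivable (v := w) d.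
  have -> : (fun y => pair_cv v (N i y)) = \sum_k (v 0 k \*: (fun y => N i y k 0)).
    by apply/funext => y; rewrite pair_cvE fct_sumE; apply: eq_bigr.
  apply: derivable_sum => k; apply: derivableZ.
  by have /derivable_mxP := Nd; exact.
have -> : pair_cv v ('d (N i) x w) = \sum_k
  ('D_v (fun y => phi y 0 k) x * 'd (N j \o phi) x w k 0 +
     (N j \o phi) x k 0 * 'D_w ('D_v (fun y => phi y 0 k)) x).
  exact: etrans (esym (@derive_val _ _ _ _ _ _ _ D2)) (@derive_val _ _ _ _ _ _ _ D1).
rewrite [RHS]big_split /= [RHS]addrC; congr (_ + _).
  by apply: eq_bigr => k _; exact: mulrC.
rewrite pair_cvE; apply: eq_bigr => k _; congr (_ * _); first exact: (esym (Dv k x xU)).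
exact: (congr1 (fun f : 'rV[R]_n -> 'cV[R]_n => f w k 0) (esym (diff_comp (phiD x xU) (N_differentiable phix)))).
Qed.

Lemma ext_d_pullback g i j p v w : smooth_map g -> pullback_eq g eta ->
  dom i p -> dom j (g p) ->
  ext_d eta j (g p) (tangent_map g i j p v) (tangent_map g i j p w) =
  ext_d eta i p v w.
Proof.
move=> gs ge ip jp; rewrite !ext_dE// -(local_rep_chart g j ip) /tangent_map.
have E1 := derive_pullback v w gs ge ip jp.
have E2 := derive_pullback w v gs ge ip jp.
set phi := local_rep g i j in E1 E2 *; set x := chart i p in E1 E2 *.
have Uo : open (rep_dom g i j) by apply: rep_dom_open; case: gs.
have ps := @smooth_map_rep R n M g i j gs.
have E3 : \sum_k 'D_w ('D_v (fun y => phi y 0 k)) x * N j (phi x) k 0 =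
    \sum_k 'D_v ('D_w (fun y => phi y 0 k)) x * N j (phi x) k 0.
  apply: eq_bigr => k _.
  have C := @smooth_derive_comm R n _ Uo (fun y => phi y 0 k) x v w
    (smooth_on_entry 0 k Uo ps) (rep_dom_chart ip jp).
  exact: (congr1 (fun t => t * _) C).
have {E3}E1 := etrans (congr1 (fun t => t + _) (esym E3)) E1.
have alg (s a b c d : R) : s + a = c -> s + b = d -> a - b = c - d by lra.
exact: alg E2 E1.
Qed.

Variables (J : pseudo_hermitian eta) (xi : vector_field M).
Hypothesis xi_reeb : is_reeb eta xi.

(** [eta] and [d eta] determine the Reeb vector. Testing [d eta] against every vector at [g p]
    requires the differential of [g] to be onto: it is injective because it preserves [eta] and
    [d eta], and the dimensions agree. *)
Lemma reeb_pushforward g i j p : smooth_map g -> pullback_eq g eta ->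
  dom i p -> dom j (g p) -> tangent_map g i j p (xi i p) = xi j (g p).
Proof.
move=> gs ge ip jp; have Uo : open (rep_dom g i j) by apply: rep_dom_open; case: gs.
have dphi : differentiable (local_rep g i j) (chart i p).
  exact: smooth_on_differentiable Uo (@smooth_map_rep R n M g i j gs) (rep_dom_chart ip jp).
pose L : {linear 'rV[R]_n -> 'rV[R]_n} := 'd (local_rep g i j) (chart i p).
have Linj v : L v = 0 -> v = 0.
  move=> Lv; apply: (@ker_ext_d_eq0 J i p v ip).
    by rewrite -(ge i j p v ip jp) /tangent_map -/L Lv /pair_cv mul0mx mxE.
  by move=> w; rewrite -(ext_d_pullback v w gs ge ip jp) /tangent_map -/L Lv ext_d0l.
have Lsurj w : exists v, L v = w.
  pose A := lin1_mx L.
  have fA : row_free A.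
    rewrite -kermx_eq0; apply/eqP/row_matrixP => k; rewrite row0; apply: Linj.
    by rewrite -mul_rV_lin1 -/A -row_mul mulmx_ker row0.
  exists (w *m invmx A); rewrite -mul_rV_lin1 -/A mulmxKV//.
  by rewrite -row_free_unit.
have [xi1 xi0] := xi_reeb ip; have [xi1' xi0'] := xi_reeb jp.
apply/eqP; rewrite -subr_eq0; apply/eqP; apply: (@ker_ext_d_eq0 J j (g p) _ jp).
  by rewrite pair_cvBl (ge i j p _ ip jp) xi1 xi1' subrr.
move=> w; have [v <-] := Lsurj w.
by rewrite ext_dBl// xi0' -/(tangent_map g i j p v) ext_d_pullback// xi0 subrr.
Qed.

Lemma integral_curve_pushforward g c : smooth_map g -> pullback_eq g eta ->
  integral_curve xi c -> integral_curve xi (g \o c).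
Proof.
move=> gs ge [cc cd]; have [gc _] := gs.
split; first by move=> t; exact: (continuous_comp (cc t) (gc (c t))).
move=> j t jt; have [i it] := dom_cover (c t).
have Uo : open (rep_dom g i j) by exact: rep_dom_open.
have dphi : differentiable (local_rep g i j) ((chart i \o c) t).
  exact: smooth_on_differentiable Uo (@smooth_map_rep R n M g i j gs) (rep_dom_chart it jt).
have := derive_comp_curve (cd i t it) dphi.
rewrite -[X in is_derive _ _ _ X]/(tangent_map g i j (c t) (xi i (c t))).
rewrite reeb_pushforward//; apply: near_eq_is_derive.
have nt : nbhs t (c @^-1` dom i) by exact: (cc t _ (near_dom it)).
by apply: filterS nt => s si /=; rewrite local_rep_chart.
Qed.

Variable psi : R -> M -> M.
Hypothesis psi_flow : is_flow xi psi.

Lemma flow_integral_curve p : integral_curve xi (psi^~ p).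
Proof. by have [_ /(_ p)[c d]] := psi_flow; split. Qed.

Lemma flow_add (s t : R) p : psi (t + s) p = psi t (psi s p).
Proof.
have [psi0 _] := psi_flow.
have E := integral_curve_uniqueness (integral_curve_shift s (flow_integral_curve p))
  (flow_integral_curve (psi s p)) (t0 := 0).
by move: E; rewrite add0r psi0 => /(_ erefl) /(congr1 (fun f => f t)).
Qed.

(** As [g] preserves [xi], both sides are integral curves with value [g p] at time [0]. *)
Lemma flow_commute g (t : R) p : smooth_map g -> pullback_eq g eta ->
  g (psi t p) = psi t (g p).
Proof.
move=> gs ge; have [psi0 _] := psi_flow.
have E := integral_curve_uniqueness (integral_curve_pushforward gs ge (flow_integral_curve p))
  (flow_integral_curve (g p)) (t0 := 0).
by move: E; rewrite /= !psi0 => /(_ erefl) /(congr1 (fun f => f t)).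
Qed.

End Transformations.

(** * Joint continuity of the flow *)

Section FlowContinuity.
Context {R : realType} {n : nat} {M : manifold R n}.

Lemma chart_ball_compact i (x0 : 'rV[R]_n) (r : R) : 0 <= r ->
  (forall x : 'rV[R]_n, `|x - x0| <= r -> chart_img i x) ->
  compact [set q : M | dom i q /\ `|chart i q - x0| <= r].
Proof.
move=> r0 ri.
have -> : [set q : M | dom i q /\ `|chart i q - x0| <= r] =
    chart_inv i @` [set x : 'rV[R]_n | forall k, x ord0 k \in `[x0 ord0 k - r, x0 ord0 k + r]].
  have ballE (x : 'rV[R]_n) : (forall k, x ord0 k \in `[x0 ord0 k - r, x0 ord0 k + r]) <->
      `|x - x0| <= r.
    split=> h.
      apply: mx_norm_le => // i0 k; rewrite (ord1 i0) !mxE.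
      by have := h k; rewrite in_itv /= ler_distl.
    move=> k; rewrite in_itv /= -ler_distl.
    by have := mx_norm_ge (x - x0) ord0 k; rewrite !mxE => /le_trans; apply.
  apply/seteqP; split => [q [iq /ballE qr]|_ [x /ballE xr <-]] /=.
    by exists (chart i q) => //; rewrite chartK.
  by have [ix cx] := chart_imgP (ri x xr); rewrite cx.
apply: continuous_compact; last first.
  apply: (@rV_compact _ _ (fun k => `[x0 ord0 k - r, x0 ord0 k + r]%classic)) => k.
  exact: segment_compact.
apply: continuous_in_subspaceT => x; rewrite inE /= => xr.
apply: chart_inv_continuous_at; apply: ri; apply: mx_norm_le => // i0 k.
by rewrite (ord1 i0) !mxE; have := xr k; rewrite in_itv /= ler_distl.
Qed.

(** Closed in [M], by compactness, and not merely in the chart domain; so the limit of a curve that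
    stays in the ball is still in the domain. *)
Lemma chart_closed_ball i (x0 : 'rV[R]_n) (r : R) : 0 <= r ->
  (forall x : 'rV[R]_n, `|x - x0| <= r -> chart_img i x) ->
  closed [set q : M | dom i q /\ `|chart i q - x0| <= r].
Proof.
move=> r0 ri; apply: compact_closed; first exact: space_hausdorff.
exact: chart_ball_compact.
Qed.

(* Look at the first time where the curve is out of the closed ball of radius
   [r / 2]. *)
Lemma slow_curve i (x0 : 'rV[R]_n) (r C t : R) (c : R -> M) :
  0 < r -> 0 <= C -> (forall x : 'rV[R]_n, `|x - x0| < r -> chart_img i x) -> continuous c ->
  (forall s, dom i (c s) -> `|chart i (c s) - x0| < r ->
    exists2 v, `|v| <= C & is_derive s (1 : R) (chart i \o c) v) ->
  dom i (c 0) -> `|chart i (c 0) - x0| < r / 4 -> 0 <= t -> C * t < r / 4 ->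
  dom i (c t) /\ `|chart i (c t) - x0| <= r / 2.
Proof.
move=> r0 C0 ri cc cd i0 c0 t0 Ct.
pose K := [set q : M | dom i q /\ `|chart i q - x0| <= r / 2].
have Kc : closed K.
  apply: chart_closed_ball; first by rewrite divr_ge0// ltW.
  by move=> x xr; apply: ri; apply: le_lt_trans xr _; rewrite ltr_pdivrMr// ltr_pMr// ltr1n.
apply: contrapT => nKt.
pose S := [set s : R | 0 <= s /\ ~ K (c s)].
have St : S t by split.
have S0 : S !=set0 by exists t.
have hS : has_inf S by split=> //; exists 0 => s [].
pose b := inf S.
have b0 : 0 <= b by apply: lb_le_inf => // s [].
have bt : b <= t by apply: ge_inf => //; case: hS.
have Kb s : 0 <= s < b -> K (c s).
  move=> /andP[s0 sb]; apply: contrapT => nK.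
  have : b <= s by apply: ge_inf; [case: hS|split].
  by rewrite leNgt sb.
have Kcb : K (c b).
  have [b00|bn0] := eqVneq b 0.
    rewrite b00; split=> //; apply: ltW; apply: lt_le_trans c0 _.
    by rewrite ler_pM2l// lef_pV2 ?posrE// ler_nat.
  have bp : 0 < b by rewrite lt_def bn0.
  apply: Kc => B nB.
  have : nbhs b (c @^-1` B) by exact: (cc b _ nB).
  move=> /nbhs_ballP[e /= e0 be].
  pose s := Num.max 0 (b - e / 2).
  have s0 : 0 <= s by rewrite le_max lexx.
  have sb : s < b by rewrite gt_max bp /= ltrBlDr ltrDl divr_gt0.
  exists (c s); split; first by apply: Kb; rewrite s0.
  apply: be; rewrite -ball_normE /= gtr0_norm ?subr_gt0//.
  have : b - e / 2 <= s by rewrite le_max lexx orbT.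
  by move=> h; rewrite ltrBlDr -ltrBlDl; apply: lt_le_trans h; rewrite ltrD2l ltrN2 gtr_pMr ?invf_lt1// ltr1n.
have K0b s : 0 <= s <= b -> K (c s).
  move=> /andP[s0]; rewrite le_eqVlt => /predU1P[->//|sb].
  by apply: Kb; rewrite s0.
have r2r : r / 2 < r by rewrite ltr_pdivrMr// ltr_pMr// ltr1n.
have step : `|chart i (c b) - chart i (c 0)| <= C * b.
  apply: mx_norm_le => [|j k]; first exact: mulr_ge0.
  rewrite !mxE (ord1 j).
  have Dk s : 0 <= s <= b -> exists2 v, `|v| <= C &
      is_derive s (1 : R) (fun s => chart i (c s) ord0 k) v.
    move=> /K0b[h1 h2]; have [v vC vd] := cd s h1 (le_lt_trans h2 r2r).
    exists (v ord0 k); first exact: le_trans (mx_norm_ge _ _ _) vC.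
    have [dd dE] := vd; split; first by have /derivable_mxP := dd; exact.
    have E := congr1 (fun m : 'rV[R]_n => m ord0 k) (derive_mx dd).
    exact: etrans (esym (etrans E (mxE _ _ _ _))) (congr1 (fun m : 'rV[R]_n => m ord0 k) dE).
  have sb (s : R) : 0 <= s <= 1 -> 0 <= (0 + (s * b) *: 1 : R) <= b.
    move=> /andP[s0 s1]; rewrite scaler1 add0r mulr_ge0//=.
    by rewrite ler_piMl.
  have [s s01] := @MVT_line R R (fun s => chart i (c s) ord0 k) 0 1 b
    (fun s s01 => let: ex_intro2 v _ vd := Dk _ (sb s s01) in @ex_derive _ _ _ _ _ _ _ vd).
  rewrite scaler1 add0r => ->; have [v vC vd] := Dk _ (sb s s01).
  rewrite (@derive_val _ _ _ _ _ _ _ vd) normrM mulrC ler_pM//.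
  by rewrite ger0_norm.
(* The curve started within [r / 4] and moved by less than [r / 4], so at time [b] it is in the
   interior of [K] and stays in [K] a little longer, against the choice of [b]. *)
have close : `|chart i (c b) - x0| < r / 2.
  rewrite -(subrKA (chart i (c 0))) (le_lt_trans (ler_normD _ _))//.
  have : C * b <= C * t by exact: ler_wpM2l.
  lra.
have : nbhs b (c @^-1` [set q | dom i q /\ `|chart i q - chart i (c b)| < r / 2 - `|chart i (c b) - x0|]).
  by apply: (cc b); apply: near_chart; [case: Kcb|rewrite subr_gt0].
move=> /nbhs_ballP[e /= e0 be].
have : b + e <= b.
  apply: lb_le_inf => // s [s0 nKs]; rewrite leNgt; apply/negP => sbe.
  have [sb|bs] := ltP s b; first by apply: nKs; apply: Kb; rewrite s0.
  apply: nKs; have [|h1 h2] := be s.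
    by rewrite -ball_normE /= distrC ger0_norm ?subr_ge0// ltrBlDl.
  split=> //; rewrite -(subrKA (chart i (c b))) (le_trans (ler_normD _ _))//.
  by move: h2; rewrite ltrBrDr => /ltW.
by rewrite gerDl leNgt e0.
Qed.

Lemma field_bounded (xi : vector_field M) i (p : M) : dom i p ->
  exists r C : R, [/\ 0 < r, 0 <= C & forall q, dom i q ->
    `|chart i q - chart i p| < r -> `|xi i q| <= C].
Proof.
move=> ip; have ix := chart_img_chart ip.
have [r [L [r0 L0 rU lip]]] := locally_lipschitz (@chart_open _ _ _ i)
  (@field_smooth _ _ _ xi i) ix.
exists r, (`|xi i p| + L * r); split=> //; first by rewrite addr_ge0// mulr_ge0// ltW.
move=> q iq qr; have pr : `|chart i p - chart i p| < r by rewrite subrr normr0.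
have := lip _ _ pr qr; rewrite /= !chartK// => h.
rewrite -(subrK (xi i p) (xi i q)) (le_trans (ler_normD _ _))// addrC lerD2l.
by rewrite (le_trans h)// ler_wpM2l// ltW.
Qed.

Variables (xi : vector_field M) (psi : R -> M -> M).
Hypothesis psi_curve : forall p, integral_curve xi (psi^~ p).
Hypothesis psi0 : forall p, psi 0 p = p.
Hypothesis psiD : forall s t p, psi (t + s) p = psi t (psi s p).
Hypothesis psi_cont : forall t, continuous (psi t).

(** The field is bounded by [C] in a chart near [p], so a curve starting within [r / 4] of [p] stays
    within [r / 2] for times below [r / (4 (C + 1))]. Negative times follow by reversing the
    curve. *)
Lemma flow_continuous_at0 (p : M) (V : set M) : nbhs p V ->
  exists2 d : R, 0 < d & \forall q \near p, forall t, `|t| < d -> V (psi t q).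
Proof.
move=> pV; have [i ip] := dom_cover p.
have [r1 r10 r1V] := chart_ball ip pV.
have [r2 [C [r20 C0 rC]]] := field_bounded xi ip.
pose r := Num.min r1 r2; have r0 : 0 < r by rewrite lt_min r10.
have r40 : 0 < r / 4 by rewrite divr_gt0.
exists (r / 4 / (C + 1)); first by rewrite divr_gt0// ltr_wpDl.
apply: filterS (near_chart ip r40) => q [iq qr] t td.
have Ct : C * `|t| < r / 4.
  have : `|t| * (C + 1) < r / 4 by rewrite -ltr_pdivlMr// ltr_wpDl.
  by apply: le_lt_trans; rewrite mulrC ler_wpM2l// lerDl.
have rimg (x : 'rV[R]_n) : `|x - chart i p| < r -> chart_img i x.
  by move=> xr; have [] := r1V x (lt_le_trans xr (ge_minl _ _)).
have [cc cd] := psi_curve q.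
suff [h1 h2] : dom i (psi t q) /\ `|chart i (psi t q) - chart i p| <= r / 2.
  have h3 : `|chart i (psi t q) - chart i p| < r1.
    apply: le_lt_trans h2 _; apply: lt_le_trans (ge_minl r1 r2).
    by rewrite ltr_pdivrMr// ltr_pMr// ltr1n.
  by have [_] := r1V _ h3; rewrite chartK.
have speed s : dom i (psi s q) -> `|chart i (psi s q) - chart i p| < r ->
    `|xi i (psi s q)| <= C.
  by move=> h1 h2; apply: rC => //; exact: lt_le_trans h2 (ge_minr _ _).
have [t0|t0] := leP 0 t.
  rewrite ger0_norm// in Ct.
  apply: (@slow_curve i (chart i p) r C t (psi^~ q)) => //; rewrite ?psi0//.
  by move=> s h1 h2; exists (xi i (psi s q)); [exact: speed|exact: cd].
rewrite ltr0_norm// in Ct.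
rewrite -(opprK t).
apply: (@slow_curve i (chart i p) r C (- t) (fun s => psi (- s) q)) => //; rewrite ?oppr0 ?psi0//.
- move=> s; exact: (continuous_comp (f := fun s : R => - s) (g := psi^~ q) (opp_continuous s) (cc (- s))).
- move=> s h1 h2; exists (- xi i (psi (- s) q)); first by rewrite normrN; exact: speed.
  have fd := cd i (- s) h1.
  have fdiff : differentiable (chart i \o psi^~ q) (- s).
    by apply/derivable1_diffP; exact: (@ex_derive _ _ _ _ _ _ _ fd).
  have E : (fun s => chart i (psi (- s) q)) = (fun s : R => (chart i \o psi^~ q) (0 + s *: -1)).
    by apply/funext => u /=; rewrite add0r scalerN scaler1.
  rewrite /comp E; apply: is_derive_line; rewrite add0r scalerN scaler1.
  split; first exact: diff_derivable.
  refine (etrans (deriveE _ fdiff) _); rewrite linearN; congr (- _).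
  exact: etrans (esym (deriveE _ fdiff)) (@derive_val _ _ _ _ _ _ _ fd).
- by rewrite oppr_ge0 ltW.
Qed.

(** [psi t p = psi (t - t0) (psi t0 p)] reduces the claim to time [0], as [psi t0] is continuous. *)
Lemma flow_continuous : continuous (fun z : R * M => psi z.1 z.2).
Proof.
move=> [t0 p0] V /= nV; have [d d0 dV] := flow_continuous_at0 nV.
have c : {for (t0, p0), continuous (fun z : R * M => (z.1 - t0, psi t0 z.2))}.
  apply: continuous_pairing.
    by apply: continuousB; [exact: cvg_fst|exact: cst_continuous].
  by apply: (continuous_comp (f := snd)); [exact: cvg_snd|exact: psi_cont].
have nB : nbhs ((t0, p0).1 - t0, psi t0 (t0, p0).2)
    [set z : R * M | V (psi z.1 z.2)].
  rewrite /= subrr; exists ([set t | `|t| < d], [set q | forall t, `|t| < d -> V (psi t q)]).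
    split=> //=; apply/nbhs_ballP; exists d => //= t.
    by rewrite -ball_normE /= sub0r normrN.
  by move=> [t q] /= [td]; apply.
have nz : nbhs (t0, p0) ((fun z : R * M => (z.1 - t0, psi t0 z.2)) @^-1` [set z : R * M | V (psi z.1 z.2)]).
  exact: (c _ nB).
apply: filterS nz => -[t p] /=; by rewrite -psiD subrK.
Qed.

End FlowContinuity.

(** * Joint continuity of derivatives by Baire's theorem *)

Lemma closed_norm_le (R : realType) (g : R -> R) (a b c : R) :
  (forall t, a <= t <= b -> {for t, continuous g}) ->
  closed [set t | a <= t <= b /\ `|g t| <= c].
Proof.
move=> gc; rewrite -openC openE => t nt.
have [tab|] := boolP (a <= t <= b).
  have gt : c < `|g t| by rewrite ltNge; apply/negP => h; apply: nt.
  have /cvgrPdist_lt /(_ (`|g t| - c)) := gc t tab.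
  rewrite subr_gt0 => /(_ gt); apply: filterS => s sE [_ sc].
  have := ler_normD (g t - g s) (g s); rewrite subrK.
  lra.
rewrite negb_and -!ltNge => /orP[ta|bt].
  have := lt_nbhsl ta; apply: filterS => s sa [/andP[+ _] _].
  by rewrite leNgt sa.
have := lt_nbhsr bt; apply: filterS => s bs [/andP[_ +] _].
by rewrite leNgt bs.
Qed.

Lemma uniform_limit_continuous (R : realType) (T : topologicalType) (f : T -> R) x :
  (forall e, 0 < e -> exists2 g : T -> R, {for x, continuous g} &
     \forall y \near x, `|f y - g y| <= e) -> {for x, continuous f}.
Proof.
move=> fg; apply/cvgrPdist_le => e e0; have e40 : 0 < e / 4 by rewrite divr_gt0.
have [g gc fgx] := fg _ e40.
have /cvgrPdist_le /(_ _ e40) gx := gc.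
have f0 := nbhs_singleton fgx.
apply: filterS (filterI fgx gx) => y [/= h1 h2].
move: f0 h1 h2; rewrite !ler_norml => /andP[? ?] /andP[? ?] /andP[? ?].
by apply/andP; split; lra.
Qed.

Section BaireJet.
Context {R : realType} {n : nat}.
Local Notation e_ i := (delta_mx 0 i : 'rV[R]_n).

Lemma norm_delta i : `|e_ i| <= 1.
Proof.
apply: mx_norm_le => // i0 j; rewrite mxE.
by case: (_ && _); rewrite ?normr1 ?normr0.
Qed.

Definition quotient (w : 'rV[R]_n -> R) i (e : R) y := e^-1 * (w (y + e *: e_ i) - w y).

(** The mean value theorem applied twice; [c] is the maximum of the second derivative over a compact
    box. *)
Lemma second_order_bound (w : 'rV[R]_n -> R) i y0 (r : R) : 0 < r ->
  smooth_on [set y | `|y - y0| < 2 * r] w ->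
  exists2 c : R, 0 <= c & forall y e, `|y - y0| < r -> 0 < e < r / 2 ->
    `|quotient w i e y - 'D_(e_ i) w y| <= c * e.
Proof.
move=> r0 ws.
(* The radius [3 / 2 * r] leaves room for a step [e < r / 2] from the ball of radius [r], and stays
   below [2 * r]. *)
pose K := [set y : 'rV[R]_n | forall k, y ord0 k \in `[y0 ord0 k - 3 / 2 * r, y0 ord0 k + 3 / 2 * r]].
have Kcomp : compact K.
  apply: (@rV_compact _ _ (fun k => `[y0 ord0 k - 3 / 2 * r, y0 ord0 k + 3 / 2 * r]%classic)) => k.
  exact: segment_compact.
have KP y : K y <-> `|y - y0| <= 3 / 2 * r.
  split=> h.
    apply: mx_norm_le => [|i0 k]; first by rewrite mulr_ge0// ltW.
    rewrite (ord1 i0) !mxE.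
    by have := h k; rewrite in_itv /= ler_distl.
  move=> k; rewrite in_itv /= -ler_distl.
  by have := mx_norm_ge (y - y0) ord0 k; rewrite !mxE => /le_trans; apply.
have Ksub y : K y -> `|y - y0| < 2 * r.
  by move=> /KP h; apply: le_lt_trans h _; rewrite ltr_pM2r//; lra.
pose D2 := partials [:: i; i] w.
have D2c : {within K, continuous (fun y => `|D2 y|)}.
  apply: continuous_in_subspaceT => y; rewrite inE => /Ksub Ky.
  apply: (continuous_comp (f := D2)); last exact: norm_continuous.
  exact: (ws [:: i; i] y Ky).1.
have K0 : K y0 by apply/KP; rewrite subrr normr0 mulr_ge0// ltW.
have [ym _ ymax] := @compact_EVT_max _ R (fun y => `|D2 y|) K (ex_intro _ y0 K0) Kcomp D2c.
exists `|D2 ym| => // y e yr /andP[e0 er].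
have Kt (t : R) : 0 <= t <= 1 -> K (y + (t * e) *: e_ i).
  move=> /andP[t0 t1]; apply/KP; rewrite addrAC (le_trans (ler_normD _ _))//.
  rewrite normrZ ger0_norm ?mulr_ge0 ?(ltW e0)//.
  have h1 : t * e * `|e_ i| <= e.
    have h : t * e <= e by rewrite ler_piMl// ltW.
    by apply: le_trans h; rewrite ler_piMr ?norm_delta// mulr_ge0// (ltW e0).
  have -> : 3 / 2 * r = r + r / 2 by lra.
  by rewrite lerD ?(ltW yr)// (le_trans h1)// ltW.
have [t t01 tE] := @MVT_line R _ w y (e_ i) e
  (fun t t01 => (ws [::] _ (Ksub _ (Kt t t01))).2 i).
have Ktt (t' : R) : 0 <= t' <= 1 -> K (y + (t' * (t * e)) *: e_ i).
  move=> /andP[t'0 t'1]; rewrite mulrA; apply: Kt.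
  by case/andP: t01 => t0 t1; rewrite mulr_ge0//= mulr_ile1.
have [t' t'01 t'E] := @MVT_line R _ (partials [:: i] w) y (e_ i) (t * e)
  (fun t t01 => (ws [:: i] _ (Ksub _ (Ktt t t01))).2 i).
rewrite /quotient tE mulKf ?lt0r_neq0//.
have {}t'E : 'D_(e_ i) w (y + (t * e) *: e_ i) - 'D_(e_ i) w y =
  t * e * D2 (y + (t' * (t * e)) *: e_ i) := t'E.
rewrite t'E normrM mulrC ler_pM//.
  by apply: ymax; rewrite inE; exact: Ktt.
case/andP: t01 => t0 t1.
by rewrite ger0_norm ?mulr_ge0 ?(ltW e0)// ler_piMl// ltW.
Qed.

(** [A N] collects the times at which the difference quotients of the derivatives of order [r] are
    Cauchy at the rate [N (e + e')], uniformly in [y]. Comparing two quotients, and not a quotient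
    with its limit, involves only derivatives already known to be jointly continuous, so [A N] is
    closed. Each time lies in some [A N] because each map is smooth, and Baire's theorem yields an
    open set [B] of times inside one [A N]. Over [B] the derivatives of order [r.+1] are uniform
    limits of jointly continuous quotients. *)
Lemma baire_jet m r (h : 'I_m -> R -> 'rV[R]_n -> R) y0 (rho a b : R) :
  0 < rho -> a < b ->
  (forall k t, a <= t <= b -> smooth_on [set y | `|y - y0| < 2 * rho] (h k t)) ->
  (forall k s z, (size s <= r)%N -> a <= z.1 <= b -> `|z.2 - y0| < 2 * rho ->
    {for z, continuous (fun z => partials s (h k z.1) z.2)}) ->
  exists O : set R, [/\ open O, O !=set0, forall t, O t -> a <= t <= b &
    forall k, jet r.+1 [set z | O z.1 /\ `|z.2 - y0| < rho] (h k)].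
Proof.
move=> rho0 ab hs hc.
pose q (u : 'I_m * seq 'I_n * 'I_n) e t y := quotient (partials u.1.2 (h u.1.1 t)) u.2 e y.
pose A N := [set t : R | a <= t <= b /\ forall u e e' y, size u.1.2 = r ->
   `|y - y0| < rho -> 0 < e < rho / 2 -> 0 < e' < rho / 2 ->
   `|q u e t y - q u e' t y| <= N%:R * (e + e')].
have inball e i y : `|y - y0| < rho -> 0 < e < rho / 2 -> `|y + e *: e_ i - y0| < 2 * rho.
  move=> yr /andP[e0 er]; rewrite addrAC (le_lt_trans (ler_normD _ _))//.
  rewrite normrZ gtr0_norm//; have h1 : e * `|e_ i| <= e by rewrite ler_piMr ?norm_delta// ltW.
  lra.
have inball0 y : `|y - y0| < rho -> `|y - y0| < 2 * rho by move=> /lt_trans; apply; lra.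
have qc u e z : size u.1.2 = r -> 0 < e < rho / 2 -> a <= z.1 <= b -> `|z.2 - y0| < rho ->
    {for z, continuous (fun z => q u e z.1 z.2)}.
  move=> ur er zab zr.
  have c1 := hc u.1.1 u.1.2 z (eq_leq ur) zab (inball0 _ zr).
  have c2 := hc u.1.1 u.1.2 (z.1, z.2 + e *: e_ u.2) (eq_leq ur) zab (inball e u.2 z.2 zr er).
  have c3 : {for z, continuous (fun z : R * 'rV[R]_n => (z.1, z.2 + e *: e_ u.2))}.
    apply: continuous_pairing; first exact: cvg_fst.
    by apply: continuousD; [exact: cvg_snd|exact: cst_continuous].
  have c4 := continuous_comp (f := fun z : R * 'rV[R]_n => (z.1, z.2 + e *: e_ u.2))
    (g := fun z => partials u.1.2 (h u.1.1 z.1) z.2) c3 c2.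
  have c5 := continuousB c4 c1.
  have c6 : {for z, continuous (fun _ : R * 'rV[R]_n => e^-1)} by exact: cst_continuous.
  exact: (continuousM c6 c5).
have Aclosed N : closed (A N).
  have -> : A N = [set t | a <= t <= b] `&` \bigcap_(v in [set v : ('I_m * seq 'I_n * 'I_n) * R * R * 'rV[R]_n |
      [/\ size v.1.1.1.1.2 = r, `|v.2 - y0| < rho, 0 < v.1.1.2 < rho / 2 & 0 < v.1.2 < rho / 2]])
      [set t | a <= t <= b /\ `|q v.1.1.1 v.1.1.2 t v.2 - q v.1.1.1 v.1.2 t v.2| <= N%:R * (v.1.1.2 + v.1.2)].
    apply/seteqP; split=> [t [tab tA]|t [tab tA]].
      by split=> // -[[[u e] e'] y] [/= h1 h2 h3 h4]; split=> //; exact: tA.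
    split=> // u e e' y h1 h2 h3 h4.
    by have [] := tA (u, e, e', y) (And4 h1 h2 h3 h4).
  apply: closedI; first exact: (@interval_closed _ (BLeft a) (BRight b)).
  apply: closed_bigI => -[[[u e] e'] y] [/= h1 h2 h3 h4].
  apply: closed_norm_le => t tab.
  have c : {for t, continuous (fun t : R => (t, y))}.
    by apply: continuous_pairing; [exact: cvg_id|exact: cst_continuous].
  apply: continuousB.
    exact: (continuous_comp (f := fun t : R => (t, y)) (g := fun z => q u e z.1 z.2) c (qc _ _ (t, y) h1 h3 tab h2)).
  exact: (continuous_comp (f := fun t : R => (t, y)) (g := fun z => q u e' z.1 z.2) c (qc _ _ (t, y) h1 h4 tab h2)).
have smooth_w k s t : a <= t <= b -> smooth_on [set y | `|y - y0| < 2 * rho] (partials s (h k t)).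
  by move=> tab; apply: smooth_on_partials; exact: hs.
have Acover t : a <= t <= b -> exists N, A N t.
  move=> tab.
  (* The order [r] is fixed, so there are finitely many [u] and the sum of their constants bounds
     each of them. *)
  pose U : finType := ('I_m * r.-tuple 'I_n * 'I_n)%type.
  have /choice[c cP] : forall u : U, exists c : R, 0 <= c /\ forall y e, `|y - y0| < rho -> 0 < e < rho / 2 ->
      `|q (u.1.1, tval u.1.2, u.2) e t y - 'D_(e_ u.2) (partials u.1.2 (h u.1.1 t)) y| <= c * e.
    move=> u; have [c c0 cE] := second_order_bound u.2 rho0 (smooth_w u.1.1 u.1.2 t tab).
    by exists c.
  exists (Num.bound (\sum_u c u)); split=> // -[[k s] i] e e' y sr yr er e'r.
  have sr' : size s == r by apply/eqP.
  pose u : U := (k, Tuple sr', i).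
  have [c0 cE] := cP u; have h1 := cE y e yr er; have h2 := cE y e' yr e'r.
  have cu : c u <= (Num.bound (\sum_u c u))%:R.
    apply: le_trans (ltW (archi_boundP _)); last by apply: sumr_ge0 => v _; have [] := cP v.
    by rewrite (bigD1 u)//= lerDl sumr_ge0// => v _; have [] := cP v.
  case/andP: er => e0 _; case/andP: e'r => e'0 _.
  have h3 : c u * (e + e') <= (Num.bound (\sum_u c u))%:R * (e + e').
    by rewrite ler_wpM2r// addr_ge0// ltW.
  apply: le_trans h3; rewrite mulrDr.
  rewrite -(subrKA ('D_(e_ i) (partials s (h k t)) y)) (le_trans (ler_normD _ _))// lerD//.
  by rewrite distrC.
have [N nd] : exists N, ~ dense (~` A N).
  apply: contrapT => /forallNP H.
  have /Baire D : forall N, open (~` A N) /\ dense (~` A N).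
    by move=> N; split; [rewrite openC|exact: contrapT (H N)].
  have oab : open `]a, b[%classic by exact: interval_open.
  have nab : `]a, b[%classic !=set0 by exists ((a + b) / 2); rewrite /= in_itv /=; lra.
  have [t [tab tA]] := D _ nab oab.
  move: tab; rewrite /= in_itv /= => /andP[/ltW at_ /ltW tb].
  have [|N tN] := Acover t; first by rewrite at_.
  exact: (tA N I).
have [B [B0 Bo BA]] : exists B : set R, [/\ B !=set0, open B & B `<=` A N].
  apply: contrapT => H; apply: nd => B B0 Bo; apply: contrapT => H'; apply: H.
  exists B; split=> // t Bt; apply: contrapT => nA; apply: H'.
  by exists t.
exists B; split=> // [t /BA[]//|k].
apply: jet_all_partials => s sr z [Bz zr]; have [zab _] := BA _ Bz.
split; last by move=> i; exact: (hs k z.1 zab s z.2 (inball0 _ zr)).2.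
move: sr; rewrite leq_eqVlt => /predU1P[sr|sr]; last exact: (hc k s z sr zab (inball0 _ zr)).
case: s sr => [//|i s] [sr].
have bound e z' : 0 < e < rho / 2 -> B z'.1 -> `|z'.2 - y0| < rho ->
    `|'D_(e_ i) (partials s (h k z'.1)) z'.2 - q (k, s, i) e z'.1 z'.2| <= N%:R * e.
  move=> er Bz' z'r; have [z'ab z'A] := BA _ Bz'.
  have [c c0 cE] := second_order_bound i rho0 (smooth_w k s z'.1 z'ab).
  (* [e'] tends to [0]: the constant [c], valid at this time only, replaces the second quotient by
     the derivative, and only [N] survives in the bound. *)
  apply/ler_addgt0Pr => d d0.
  pose e' := Num.min (rho / 4) (d / (N%:R + c + 1)).
  have Nc : 0 < N%:R + c + 1 by rewrite ltr_wpDl// addr_ge0.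
  have e'0 : 0 < e' by rewrite lt_min !divr_gt0.
  have e'r : 0 < e' < rho / 2.
    by rewrite e'0 /=; apply: le_lt_trans (ge_minl _ _) _; lra.
  have h1 := z'A (k, s, i) e e' z'.2 sr z'r er e'r.
  have h2 := cE z'.2 e' z'r e'r.
  have h3 : (N%:R + c + 1) * e' <= d by rewrite -ler_pdivlMl// mulrC; exact: ge_minr.
  rewrite -(subrKA (q (k, s, i) e' z'.1 z'.2)) (le_trans (ler_normD _ _))//.
  rewrite distrC in h2; rewrite distrC in h1.
  apply: le_trans (lerD h2 h1) _; lra.
apply: uniform_limit_continuous => e e0.
pose e1 := Num.min (rho / 4) (e / (N%:R + 1)).
have e10 : 0 < e1 by rewrite lt_min !divr_gt0// ltr_wpDl.
have e1r : 0 < e1 < rho / 2.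
  by rewrite e10 /=; apply: le_lt_trans (ge_minl _ _) _; lra.
exists (fun z => q (k, s, i) e1 z.1 z.2); first exact: qc.
have nO : nbhs z [set z : R * 'rV[R]_n | B z.1 /\ `|z.2 - y0| < rho].
  have c1 : nbhs z (fst @^-1` B).
    have : nbhs z.1 B by exact: open_nbhs_nbhs.
    have cz : {for z, continuous (@fst R 'rV[R]_n)} by exact: cvg_fst.
    by move=> nz; exact: (cz _ nz).
  have c2 : nbhs z (snd @^-1` [set y : 'rV[R]_n | `|y - y0| < rho]).
    have cz : {for z, continuous (@snd R 'rV[R]_n)} by exact: cvg_snd.
    have nz : nbhs z.2 [set y : 'rV[R]_n | `|y - y0| < rho].
      apply/nbhs_ballP; exists (rho - `|z.2 - y0|) => /=; first by rewrite subr_gt0.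
      move=> y; rewrite -ball_normE /= => yz.
      by rewrite -(subrKA z.2) (le_lt_trans (ler_normD _ _))// -ltrBrDr distrC.
    exact: (cz _ nz).
  exact: filterI c1 c2.
apply: filterS nO => z' [Bz' z'r]; apply: le_trans (bound e1 z' e1r Bz' z'r) _.
have h3 : (N%:R + 1) * e1 <= e by rewrite -ler_pdivlMl ?ltr_wpDl// mulrC; exact: ge_minr.
apply: le_trans h3; rewrite ler_wpM2r ?(ltW e10)//; lra.
Qed.

End BaireJet.

Lemma jet_local (R : realType) (P : topologicalType) n r (W : set (P * 'rV[R]_n)) h :
  (forall z, W z -> exists2 W', W' z & jet r W' h) -> jet r W h.
Proof.
have hc h' r' : (forall z, W z -> exists2 W', W' z & jet r' W' h') ->
    forall z, W z -> {for z, continuous (fun z => h' z.1 z.2)}.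
  by move=> loc z /loc[W' W'z jh]; exact: jet_continuous jh z W'z.
elim: r h => [|r IH] h loc; first by split=> //; exact: hc loc.
split; first exact: hc loc.
move=> i; split=> [z /loc[W' W'z [_ /(_ i)[hd _]]]|]; first exact: hd.
by apply: IH => z /loc[W' W'z [_ /(_ i)[_ hj]]]; exists W'.
Qed.

(** * Spatial derivatives of the flow *)

Section FlowJet.
Context {R : realType} {n : nat} {M : manifold R n}.
Variable psi : R -> M -> M.
Hypothesis psi0 : forall p, psi 0 p = p.
Hypothesis psiD : forall t s p, psi (t + s) p = psi t (psi s p).
Hypothesis psi_cont : continuous (fun z : R * M => psi z.1 z.2).
Hypothesis psi_smooth : forall t, smooth_map (psi t).
Implicit Types (i j : chart_index M).

Definition flow_dom i j : set (R * 'rV[R]_n) := [set z | rep_dom (psi z.1) i j z.2].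

Lemma flow_chart_inv_continuous i (z : R * 'rV[R]_n) : chart_img i z.2 ->
  {for z, continuous (fun z : R * 'rV[R]_n => psi z.1 (chart_inv i z.2))}.
Proof.
move=> iz; have c : {for z, continuous (fun z : R * 'rV[R]_n => (z.1, chart_inv i z.2 : M))}.
  apply: continuous_pairing; first exact: cvg_fst.
  apply: (continuous_comp (f := snd)); first exact: cvg_snd.
  exact: chart_inv_continuous_at.
exact: (continuous_comp (g := fun z : R * M => psi z.1 z.2) c (@psi_cont _)).
Qed.

Lemma flow_dom_open i j : open (flow_dom i j).
Proof.
rewrite openE => z zW; have [iz ip cx jp] := rep_domP zW.
have h2 : nbhs z ((fun z : R * 'rV[R]_n => psi z.1 (chart_inv i z.2)) @^-1` dom j).
  exact: (flow_chart_inv_continuous iz (near_dom jp)).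
have h1 : nbhs z (snd @^-1` @chart_img R n M i).
  have c : {for z, continuous (snd : R * 'rV[R]_n -> 'rV[R]_n)} by exact: cvg_snd.
  exact: (c _ (near_chart_img iz)).
apply: filterS (filterI h1 h2) => y [/= /chart_imgP[iy cy] jy].
by exists (chart_inv i y.2); rewrite ?cy.
Qed.

Lemma flow_rep_continuous i j z : flow_dom i j z ->
  {for z, continuous (fun z : R * 'rV[R]_n => local_rep (psi z.1) i j z.2)}.
Proof.
move=> zW; have [iz ip cx jp] := rep_domP zW.
exact: (continuous_comp (g := chart j) (flow_chart_inv_continuous iz) (chart_continuous_at jp)).
Qed.

(* Baire's theorem gives the derivatives of order [r.+1] of [psi_t] near some
   small time [c], and the group law [psi_t = psi_(t - t0 + c) o psi_(t0 - c)]
   brings them near [t0]. *)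
Lemma flow_jet r i j k :
  jet r (flow_dom i j) (fun t x => local_rep (psi t) i j x ord0 k).
Proof.
elim: r i j k => [|r IH] i j k.
  split=> // z zW.
  exact: (continuous_comp (g := fun m : 'rV[R]_n => m ord0 k) (flow_rep_continuous zW)
    (@coord_continuous R 1 n ord0 k _)).
apply: jet_local => -[t0 x0] zW; have [/= iz ip cx jp] := rep_domP zW.
set p0 := chart_inv i x0 in ip cx jp; set q0 := psi t0 p0 in jp; pose y0 := chart j q0.
have W0 : flow_dom j j (0, y0) by apply: rep_dom_chart => //; rewrite psi0.
have nW0 : nbhs ((0, y0) : R * 'rV[R]_n) (flow_dom j j).
  by apply: open_nbhs_nbhs; split=> //; exact: flow_dom_open.
have [r0 r00 hr0] : exists2 r0 : R, 0 < r0 & forall (t : R) (y : 'rV[R]_n),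
    `|t| < r0 -> `|y - y0| < r0 -> flow_dom j j (t, y).
  move/nbhs_ballP: nW0 => [e /= e0 he]; exists e => // t y te ye; apply: he.
  by split; rewrite -ball_normE /= distrC ?subr0.
pose rho := r0 / 2.
have rho0 : 0 < rho by rewrite divr_gt0.
have rho2 : 2 * rho = r0 by rewrite /rho; lra.
have [e e0 he] : exists2 e : R, 0 < e & forall t : R, `|t - t0| < e ->
    dom j (psi t p0) /\ `|chart j (psi t p0) - y0| < rho.
  have c : {for t0, continuous (fun t : R => (t, p0))}.
    by apply: continuous_pairing; [exact: cvg_id|exact: cst_continuous].
  have c2 := continuous_comp (g := fun z : R * M => psi z.1 z.2) c (@psi_cont _).
  have /nbhs_ballP[e /= e0 he] := c2 _ (near_chart jp rho0).
  exists e => // t te; apply: he.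
  by rewrite -ball_normE /= distrC.
(* Times up to [eta] map the ball of radius [2 * rho] around [y0] into the domain of the chart [j],
   and change [t0] so little that [p0] is still sent within [rho] of [y0]. *)
pose eta := Num.min r0 e / 2.
have m0 : 0 < Num.min r0 e by rewrite lt_min r00.
have eta0 : 0 < eta by rewrite divr_gt0.
have etar : eta < r0 by apply: lt_le_trans (ge_minl r0 e); rewrite /eta; lra.
have etae : eta < e by apply: lt_le_trans (ge_minr r0 e); rewrite /eta; lra.
have etal (t : R) : - eta <= t <= eta -> `|t| <= eta by rewrite ler_norml.
have ab : - eta < eta by lra.
have [B [Bo [c Bc] Bab Bj]] : exists O : set R, [/\ open O, O !=set0,
    forall t, O t -> - eta <= t <= eta &
    forall k, jet r.+1 [set z : R * 'rV[R]_n | O z.1 /\ `|z.2 - y0| < rho]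
      (fun t y => local_rep (psi t) j j y ord0 k)].
  apply: (@baire_jet R n n r (fun k t y => local_rep (psi t) j j y ord0 k)) => //.
    move=> k' t /etal th.
    apply: (@smooth_on_sub _ _ _ (rep_dom (psi t) j j)).
      by move=> y /=; rewrite rho2 => yr; apply: (hr0 t y) => //; exact: le_lt_trans etar.
    apply: smooth_on_entry; last exact: smooth_map_rep.
    by apply: rep_dom_open; case: (psi_smooth t).
  move=> k' s [t y] /= sr /etal th yr.
  apply: (jet_partials (IH j j k') sr); apply: hr0; first exact: le_lt_trans etar.
  by rewrite -rho2.
pose g := local_rep (psi (t0 - c)) i j; pose D := rep_dom (psi (t0 - c)) i j.
have Do : open D by apply: rep_dom_open; case: (psi_smooth (t0 - c)).
have gs : smooth_on D g by exact: smooth_map_rep.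
have D'o : open [set x | D x /\ `|g x - y0| < rho].
  rewrite openE => x [Dx gx].
  have gc : {for x, continuous g} := (gs [::] x Dx).1.
  apply: filterI; first exact: open_nbhs_nbhs.
  have nc : {for x, continuous (fun x => `|g x - y0|)}.
    apply: (continuous_comp (f := fun x => g x - y0)); last exact: norm_continuous.
    by apply: continuousB => //; exact: cst_continuous.
  have : nbhs `|g x - y0| [set t : R | t < rho].
    by apply: open_nbhs_nbhs; split=> //; exact: open_lt.
  by move=> /nc.
(* The pairs [(t, x)] such that [g] sends [x] into the ball and the remaining time [t - t0 + c] is
   in [B]; at [t = t0] this time is [c]. *)
pose W' : set (R * 'rV[R]_n) := [set z | B (z.1 - t0 + c) /\ (D z.2 /\ `|g z.2 - y0| < rho)].
have tauc : continuous (fun t : R => t - t0 + c).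
  move=> t; apply: (@continuousD _ _ _ (fun t => t - t0) (cst c)); last exact: cst_continuous.
  by apply: (@continuousB _ _ _ id (cst t0)); [exact: cvg_id|exact: cst_continuous].
have W'o : open W'.
  apply: openI.
    apply: (@open_comp _ _ (fun z : R * 'rV[R]_n => z.1 - t0 + c)) => // z _.
    have c1 : {for z, continuous (fst : R * 'rV[R]_n -> R)} by exact: cvg_fst.
    exact: (continuous_comp (g := fun t : R => t - t0 + c) c1 (tauc _)).
  apply: (@open_comp _ _ (snd : R * 'rV[R]_n -> 'rV[R]_n) _ _ D'o) => z _; exact: cvg_snd.
exists W'.
  split; first by rewrite /= subrr add0r.
  have [|h1 h2] := he (t0 - c).
    by rewrite addrAC subrr add0r normrN; apply: le_lt_trans etae; apply: etal; exact: Bab.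
  split => /=; first by rewrite -cx; exact: rep_dom_chart.
  by rewrite -cx /g local_rep_chart.
suff J : jet r.+1 W' (fun t x => local_rep (psi (t - t0 + c)) j j (g x) ord0 k).
  apply: (jet_eq W'o _ J).
  move=> [t x] [/= _ [Dx _]]; have [_ _ _ jx] := rep_domP Dx.
  rewrite /local_rep /= /g /local_rep /= chartK// -psiD.
  by congr (chart j (psi _ _) ord0 k); lra.
apply: (@jet_comp _ _ _ _ _ _ [set z : R * 'rV[R]_n | B z.1 /\ `|z.2 - y0| < rho]
   W' (fun t y => local_rep (psi t) j j y ord0 k) (fun t => t - t0 + c) (fun _ => g)) => //.
- apply: openI.
    by apply: (@open_comp _ _ (fst : R * 'rV[R]_n -> R) _ _ Bo) => z _; exact: cvg_fst.
  apply: (@open_comp _ _ (fun z : R * 'rV[R]_n => `|z.2 - y0|) [set t : R | t < rho]); last exact: open_lt.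
  move=> z _; apply: (continuous_comp (f := fun z : R * 'rV[R]_n => z.2 - y0)); last exact: norm_continuous.
  by apply: continuousB; [exact: cvg_snd|exact: cst_continuous].
- by move=> z _; exact: tauc.
- by move=> z [? []].
move=> l; apply: (@jet_sub _ _ _ _ [set z : R * 'rV[R]_n | D z.2]); first by move=> z [_ []].
by apply: smooth_on_jet; exact: smooth_on_entry.
Qed.

End FlowJet.

(** * Continuity in the group of diffeomorphisms *)

Section DiffeoTopology.
Context {R : realType} {n : nat} {M : manifold R n}.

Lemma diffeo_continuous (T : topologicalType) (h : T -> diffeo M) x :
  (forall N, diffeo_subbase M N -> N (h x) -> nbhs x (h @^-1` N)) ->
  {for x, continuous h}.
Proof.
move=> hN A; rewrite nbhsE => -[B [Bo Bx] BA].
suff : nbhs x (h @^-1` B) by apply: filterS => y; exact: BA.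
have [D sD BE] := Bo; move: Bx; rewrite -BE => -[C DC Cx].
have [F sF CE] := sD C DC.
suff : nbhs x (h @^-1` C) by apply: filterS => y; exists C.
rewrite -CE; move: Cx; rewrite -CE => Cx.
apply: (@filter_bigI _ _ F (fun N => h @^-1` N)) => N NF.
apply: hN; last exact: Cx.
by have := sF N NF; rewrite inE.
Qed.

Lemma diffeo_ball_nbhs (f : diffeo M) i j (K : set M) s (e : R) :
  compact K -> K `<=` dom i -> f @` K `<=` dom j -> 0 < e ->
  nbhs f (diffeo_ball f i j K s e).
Proof.
move=> Kc Ki Kj e0; apply: open_nbhs_nbhs; split; last first.
  by move=> p Kp; rewrite subrr normr0; split=> //; apply: Kj; exists p.
pose N := diffeo_ball f i j K s e.
exists [set N]; last by rewrite bigcup_set1.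
move=> _ ->; apply: (@finI_from1 _ _ (diffeo_subbase M) id N).
by exists f, i, j, K, s, e.
Qed.

Lemma flow_partials_continuous (psi : R -> M -> M) i j s z :
  (forall k r, jet r (flow_dom psi i j) (fun t x => local_rep (psi t) i j x ord0 k)) ->
  (forall t, smooth_map (psi t)) -> open (flow_dom psi i j) -> flow_dom psi i j z ->
  {for z, continuous (fun z => partials s (local_rep (psi z.1) i j) z.2)}.
Proof.
move=> pj ps Wo zW; apply: mx_continuous => a k; rewrite (ord1 a).
apply: near_eq_continuous (jet_partials (pj k (size s)) (leqnn _) zW).
have : nbhs z (flow_dom psi i j) by exact: open_nbhs_nbhs.
apply: filterS => -[t x] /= xW; apply: (partials_entry (U := rep_dom (psi t) i j)) => //.
  by apply: rep_dom_open; case: (ps t).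
exact: smooth_map_rep.
Qed.

(** By joint continuity the conditions of a subbasic ball persist near each [(p, t0)]; compactness
    of [K] makes them hold on all of [K] for [t] near [t0]. *)
Lemma flow_diffeo_continuous (psi : R -> M -> M) (h : R -> diffeo M) :
  (forall i j k r, jet r (flow_dom psi i j) (fun t x => local_rep (psi t) i j x ord0 k)) ->
  (forall i j, open (flow_dom psi i j)) ->
  (forall t, h t = psi t :> (M -> M)) -> continuous h.
Proof.
move=> pj Wo hE t0; apply: diffeo_continuous => _ [f [i [j [K [s [e [Kc Ki Kj e0 ->]]]]]]] ft0.
have ps t : smooth_map (psi t) by rewrite -hE; case: (h t) => g /= [].
move/compact_near_coveringP : (Kc) => Kn.
pose P (t : R) (p : M) : Prop := dom j (psi t p) /\
    `|partials s (local_rep (psi t) i j) (chart i p) -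
      partials s (local_rep f i j) (chart i p)| < e.
have : \forall t \near t0, K `<=` P t.
  refine (Kn R (nbhs t0) P _ _) => p Kp; have ip := Ki p Kp.
  have [jp lt] := ft0 p Kp; rewrite hE in jp lt.
  have zW : flow_dom psi i j (t0, chart i p) by exact: rep_dom_chart.
  have c1 := @flow_partials_continuous psi i j s _ (pj i j) ps (Wo i j) zW.
  have fs : smooth_map f by case: (f) => g /= [].
  have xW : rep_dom f i j (chart i p) by apply: rep_dom_chart => //; apply: Kj; exists p.
  have c2 := (smooth_map_rep fs s xW).1.
  have c3 : {for (p, t0), continuous (fun z : M * R => (z.2, chart i z.1))}.
    apply: continuous_pairing; first exact: cvg_snd.
    apply: (continuous_comp (f := fst)); first exact: cvg_fst.
    exact: chart_continuous_at.
  have c4 : {for (p, t0), continuous (fun z : M * R =>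
      `|partials s (local_rep (psi z.2) i j) (chart i z.1) -
        partials s (local_rep f i j) (chart i z.1)|)}.
    have d1 := continuous_comp (g := fun z : R * 'rV[R]_n => partials s (local_rep (psi z.1) i j) z.2) c3 c1.
    have c5 : {for (p, t0), continuous (fun z : M * R => chart i z.1)}.
      apply: (continuous_comp (f := fst)); first exact: cvg_fst.
      exact: chart_continuous_at.
    have d2 := continuous_comp (g := partials s (local_rep f i j)) c5 c2.
    have d3 := continuousB d1 d2.
    exact: (continuous_comp d3 (@norm_continuous _ _ _)).
  have n1 : nbhs ((p, t0) : M * R) [set z | flow_dom psi i j (z.2, chart i z.1)].
    exact: (c3 _ (open_nbhs_nbhs (conj (Wo i j) zW))).
  have n2 : nbhs ((p, t0) : M * R) [set z |
      `|partials s (local_rep (psi z.2) i j) (chart i z.1) -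
        partials s (local_rep f i j) (chart i z.1)| < e].
    exact: (c4 _ (open_nbhs_nbhs (conj (@open_lt _ e) lt))).
  have n3 : nbhs ((p, t0) : M * R) [set z | dom i z.1].
    have c6 : {for (p, t0), continuous (fst : M * R -> M)} by exact: cvg_fst.
    exact: (c6 _ (near_dom ip)).
  apply: filterS (filterI n3 (filterI n1 n2)) => -[q t] /= [iq [/rep_domP[_ _ _]]].
  by rewrite chartK.
by apply: filterS => t tK p Kp; rewrite hE; exact: tK.
Qed.

(** A ball without derivatives suffices: [f] varies by less than [r / 2] on a compact chart ball [K]
    around [p], and [g] is within [r / 2] of [f] on [K]. *)
Lemma diffeo_eval_continuous : continuous (fun z : diffeo M * M => diffeo_fun z.1 z.2).
Proof.
move=> [f p] V /= nV; have [j jp] := dom_cover (f p); have [i ip] := dom_cover p.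
have [r r0 rV] := chart_ball jp nV.
have fc : continuous f by case: (f) => g [[]].
have nI : nbhs p (f @^-1` [set q | dom j q /\ `|chart j q - chart j (f p)| < r / 2]).
  by apply: fc; apply: near_chart => //; rewrite divr_gt0.
have [r' r'0 rV'] := chart_ball ip nI.
pose K : set M := [set q | dom i q /\ `|chart i q - chart i p| <= r' / 2].
have r2 : r' / 2 < r' by lra.
have Kc : compact K.
  apply: chart_ball_compact; first by rewrite divr_ge0// ltW.
  by move=> x xr; have [] := rV' x (le_lt_trans xr r2).
have Kj q : K q -> dom j (f q) /\ `|chart j (f q) - chart j (f p)| < r / 2.
  move=> [iq qr]; have [|_] := rV' (chart i q); first exact: le_lt_trans r2.
  by rewrite chartK.
have nK : nbhs p K.
  have r20 : 0 < r' / 2 by rewrite divr_gt0.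
  by apply: filterS (near_chart ip r20) => q [iq /ltW].
have re : 0 < r / 2 by rewrite divr_gt0.
have nB : nbhs f (diffeo_ball f i j K [::] (r / 2)).
  apply: diffeo_ball_nbhs => //; first by move=> q [].
  by move=> _ [q Kq <-]; have [] := Kj q Kq.
exists (diffeo_ball f i j K [::] (r / 2), K) => // -[g q] /= [gB Kq].
have [jq h1] := gB q Kq; have [iq _] := Kq; have [jfq h2] := Kj q Kq.
move: h1; rewrite /= /local_rep /= chartK// => h1.
have [|_] := rV (chart j (g q)); last by rewrite chartK.
rewrite -(subrKA (chart j (f q))) (le_lt_trans (ler_normD _ _))//.
lra.
Qed.

End DiffeoTopology.

(** * Functions of nonzero weight *)

Section Mean.
Context {R : realType}.
Implicit Types (f g F : R -> R).

Lemma is_derive_MVT F f (x y : R) : x <= y ->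
  (forall s : R, x <= s <= y -> is_derive s (1 : R) F (f s)) ->
  exists2 z, x <= z <= y & F y - F x = f z * (y - x).
Proof.
move=> xy Fd.
have sb (s : R) : 0 <= s <= 1 -> x <= (x + (s * (y - x)) *: 1 : R) <= y.
  by move=> /andP[s0 s1]; rewrite scaler1; nra.
have [s s01] := @MVT_line R R F x 1 (y - x)
  (fun s s01 => @ex_derive _ _ _ _ _ _ _ (Fd _ (sb s s01))).
rewrite scaler1 (addrC x (y - x)) subrK => ->; exists (x + (s * (y - x)) *: 1); first exact: sb.
by rewrite (@derive_val _ _ _ _ _ _ _ (Fd _ (sb s s01))) mulrC.
Qed.

(** The integral starts at [-1], and [is_derive_prim] reaches up to [3], so that two-sided
    derivatives are available on [[0, 2]], where the shifted arguments lie. *)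
Let prim f (x : R) : R := (\int[@lebesgue_measure R]_(t in `[(- 1)%R, x]) f t)%R.

Lemma is_derive_prim f (x : R) : continuous f -> -1 < x < 3 ->
  is_derive x (1 : R) (prim f) (f x).
Proof.
move=> fc /andP[x1 x3].
have fi : (@lebesgue_measure R).-integrable `[(- 1)%R, 3%R] (EFin \o f).
  apply: continuous_compact_integrable; first exact: segment_compact.
  exact: continuous_subspaceT.
have [d dE] := @continuous_FTC1_closed R f (-1) x 3 x3 fi x1 (fc x).
by split; [exact: d|rewrite -derive1E; exact: dE].
Qed.

Definition mean f : R := prim f 1 - prim f 0.

Lemma meanE f F : continuous f ->
  (forall s : R, 0 <= s <= 1 -> is_derive s (1 : R) F (f s)) -> mean f = F 1 - F 0.
Proof.
move=> fc Fd; have D (s : R) : 0 <= s <= 1 -> is_derive s (1 : R) (prim f - F) (f s - f s).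
  move=> s01; apply: is_deriveB; last exact: Fd.
  by apply: is_derive_prim => //; lra.
have [z _] := @is_derive_MVT (prim f - F) (fun s => f s - f s) 0 1 ler01 D.
by rewrite /mean subrr mul0r !fctE /=; lra.
Qed.

Lemma continuous_linear_comb (a b : R) f g : continuous f -> continuous g ->
  continuous (fun s : R => a * f s + b * g s).
Proof.
move=> fc gc; have c (h : R -> R) (k : R) : continuous h -> continuous (fun s => k * h s).
  by move=> hc s; exact: (continuousM (@cst_continuous _ _ k s) (hc s)).
by move=> s; apply: (@continuousD _ _ _ (fun s => a * f s) (fun s => b * g s)); exact: c.
Qed.

Lemma mean_linear (a b : R) f g : continuous f -> continuous g ->
  mean (fun s => a * f s + b * g s) = a * mean f + b * mean g.
Proof.
move=> fc gc; have hc := @continuous_linear_comb a b f g fc gc.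
have D (s : R) : 0 <= s <= 1 ->
    is_derive s (1 : R) (a *: prim f + b *: prim g) (a * f s + b * g s).
  move=> s01; have s13 : -1 < s < 3 by lra.
  exact: (is_deriveD (is_deriveZ a (is_derive_prim fc s13)) (is_deriveZ b (is_derive_prim gc s13))).
by rewrite (meanE hc D) /mean !fctE /= /GRing.scale /=; ring.
Qed.

(** By periodicity [prim f (s + 1) - prim f s] has derivative zero. *)
Lemma mean_shift f (a : R) : continuous f -> (forall s, f (s + 1) = f s) ->
  0 <= a <= 1 -> mean (fun s => f (s + a)) = mean f.
Proof.
move=> fc fp a01.
have tc (b : R) : continuous (fun s : R => s + b).
  by move=> s; apply: (@continuousD _ _ _ id (cst b)); [exact: cvg_id|exact: cst_continuous].
have hc : continuous (fun s => f (s + a)).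
  by move=> s; exact: (continuous_comp (tc a s) (fc (s + a))).
have D0 (s : R) : 0 <= s <= 1 -> is_derive s (1 : R) (fun s => prim f (s + a)) (f (s + a)).
  move=> s01; apply: (@is_derive_translate R R R (prim f)).
  by apply: is_derive_prim => //; lra.
rewrite (meanE hc D0).
have D (s : R) : 0 <= s <= a -> is_derive s (1 : R) ((fun s => prim f (s + 1)) - prim f) (f (s + 1) - f s).
  move=> s0a; apply: is_deriveB; last by apply: is_derive_prim => //; lra.
  by apply: (@is_derive_translate R R R (prim f)); apply: is_derive_prim => //; lra.
have a0 : 0 <= a by case/andP: a01.
have [z _] := is_derive_MVT a0 D.
by rewrite fp subrr mul0r !fctE /= /mean !add0r (addrC a); lra.
Qed.

Lemma mean_value f : continuous f -> exists2 z, 0 <= z <= 1 & mean f = f z.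
Proof.
move=> fc; have D (s : R) : 0 <= s <= 1 -> is_derive s (1 : R) (prim f) (f s).
  by move=> s01; apply: is_derive_prim => //; lra.
have [z z01] := is_derive_MVT ler01 D.
by rewrite subr0 mulr1 => E; exists z.
Qed.

Lemma mean_dist f g (e : R) : continuous f -> continuous g ->
  (forall s : R, 0 <= s <= 1 -> `|f s - g s| <= e) -> `|mean f - mean g| <= e.
Proof.
move=> fc gc fg.
have hc := @continuous_linear_comb 1 (-1) f g fc gc.
have [z z01] := mean_value hc; rewrite mean_linear// !mul1r !mulN1r => ->.
exact: fg.
Qed.

Lemma mean_gt0 f : continuous f -> (forall s : R, 0 <= s <= 1 -> 0 <= f s) -> 0 < f 0 ->
  0 < mean f.
Proof.
move=> fc f0 f00.
have D (s : R) : 0 <= s <= 1 -> is_derive s (1 : R) (prim f) (f s).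
  by move=> s01; apply: is_derive_prim => //; lra.
have : nbhs (0 : R) [set s | f 0 / 2 < f s].
  have : nbhs (f 0) [set t : R | f 0 / 2 < t].
    by apply: open_nbhs_nbhs; split; [exact: open_gt|rewrite /= ltr_pdivrMr// ltr_pMr// ltr1n].
  by move=> /fc.
move=> /nbhs_ballP[d /= d0]; rewrite -ball_normE /= => fd.
pose b := Num.min d 1 / 2.
have m0 : 0 < Num.min d 1 by rewrite lt_min d0 ltr01.
have bd : b < d by have := ge_minl d 1; rewrite /b; lra.
have b1 : b < 1 by have := ge_minr d 1; rewrite /b; lra.
have b0 : 0 < b by rewrite divr_gt0.
have D1 (s : R) : 0 <= s <= b -> is_derive s (1 : R) (prim f) (f s).
  by move=> sb; apply: D; lra.
have D2 (s : R) : b <= s <= 1 -> is_derive s (1 : R) (prim f) (f s).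
  by move=> sb; apply: D; lra.
have [z1 z1b E1] := is_derive_MVT (ltW b0) D1.
have [z2 z2b E2] := is_derive_MVT (ltW b1) D2.
have h1 : f 0 / 2 < f z1 by apply: fd; rewrite /= sub0r normrN ger0_norm; lra.
have h2 : 0 <= f z2 by apply: f0; lra.
rewrite /mean; have := mulr_gt0 (lt_trans (divr_gt0 f00 (ltr0n _ 2)) h1) b0.
have h3 : 0 <= 1 - b by lra.
have := mulr_ge0 h2 h3; lra.
Qed.

End Mean.

Lemma mean_family_continuous (R : realType) (T : topologicalType) (f : T -> R -> R) :
  continuous (fun z : T * R => f z.1 z.2) -> continuous (fun x => mean (f x)).
Proof.
move=> fc x0; have fs x : continuous (f x).
  move=> s; have c : {for s, continuous (fun s : R => (x, s))}.
    by apply: continuous_pairing; [exact: cst_continuous|exact: cvg_id].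
  exact: (continuous_comp (g := fun z : T * R => f z.1 z.2) c (fc (x, s))).
apply/cvgrPdist_le => e e0.
have /compact_near_coveringP K01 := @segment_compact R 0 1.
pose P (x : T) (s : R) : Prop := `|f x0 s - f x s| <= e.
have : \forall x \near x0, `[0, 1]%classic `<=` P x.
  refine (K01 T (nbhs x0) P _ _) => s _.
  have c1 : {for (s, x0), continuous (fun z : R * T => f x0 z.1)}.
    have c : {for (s, x0), continuous (fst : R * T -> R)} by exact: cvg_fst.
    exact: (continuous_comp c (fs x0 s)).
  have c2 : {for (s, x0), continuous (fun z : R * T => f z.2 z.1)}.
    have c : {for (s, x0), continuous (fun z : R * T => (z.2, z.1))}.
      by apply: continuous_pairing; [exact: cvg_snd|exact: cvg_fst].
    exact: (continuous_comp (g := fun z : T * R => f z.1 z.2) c (fc (x0, s))).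
  have /cvgrPdist_le/(_ e e0) := continuousB c1 c2.
  by apply: filterS => -[s' x]; rewrite !fctE /= subrr sub0r normrN.
apply: filterS => x xP; apply: mean_dist => // s s01; apply: xP.

Qed.

(** * Fourier coefficients along the orbits *)

Section Weights.
Context {R : realType} {M : topologicalType}.
Hypothesis M_hausdorff : hausdorff_space M.
Hypothesis M_compact : compact [set: M].
Variable act : R -> M -> M.
Hypothesis act_cont : continuous (fun z : R * M => act z.1 z.2).
Hypothesis act0 : forall p, act 0 p = p.
Hypothesis actD : forall a b p, act (a + b) p = act a (act b p).
Hypothesis act1 : forall p, act 1 p = p.

Let actMn (k : nat) s p : act s p = p -> act (k%:R * s) p = p.
Proof.
move=> sp; elim: k => [|k IH]; first by rewrite mul0r act0.
by rewrite -natr1 mulrDl mul1r actD sp.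
Qed.

Let act_int (k : int) p : act k%:~R p = p.
Proof.
have nat_case (j : nat) : act j%:R p = p by rewrite -[j%:R]mulr1 actMn.
case: k => [j|j]; first exact: nat_case.
by rewrite -[X in act _ X](nat_case j.+1) -actD NegzE rmorphN /= addNr act0.
Qed.

(** Positive periods are at least [d], and so are their positive differences; hence their infimum
    [tau] is attained and each period is a multiple of it, in particular [1 = m * tau]. *)
Lemma minimal_period p (d : R) : 0 < d -> (forall s, 0 < s < d -> act s p <> p) ->
  exists2 m : nat, (0 < m)%N & forall s, 0 <= s -> act s p = p ->
    exists k : int, m%:R * s = k%:~R.
Proof.
move=> d0 dP; pose S := [set s : R | 0 < s /\ act s p = p].
have S1 : S 1 by split.
have Sd s : S s -> d <= s.
  move=> [s0 sp]; rewrite leNgt; apply/negP => sd.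
  by apply: (dP s _ sp); rewrite s0.
have hS : has_inf S by split; [exists 1|exists d].
pose tau := inf S.
have taud : d <= tau by apply: lb_le_inf => //; exists 1.
have tau0 : 0 < tau by exact: lt_le_trans taud.
have tauS s : S s -> tau <= s by move=> Ss; apply: ge_inf => //; case: hS.
have taup : act tau p = p.
  have [x Sx xd] := inf_adherent d0 hS; rewrite -/tau in xd.
  have := tauS x Sx; rewrite le_eqVlt => /predU1P[->|tx]; first by case: Sx.
  have [|y Sy yx] := @inf_adherent _ S (x - tau) _ hS; first by rewrite subr_gt0.
  rewrite -/tau in yx; have yx' : y < x by lra.
  have := tauS y Sy => ty; case: (dP (x - y)); first by apply/andP; split; lra.
  by have [_ xp] := Sx; have [_ yp] := Sy; rewrite -[in LHS]yp -actD subrK.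
have mult s : 0 <= s -> act s p = p -> exists k : nat, s = k%:R * tau.
  move=> s0 sp; exists (Num.truncn (s / tau)); set k := Num.truncn _.
  have /andP[] : k%:R <= s / tau < k.+1%:R by apply: truncn_itv; rewrite divr_ge0// ltW.
  rewrite ler_pdivlMr// ltr_pdivrMr// -natr1 mulrDl mul1r => ks sk.
  apply/eqP; rewrite eq_le ks andbT leNgt; apply/negP => ks'.
  suff : tau <= s - k%:R * tau by lra.
  apply: tauS; split; first by lra.
  by rewrite -[X in act _ X](actMn k taup) -actD subrK.
have [m mE] := mult 1 ler01 (act1 p).
exists m; first by case: m mE => // /eqP; rewrite mul0r oner_eq0.
move=> s s0 sp; have [k ->] := mult s s0 sp; exists (Posz k).
by rewrite mulrCA -mE mulr1.
Qed.

(* [u + i v] is a Fourier coefficient, along the orbits, of a bump function [phi]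
   around [p]; its degree [m] is the order of the stabilizer of [p], and [phi]
   vanishes at the points [act s p] where [cs (m * s)] is not positive. *)
Lemma weight_exists p (d : R) : 0 < d -> (forall s, 0 < s < d -> act s p <> p) ->
  exists (m : nat) (u v : M -> R),
    [/\ (0 < m)%N, continuous u, continuous v, 0 < u p ^+ 2 + v p ^+ 2 &
    forall a x,
      u (act a x) = cs (m%:R * a) * u x - sn (m%:R * a) * v x /\
      v (act a x) = sn (m%:R * a) * u x + cs (m%:R * a) * v x].
Proof.
move=> d0 dP; have [m m0 mP] := minimal_period d0 dP.
have mulc (k : R) : continuous (fun s : R => k * s).
  by move=> s; exact: (continuousM (@cst_continuous R R k s) (@cvg_id _ (nbhs s))).
have csc : continuous (fun s : R => cs (m%:R * s)).
  move=> s; have c := continuous_comp (mulc (2 * pi) (m%:R * s)) (@continuous_cos R _).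
  exact: (continuous_comp (mulc m%:R s) c).
have snc : continuous (fun s : R => sn (m%:R * s)).
  move=> s; have c := continuous_comp (mulc (2 * pi) (m%:R * s)) (@continuous_sin R _).
  exact: (continuous_comp (mulc m%:R s) c).
(* [S] is compact and its image avoids [p]: if [act s p = p], then [m * s] is an integer and the
   cosine is [1]. *)
pose S := `[0, 1]%classic `&` [set s : R | cs (m%:R * s) <= 0].
pose B := act^~ p @` S.
have Bc : closed B.
  apply: compact_closed => //; apply: continuous_compact.
    apply: continuous_subspaceT => s.
    have c : {for s, continuous (fun s : R => (s, p))}.
      by apply: continuous_pairing; [exact: cvg_id|exact: cst_continuous].
    exact: (continuous_comp (g := fun z : R * M => act z.1 z.2) c (@act_cont _)).
  apply: compact_closedI; first exact: segment_compact.
  by apply: (closed_comp (f := fun s : R => cs (m%:R * s)) _ (@closed_le _ 0)) => s _; exact: csc.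
have Ac : closed [set p].
  by apply: accessible_closed_set1; exact: hausdorff_accessible.
have BA : B `&` [set p] = set0.
  rewrite -subset0 => _ [[s [s01 cs0] <-] /= sp].
  have s0 : 0 <= s by move: s01; rewrite /= in_itv /= => /andP[].
  have [k kE] := mP s s0 sp; have [c1 _] := @cs_sn_int R k.
  by move: cs0; rewrite /= kE c1 ler10.
have /(@uniform_separatorP _ R) [phi [phic phi01 phiB phiA]] : uniform_separator B [set p].
  have /normal_separatorP nM := compact_normal M_hausdorff M_compact.
  exact: nM.
have phi_ge0 (x : M) : 0 <= phi x.
  by have : range phi (phi x) by [exists x]; move=> /phi01; rewrite /= in_itv /= => /andP[].
pose F x (s : R) := phi (act s x) * cs (m%:R * s).
(* The sign makes [F + i G] equal to [phi (act s x) exp (- 2 i pi m s)], whose mean has weight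
   [m]. *)
pose G x (s : R) := - phi (act s x) * sn (m%:R * s).
have phiact : continuous (fun z : M * R => phi (act z.2 z.1)).
  move=> z; have c : {for z, continuous (fun z : M * R => (z.2, z.1))}.
    by apply: continuous_pairing; [exact: cvg_snd|exact: cvg_fst].
  have c2 := continuous_comp (g := fun z : R * M => act z.1 z.2) c (@act_cont _).
  exact: (continuous_comp c2 (phic _)).
have sndc : continuous (snd : M * R -> R) by move=> z; exact: cvg_snd.
have Fc : continuous (fun z : M * R => F z.1 z.2).
  by move=> z; exact: (continuousM (phiact z) (continuous_comp (sndc z) (csc _))).
have Gc : continuous (fun z : M * R => G z.1 z.2).
  by move=> z; exact: (continuousM (continuousN (phiact z)) (continuous_comp (sndc z) (snc _))).
have pairc (x : M) (s : R) : {for s, continuous (fun s : R => (x, s))}.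
  by apply: continuous_pairing; [exact: cst_continuous|exact: cvg_id].
have Fxc x : continuous (F x).
  by move=> s; exact: (continuous_comp (g := fun z : M * R => F z.1 z.2) (pairc x s) (Fc _)).
have Gxc x : continuous (G x).
  by move=> s; exact: (continuous_comp (g := fun z : M * R => G z.1 z.2) (pairc x s) (Gc _)).
exists m, (fun x => mean (F x)), (fun x => mean (G x)); split => //.
- exact: mean_family_continuous.
- exact: mean_family_continuous.
- apply: ltr_wpDr; first exact: sqr_ge0.
  (* By the choice of [phi], the integrand [F p] is nonnegative, and it is [1] at [0]. *)
  rewrite exprn_gt0//; apply: mean_gt0 => //.
    move=> s s01; rewrite /F; have [cs0|/ltW cs0] := leP (cs (m%:R * s)) 0.
      suff -> : phi (act s p) = 0 by rewrite mul0r.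
      by apply: phiB; exists (act s p) => //; exists s => //; split=> //=; rewrite in_itv.
    exact: mulr_ge0.
  have -> : F p 0 = 1.
    have [c1 _] := @cs_sn_int R 0; rewrite /F act0 mulr0 c1 mulr1.
    by apply: phiA; exists p.
  exact: ltr01.
have rot x (a : R) : 0 <= a <= 1 ->
    mean (F (act a x)) = cs (m%:R * a) * mean (F x) - sn (m%:R * a) * mean (G x) /\
    mean (G (act a x)) = sn (m%:R * a) * mean (F x) + cs (m%:R * a) * mean (G x).
  move=> a01.
  have per (s : R) : act (s + 1) x = act s x by rewrite actD act1.
  have [c1 s1] := @cs_sn_int R m%:Z; rewrite -pmulrn in c1 s1.
  have csp (s : R) : cs (m%:R * (s + 1)) = cs (m%:R * s).
    by rewrite mulrDr mulr1 csD c1 s1; ring.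
  have snp (s : R) : sn (m%:R * (s + 1)) = sn (m%:R * s).
    by rewrite mulrDr mulr1 snD c1 s1; ring.
  have FE : mean (F x) = mean (fun s => F x (s + a)).
    by rewrite mean_shift// => s; rewrite /F per csp.
  have GE : mean (G x) = mean (fun s => G x (s + a)).
    by rewrite mean_shift// => s; rewrite /G per snp.
  have tc : continuous (fun s : R => s + a).
    by move=> s; apply: (@continuousD _ _ _ id (cst a)); [exact: cvg_id|exact: cst_continuous].
  have Fac : continuous (fun s => F x (s + a)).
    by move=> s; exact: (continuous_comp (tc s) (Fxc x (s + a))).
  have Gac : continuous (fun s => G x (s + a)).
    by move=> s; exact: (continuous_comp (tc s) (Gxc x (s + a))).
  rewrite FE GE -mulNr -!mean_linear//.
  split; congr mean; apply/funext => s; rewrite /F /G -actD.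
    have -> : m%:R * s = m%:R * (s + a) - m%:R * a by ring.
    by rewrite csB; ring.
  have -> : m%:R * s = m%:R * (s + a) - m%:R * a by ring.
  by rewrite snB; ring.
(* [rot] covers [[0, 1]], and integers act trivially. *)
move=> a x; have [k [r r01 ->]] : exists k : int, exists2 r : R, 0 <= r <= 1 & a = r + k%:~R.
  exists (Num.floor a), (a - (Num.floor a)%:~R); last by rewrite subrK.
  by have := floor_itv a; rewrite intrD; lra.
rewrite actD act_int; have [c1 s1] := @cs_sn_int R (m%:Z * k).
have E : m%:R * k%:~R = (m%:Z * k)%:~R :> R by rewrite intrM.
rewrite [m%:R * (r + _)]mulrDr E csD snD c1 s1 !mulr1 !mulr0 subr0 addr0.
exact: rot.
Qed.

End Weights.

Lemma weights_exist (R : realType) (M : topologicalType) (act : R -> M -> M) :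
  hausdorff_space M -> compact [set: M] ->
  continuous (fun z : R * M => act z.1 z.2) ->
  (forall p, act 0 p = p) -> (forall a b p, act (a + b) p = act a (act b p)) ->
  (forall p, act 1 p = p) ->
  (forall p, exists2 d : R, 0 < d & forall s : R, 0 < s < d -> act s p <> p) ->
  exists (q : nat) (u v : 'I_q -> M -> R) (w : 'I_q -> R),
    [/\ forall l, continuous (u l) /\ continuous (v l),
        forall p, exists l, 0 < u l p ^+ 2 + v l p ^+ 2, forall l, w l != 0 &
        forall l a x,
          u l (act a x) = cs (w l * a) * u l x - sn (w l * a) * v l x /\
          v l (act a x) = sn (w l * a) * u l x + cs (w l * a) * v l x].
Proof.
move=> hM cM act_cont act0 actD act1 actP.
have /choice[m /choice[u /choice[v uvP]]] p := let: ex_intro2 d d0 dP := actP p in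
  weight_exists hM cM act_cont act0 actD act1 d0 dP.
(* Finite lists ordered by inclusion: with this filter, the near-covering form of compactness
   extracts a finite subcover. *)
pose F := filter_from [set: seq M] (fun l0 : seq M => [set l : seq M | {subset l0 <= l}]).
have FF : Filter F.
  apply: filter_from_filter; first by exists [::].
  move=> l1 l2 _ _; exists (l1 ++ l2) => // l h.
  by split=> x xl; apply: h; rewrite mem_cat xl ?orbT.
pose P (l : seq M) (x : M) : Prop := exists2 p, p \in l & 0 < u p x ^+ 2 + v p x ^+ 2.
have /compact_near_coveringP cv := cM.
have [] : \near F, [set: M] `<=` P F.
  refine (cv _ F P FF _) => p _; have [_ uc vc up _] := uvP p.
  have c : {for p, continuous (fun x => u p x ^+ 2 + v p x ^+ 2)}.
    have c1 := continuousM (uc p) (uc p); have c2 := continuousM (vc p) (vc p).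
    exact: (continuousD c1 c2).
  exists ([set x | 0 < u p x ^+ 2 + v p x ^+ 2], [set l : seq M | p \in l]).
    split=> /=; first exact: (c _ (open_nbhs_nbhs (conj (@open_gt _ 0) up))).
    by exists [:: p] => // l h; apply: h; rewrite mem_head.
  by move=> [x l] /= [xp pl]; exists p.
move=> l0 _ /(_ l0 (fun x h => h)) lP.
pose c (l : 'I_(size l0)) := tnth (in_tuple l0) l.
exists (size l0), (u \o c), (v \o c), (fun l => (m (c l))%:R).
split=> [l|p|l|l a x] /=; have := uvP.
- by move=> /(_ (c l))[].
- move=> _; have [p' p'l h] := lP p I; have /tnthP[l p'E] : p' \in in_tuple l0 by [].
  by exists l; rewrite /c -p'E.
- by move=> /(_ (c l))[m0 _ _ _ _]; rewrite pnatr_eq0 -lt0n.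
- by move=> /(_ (c l))[_ _ _ _ h]; exact: h.
Qed.

Section Clamp.
Context {R : realType}.

(** Retraction onto [[0, 1]]: a homotopy continuous within the square extends to one continuous on
    the plane, as [homotopy_contradiction] requires. *)
Definition clamp (t : R) : R := Num.max 0 (Num.min t 1).

Lemma clamp_in t : 0 <= clamp t <= 1.
Proof. by rewrite /clamp le_max lexx /= ge_max ler01 ge_min lexx orbT. Qed.

Lemma clamp_id t : 0 <= t <= 1 -> clamp t = t.
Proof. by move=> /andP[t0 t1]; rewrite /clamp (min_idPl t1) (max_idPr t0). Qed.

Lemma clamp_continuous : continuous clamp.
Proof.
move=> t; have idc : {for t, continuous (id : R -> R^o)} by exact: cvg_id.
have c1 : {for t, continuous (cst 1 : R -> R^o)} by exact: cst_continuous.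
have c0 : {for t, continuous (cst 0 : R -> R^o)} by exact: cst_continuous.
exact: (continuous_max c0 (continuous_min idc c1)).
Qed.

End Clamp.

Lemma within_continuous_comp (S T U : topologicalType) (A : set T) (f : T -> U) (g : S -> T) :
  {within A, continuous f} -> continuous g -> (forall x, A (g x)) -> continuous (f \o g).
Proof.
move=> /subspace_continuousP fc gc Ag x V /(fc (g x) (Ag x)) /= fV.
have nx : nbhs x (g @^-1` [set y | A y -> V (f y)]) by exact: (gc x _ fV).
by apply: filterS nx => y /= h; apply: h.
Qed.

(** * Loops of pseudo-Hermitian transformations *)

Section PshTopology.
Context {R : realType} {n : nat} {M : manifold R n} {eta : one_form M}.
Variable J : pseudo_hermitian eta.

Lemma diffeo_inj : injective (@diffeo_fun R n M).
Proof.
move=> [f fP] [g gP] /= fg; move: fP; rewrite fg => fP.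
by congr Diffeo; exact: Prop_irrelevance.
Qed.

Lemma Psh_inj (g h : Psh J) : (set_val g : M -> M) = set_val h -> g = h.
Proof. by move=> gh; apply: val_inj; exact: diffeo_inj. Qed.

Lemma Psh_continuous (T : topologicalType) (f : T -> Psh J) :
  continuous (fun t => set_val (f t) : diffeo M) -> continuous f.
Proof.
move=> /continuousP fc; apply/continuousP => _ [B Bo <-]; exact: fc.
Qed.

Lemma Psh_val (g : Psh J) : smooth_map (set_val g) /\ pullback_eq (set_val g) eta.
Proof.
have [ge _] := set_valP g; split=> //.
by have [] := diffeoP (set_val g).
Qed.

End PshTopology.

Section FlowFacts.
Context {R : realType} {n : nat} {M : manifold R n} {eta : one_form M}.
Variables (xi : vector_field M) (psi : R -> M -> M).
Hypothesis xi_reeb : is_reeb eta xi.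
Hypothesis psi_flow : is_flow xi psi.

(** [xi] does not vanish since [eta (xi) = 1]. A return at time [s] would make the difference
    quotient zero, at distance [|xi|] from its limit. *)
Lemma reeb_flow_moves p : exists2 d : R, 0 < d & forall s : R, 0 < s < d -> psi s p <> p.
Proof.
have [psi0 psip] := psi_flow; have [_ psid] := psip p.
have [i ip] := dom_cover p.
have ip0 : dom i (psi 0 p) by rewrite psi0.
have [d dE] := psid i 0 ip0; rewrite psi0 in dE.
have xi0 : xi i p != 0.
  apply/negP => /eqP xi0; have [] := xi_reeb ip; rewrite xi0 /pair_cv mul0mx mxE.
  by move=> /esym/eqP; rewrite oner_eq0.
have dc : h^-1 *: (chart i (psi (h *: 1 + 0) p) - chart i (psi 0 p)) @[h --> 0^'] --> xi i p.
  by rewrite -dE; exact: d.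
have nx : 0 < `|xi i p| by rewrite normr_gt0.
move/cvgrPdist_lt : dc => /(_ _ nx).
move=> /nbhs_ballP[e /= e0]; rewrite -ball_normE /= => he.
exists e => // s /andP[s0 se] sp.
have := he s; rewrite /= sub0r normrN (gtr0_norm s0) => /(_ se).
rewrite gt_eqF// => /(_ isT).
by rewrite scaler1 addr0 sp psi0 subrr scaler0 subr0 ltxx.
Qed.

End FlowFacts.

Theorem theorem4p4 (R : realType) (k : nat) (M : manifold R k.*2.+1)
    (M_nonempty : [set: M] !=set0) (M_closed : closed_manifold M)
    (eta : one_form M) (eta_contact : is_contact eta)
    (J : pseudo_hermitian eta)
    (xi : vector_field M) (xi_reeb : is_reeb eta xi)
    (psi : R -> M -> M) (psi_flow : is_flow xi psi)
    (eta_regular : periodic_orbits psi)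
    (psi_Psh : forall t, exists2 h : diffeo M, Psh J h & psi t = h)
    (psi_periodic : exists2 T : R, 0 < T & psi T = idfun) :
  infinite_set (pi1 R (Psh_id J)).
Proof.
have [T T0 psiT] := psi_periodic; have [p0 _] := M_nonempty.
have [psi0 psip] := psi_flow; have psiD := flow_add psi_flow.
have psi_smooth t : smooth_map (psi t).
  by have [h _ ->] := psi_Psh t; case: h => f /= [].
have psi_cont t : continuous (psi t) by case: (psi_smooth t).
have psi_jc := flow_continuous (flow_integral_curve psi_flow) psi0 psiD psi_cont.
(* Time is rescaled so that [1] is a period, not necessarily the least one. *)
pose act (a : R) := psi (T * a).
have act0 p : act 0 p = p by rewrite /act mulr0.
have actD (a b : R) p : act (a + b) p = act a (act b p) by rewrite /act mulrDr psiD.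
have act1 p : act 1 p = p by rewrite /act mulr1 psiT.
have Tc : continuous (fun s : R => T * s).
  by move=> s; exact: (continuousM (@cst_continuous R R T s) (@cvg_id _ (nbhs s))).
have act_cont : continuous (fun z : R * M => act z.1 z.2).
  move=> z; have c : {for z, continuous (fun z : R * M => (T * z.1, z.2))}.
    apply: continuous_pairing; last exact: cvg_snd.
    have c1 : {for z, continuous (fst : R * M -> R)} by exact: cvg_fst.
    exact: (continuous_comp c1 (Tc _)).
  exact: (continuous_comp (g := fun z : R * M => psi z.1 z.2) c (@psi_jc _)).
have act_moves p : exists2 d : R, 0 < d & forall s : R, 0 < s < d -> act s p <> p.
  have [d d0 dP] := reeb_flow_moves xi_reeb psi_flow p.
  exists (d / T); first exact: divr_gt0.
  move=> s /andP[s0 sd]; apply: dP; rewrite mulr_gt0//=.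
  by rewrite mulrC -ltr_pdivlMr.
have [q [u [v [w [uvc uv_neq0 w_neq0 uv_act]]]]] := weights_exist
  (@space_hausdorff _ _ M) M_closed act_cont act0 actD act1 act_moves.
have hex t : exists h : diffeo M, Psh J h /\ psi t = h.
  by have [h] := psi_Psh t; exists h.
have [h hP] := choice hex.
have h_cont : continuous h.
  apply: (@flow_diffeo_continuous _ _ _ psi).
  - by move=> i j l r; exact: flow_jet.
  - by move=> i j; exact: flow_dom_open.
  - by move=> t; rewrite (hP t).2.
pose g t : Psh J := exist _ (h t) (mem_set (hP t).1).
have gE t : (set_val (g t) : M -> M) = psi t by rewrite set_valE /= (hP t).2.
have g_cont : continuous g by apply: Psh_continuous.
pose gam (n : nat) (t : R) := g (T * (n%:R * t)).
have actn (n : nat) p : act n%:R p = p.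
  by elim: n => [//|n IH]; rewrite -natr1 actD act1.
have gam_loop n : is_loop (Psh_id J) (gam n).
  split.
  - apply: continuous_subspaceT => t.
    have c1 : {for t, continuous (fun s : R => n%:R * s)}.
      exact: (continuousM (@cst_continuous R R n%:R t) (@cvg_id _ (nbhs t))).
    have c2 := continuous_comp c1 (Tc _).
    exact: (continuous_comp c2 (g_cont _)).
  - by apply: Psh_inj; rewrite /gam gE; apply/funext => p; rewrite !mulr0 psi0.
  - apply: Psh_inj; rewrite /gam gE; apply/funext => p; rewrite mulr1.
    exact: actn.
pose cls (n : nat) := [set d | is_loop (Psh_id J) d /\ loop_homotopic (Psh_id J) (gam n) d].
have cls_pi1 n : pi1 R (Psh_id J) (cls n) by exists (gam n).
have cls_inj n n' : cls n = cls n' -> n = n'.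
  (* The constant homotopy puts [gam n'] in [cls n'], hence in [cls n], which provides a homotopy
     from [gam n]. *)
  move=> E; have [_ [H [Hc H0 H1 Hs]]] : cls n (gam n').
    rewrite E; split=> //; exists (fun z => gam n' z.2); split=> //.
    - apply: continuous_subspaceT => z.
      have c1 : {for z, continuous (snd : R * R -> R)} by exact: cvg_snd.
      have c2 : {for z.2, continuous (fun s : R => n'%:R * s)}.
        exact: (continuousM (@cst_continuous R R n'%:R _) (@cvg_id _ (nbhs z.2))).
      have c3 := continuous_comp c1 (continuous_comp c2 (Tc _)).
      exact: (continuous_comp c3 (g_cont _)).
    - move=> s s01; have [_ e0 e1] := gam_loop n'.
      by rewrite /= e0 e1.
  apply/eqP/negPn/negP => nn'.
  pose K s t p : M := (set_val (H (clamp s, clamp t)) : M -> M) p.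
  have Hclamp : continuous (fun z : R * R => H (clamp z.1, clamp z.2)).
    have gc (z : R * R) : {for z, continuous (fun z : R * R => (clamp z.1, clamp z.2))}.
      have c1 : {for z, continuous (fst : R * R -> R)} by exact: cvg_fst.
      have c2 : {for z, continuous (snd : R * R -> R)} by exact: cvg_snd.
      exact: (continuous_pairing (continuous_comp c1 (@clamp_continuous R _))
        (continuous_comp c2 (@clamp_continuous R _))).
    apply: (within_continuous_comp Hc gc).
    by move=> z; split=> /=; rewrite in_itv /=; exact: clamp_in.
  have K_cont : continuous (fun z : R * R * M => K z.1.1 z.1.2 z.2).
    move=> z; have c1 : {for z, continuous (fun z : R * R * M =>
        (set_val (H (clamp z.1.1, clamp z.1.2)) : diffeo M))}.
      have d1 : {for z, continuous (fst : R * R * M -> R * R)} by exact: cvg_fst.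
      have d2 := continuous_comp d1 (Hclamp _).
      exact: (continuous_comp d2 (@initial_continuous _ _ (set_val : Psh J -> diffeo M) _)).
    have c2 : {for z, continuous (snd : R * R * M -> M)} by exact: cvg_snd.
    exact: (continuous_comp (continuous_pairing c1 c2) (@diffeo_eval_continuous _ _ M _)).
  have cl0 : clamp (0 : R) = 0 by rewrite clamp_id// lexx ler01.
  have cl1 : clamp (1 : R) = 1 by rewrite clamp_id// lexx ler01.
  have nn'R : n%:R != n'%:R :> R by rewrite eqr_nat.
  apply: (homotopy_contradiction (act := act) (u := u) (v := v) (w := w) (H := K)
    (n := n%:R) (n' := n'%:R) M_closed (fun l => (uvc l).1) (fun l => (uvc l).2)
    uv_neq0 w_neq0 (fun l a x => (uv_act l a x).1) (fun l a x => (uv_act l a x).2)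
    K_cont _ _ _ _ _ p0 (ler0n _ _) (ler0n _ _) nn'R).
  - move=> s t a p; have [fs fe] := Psh_val (H (clamp s, clamp t)).
    exact: (flow_commute J xi_reeb psi_flow).
  - move=> s p s01; rewrite /K cl0 clamp_id//.
    by have [->] := Hs s s01.
  - move=> s p s01; rewrite /K cl1 clamp_id//.
    by have [_ ->] := Hs s s01.
  - by move=> t p t01; rewrite /K cl0 clamp_id// H0// gE.
  - by move=> t p t01; rewrite /K cl1 clamp_id// H1// gE.
move=> fin; apply: infinite_nat.
have -> : [set: nat] = cls @^-1` pi1 R (Psh_id J).
  by apply/seteqP; split=> [n _|//]; exact: cls_pi1.
by apply: finite_preimage => // n n' _ _; exact: cls_inj.
Qed.
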